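(* Fix $p\ge 1$. There is a constant $C_p$ depending only on $p$ and an absolute constant $c_0$ such that the following holds for every sufficiently small $\varepsilon>0$. There is a randomized algorithm which, given a matrix $A\in\mathbb{R}^{n\times d}$, a function $f\in\mathsf{Lip}_L$, the parameter $\varepsilon$, and query access to the entries of an unknown vector $b\in\mathbb{R}^n$, makes at most $C_p\, \frac{d^{\max\{1,p/2\}}}{\varepsilon^{\max\{2,p\}}}\,(\log(d/\varepsilon))^{c_0}$ queries to entries of $b$ and, with probability at least $0.9$, returns $\hat x\in\mathbb{R}^d$ such that $$\|f(A\hat x)-b\|_p^p\le \mathsf{OPT}+\varepsilon\big(\mathsf{OPT}+L^p\|Ax^*\|_p^p\big).$$
   Context: For $L\ge 0$, $\mathsf{Lip}_L$ is the set of functions $f:\mathbb{R}\to\mathbb{R}$ with $f(0)=0$ and $|f(x)-f(y)|\le L|x-y|$ for all $x,y$. For $u\in\mathbb{R}^n$, $f(u)$ denotes $f$ applied entrywise. $\mathsf{OPT}:=\min_{x\in\mathbb{R}^d}\|f(Ax)-b\|_p^p$, and $x^*$ is a minimizer of $\|Ax\|_p^p$ among all $x$ with $\|f(Ax)-b\|_p^p=\mathsf{OPT}$. The algorithm may use an exact solver for optimization problems of the form $\min_x \|S'(f(A'x)-b')\|_p^p+\tau\|A''x\|_p^p$; only the number of queried entries of $b$ is counted (the algorithm has full access to $A$ and $f$). *)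

(* Defs.v *)
From HB Require Import structures.
From mathcomp Require Import all_boot all_order all_algebra.
From mathcomp Require Import all_classical all_reals all_analysis.
Set Implicit Arguments. Unset Strict Implicit. Unset Printing Implicit Defensive.
Import Order.TTheory GRing.Theory Num.Theory.
Local Open Scope ring_scope.

Definition Lip (R : realType) (L : R) (f : R -> R) : Prop :=
  f 0 = 0 /\ forall x y : R, `|f x - f y| <= L * `|x - y|.

Definition lpp (R : realType) (n : nat) (p : R) (v : 'cV[R]_n) : R :=
  \sum_(i < n) `|v i 0| `^ p.

Definition resid (R : realType) (n d : nat) (p : R) (f : R -> R)
  (A : 'M[R]_(n, d)) (b : 'cV[R]_n) (x : 'cV[R]_d) : R :=
  lpp p (map_mx f (A *m x) - b).

(* Answer of the oracle for b to a query (None = a wasted query, answer 0). *)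
Definition oracle (R : realType) (n : nat) (b : 'cV[R]_n) (q : option 'I_n) : R :=
  if q is Some i then b i 0 else 0.

(* Transcript of an adaptive query strategy after k queries: the next queried
   index is chosen as a function of the answers received so far. *)
Fixpoint transcript (R : realType) (n : nat) (b : 'cV[R]_n)
  (qry : seq R -> option 'I_n) (k : nat) : seq R :=
  match k with
  | 0 => [::]
  | k'.+1 => let s := transcript b qry k' in rcons s (oracle b (qry s))
  end.

(* Main.v *)
(* Approximately maximising |det M| under sum_i |a_i M|^p <= 1 (a_i the rows of A) puts the
   column space of A in a Lewis-type position U: its rows u_i satisfy sum_i |u_i|^p <= d and
   |x|^2 <= C_p sum_i |u_i|^(p-2) <u_i, x>^2.  Draw m rows independently, row i with
   probability of order |u_i|^p / d, and minimise, up to a factor 1 + eps/C, the reweighted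
   sampled loss plus (eps/C) L^p |Ax|_p^p, where L is the least Lipschitz constant of f.

   The increment of the sampled loss from xstar is uniformly close to its expectation, at every
   scale of |Ax|_p: symmetrise with a second sample and random signs, then chain over nets for
   the sup norm on the sampled rows.  Such nets come from a perceptron argument: in the dual of
   a Euclidean norm, greedy steps of size t reach every point after about t^-2 of them, and a
   multiscale restart improves this to t^-min(p,2).  For p < 2 the Euclidean norm is the
   sampled quadratic form, which dominates half of the true one.  Rows where f(A xstar) - b is
   too large for the current scale are dropped, as their loss hardly varies.

   Row i is drawn as g k with k uniform in 'I_(2n), so that all probabilities are counting
   ratios over the finite set of samples. *)

Require Import Defs.
From HB Require Import structures.
From mathcomp Require Import all_boot all_order all_algebra.
From mathcomp Require Import all_classical all_reals all_analysis.
From mathcomp Require Import perm ring lra.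
Set Implicit Arguments. Unset Strict Implicit. Unset Printing Implicit Defensive.
Import Order.TTheory GRing.Theory Num.Theory.
Local Open Scope ring_scope.

(** Single entries of the noise [f (A xstar) - b] are unbounded, so the sampled loss does not
    concentrate; only its increments do. A step v at a row of size y changes the loss by about v
    y^(p-1), where y may reach the noise that is kept, of order B/eps at unit scale; here B bounds
    |x| when |Ax|_p <= 1. For p > 2 the square is at most v^2 (B/eps)^(p-2) y^p, and the weighted
    sum of y^p is bounded. With weights of order W, accuracy eps thus costs W B^p / eps^p samples; W
    ~ d and B ~ d^(1/2-1/p) give d^(p/2) / eps^p. For p <= 2 the square is at most v^p y^p, B is
    constant, and d / eps^2 results. Along the chain, the logarithm of the net at resolution t grows
    like t^(-min(p,2)), while the variance of a link shrinks like t^min(p,2): all links have the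
    same tail, and only logarithms are lost. The regulariser does two things. It bounds |A xh|_p^p
    by O(1/eps) times the value at xstar, so that logarithmically many dyadic scales contain every
    candidate xh; and it pays for the deviation, which is proportional to the scale. *)

(** * Uniform probability on finite sets, and elementary tail bounds *)

Section FiniteProbability.
Variable R : realType.

(** Expectation under the uniform law. On an empty type it is 0, as [0^-1 = 0]. *)
Definition Ex (T : finType) (f : T -> R) : R := (\sum_t f t) / #|T|%:R.

Definition Pr (T : finType) (P : T -> Prop) : R := Ex (fun t => (`[< P t >])%:R).

Lemma Ex_le (T : finType) (f g : T -> R) :
  (forall t, f t <= g t) -> Ex f <= Ex g.
Proof. by move=> fg; apply: ler_wpM2r; [rewrite invr_ge0 ler0n|exact: ler_sum]. Qed.

Lemma eq_Ex (T : finType) (f g : T -> R) : f =1 g -> Ex f = Ex g.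
Proof. by move=> fg; rewrite /Ex; congr (_ / _); apply: eq_bigr => t _. Qed.

Lemma Ex_ge0 (T : finType) (f : T -> R) : (forall t, 0 <= f t) -> 0 <= Ex f.
Proof. by move=> f0; rewrite divr_ge0 // sumr_ge0. Qed.

Lemma ExD (T : finType) (f g : T -> R) : Ex (fun t => f t + g t) = Ex f + Ex g.
Proof. by rewrite /Ex big_split mulrDl. Qed.

Lemma ExZ (T : finType) (c : R) (f : T -> R) : Ex (fun t => c * f t) = c * Ex f.
Proof. by rewrite /Ex -mulr_sumr mulrA. Qed.

Lemma Ex_sum (T : finType) (J : Type) (s : seq J) (P : pred J) (f : J -> T -> R) :
  Ex (fun t => \sum_(j <- s | P j) f j t) = \sum_(j <- s | P j) Ex (f j).
Proof. by rewrite /Ex exchange_big mulr_suml. Qed.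

Lemma Ex_cst (T : finType) (c : R) : (0 < #|T|)%N -> Ex (fun _ : T => c) = c.
Proof.
by move=> T0; rewrite /Ex sumr_const cardE -cardT -[c *+ _]mulr_natr mulfK // pnatr_eq0 -lt0n.
Qed.

Lemma Ex_pair (T U : finType) (f : T -> U -> R) :
  Ex (fun tu : T * U => f tu.1 tu.2) = Ex (fun t => Ex (f t)).
Proof.
rewrite /Ex -mulr_suml -mulrA -invfM -natrM mulnC -card_prod.
by rewrite (pair_big xpredT xpredT f).
Qed.

Lemma Ex_exchange (T U : finType) (f : T -> U -> R) :
  Ex (fun t => Ex (f t)) = Ex (fun u => Ex (f ^~ u)).
Proof. by rewrite /Ex -!mulr_suml exchange_big mulrAC. Qed.

Lemma Ex_bij (T U : finType) (h : U -> T) (f : T -> R) :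
  bijective h -> Ex (fun u => f (h u)) = Ex f.
Proof.
move=> bh; rewrite /Ex (bij_eq_card bh); congr (_ / _).
by rewrite (reindex h) //; apply: onW_bij.
Qed.

Lemma Pr_le (T : finType) (P Q : T -> Prop) :
  (forall t, P t -> Q t) -> Pr P <= Pr Q.
Proof.
move=> PQ; apply: Ex_le => t.
by case: asboolP => [/PQ/asboolT ->|].
Qed.

Lemma Pr_eq0 (T : finType) (P : T -> Prop) : (forall t, ~ P t) -> Pr P = 0.
Proof. by move=> nP; rewrite /Pr /Ex big1 ?mul0r// => t _; rewrite asboolF. Qed.

Lemma Pr_ge0 (T : finType) (P : T -> Prop) : 0 <= Pr P.
Proof. by apply: Ex_ge0. Qed.

Lemma Pr_le1 (T : finType) (P : T -> Prop) : Pr P <= 1.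
Proof.
have [T0|T0] := posnP #|T|; first by rewrite /Pr /Ex T0 invr0 mulr0.
rewrite -[leRHS](Ex_cst 1 T0); by apply: Ex_le => t; case: `[<_>].
Qed.

Lemma PrU (T : finType) (P Q : T -> Prop) :
  Pr (fun t => P t \/ Q t) <= Pr P + Pr Q.
Proof.
rewrite -ExD; apply: Ex_le => t; rewrite asbool_or -natrD ler_nat.
by do 2 case: `[<_>].
Qed.

Lemma Pr_exists (T : finType) (J : finType) (P : J -> T -> Prop) :
  Pr (fun t => exists j, P j t) <= \sum_j Pr (P j).
Proof.
rewrite -Ex_sum; apply: Ex_le => t.
case: asboolP => [[j Pj]|_]; last exact: sumr_ge0.
by rewrite (bigD1 j)//= asboolT// lerDl sumr_ge0.
Qed.

Lemma Pr_markov (T : finType) (f : T -> R) (a : R) :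
  (forall t, 0 <= f t) -> 0 < a -> Pr (fun t => a <= f t) <= Ex f / a.
Proof.
move=> f0 a0; rewrite ler_pdivlMr// mulrC -ExZ; apply: Ex_le => t.
by case: asboolP => af; rewrite ?mulr1 ?mulr0.
Qed.

Lemma PrN (T : finType) (P : T -> Prop) : (0 < #|T|)%N ->
  Pr (fun t => ~ P t) = 1 - Pr P.
Proof.
move=> T0; apply/eqP; rewrite eq_sym subr_eq -ExD; apply/eqP.
rewrite -[LHS](Ex_cst 1 T0); apply: eq_Ex => t; rewrite asbool_neg.
by case: `[<_>]; rewrite ?addr0 ?add0r.
Qed.

(** Conditioning on the first coordinate; outside [good] the inner probability is bounded by 1. *)
Lemma Pr_pair_le (T U : finType) (good : T -> Prop) (P : T -> U -> Prop) (e : R) :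
  0 <= e -> (forall t, good t -> Pr (P t) <= e) ->
  Pr (fun u : T * U => P u.1 u.2) <= Pr (fun t => ~ good t) + e.
Proof.
move=> e0 Pe; rewrite /Pr (Ex_pair (fun t u => (`[< P t u >])%:R)).
have [T0|T0] := posnP #|T|; first by rewrite /Ex T0 invr0 !mulr0 add0r.
rewrite -[e in leRHS](Ex_cst e T0) -ExD; apply: Ex_le => t.
have [gt|ngt] := pselect (good t).
  by apply: (le_trans (Pe t gt)); rewrite lerDr.
by rewrite asboolT//; apply: (le_trans (Pr_le1 _)); rewrite lerDl.
Qed.

(** The values of a uniform random function are independent: this is distributivity of products over
    sums. *)
Lemma Ex_prod (m : nat) (I : finType) (g : 'I_m -> I -> R) :
  Ex (fun S : {ffun 'I_m -> I} => \prod_j g j (S j)) = \prod_j Ex (g j).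
Proof.
rewrite /Ex big_split /= -bigA_distr_bigA /=; congr (_ * _).
by rewrite prodr_const card_ffun card_ord natrX -exprVn.
Qed.

Lemma card_ffun_gt0 (m : nat) (I : finType) : (0 < #|I|)%N ->
  (0 < #|{: {ffun 'I_m -> I}}|)%N.
Proof. by move=> I0; rewrite card_ffun expn_gt0 I0. Qed.

Lemma Ex_proj (m : nat) (I : finType) (g : I -> R) (j : 'I_m) : (0 < #|I|)%N ->
  Ex (fun S : {ffun 'I_m -> I} => g (S j)) = Ex g.
Proof.
move=> I0; pose G k (i : I) := if k == j then g i else 1.
transitivity (Ex (fun S : {ffun 'I_m -> I} => \prod_k G k (S k))).
  apply: eq_Ex => S; rewrite (bigD1 j)//= big1 ?mulr1 /G ?eqxx//.
  by move=> k /negPf ->.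
rewrite Ex_prod (bigD1 j)//= big1 ?mulr1 /G ?eqxx//.
by move=> k /negPf ->; rewrite Ex_cst.
Qed.

Lemma Ex_proj2 (m : nat) (I : finType) (g h : I -> R) (j k : 'I_m) :
  (0 < #|I|)%N -> j != k ->
  Ex (fun S : {ffun 'I_m -> I} => g (S j) * h (S k)) = Ex g * Ex h.
Proof.
move=> I0 jk; pose G l (i : I) := if l == j then g i else if l == k then h i else 1.
have Gj : G j = g by apply/funext => i; rewrite /G eqxx.
have Gk : G k = h by apply/funext => i; rewrite /G eqxx eq_sym (negPf jk).
have G1 l : (l != j) && (l != k) -> G l = fun=> 1.
  by move=> /andP[/negPf lj /negPf lk]; apply/funext => i; rewrite /G lj lk.
transitivity (Ex (fun S : {ffun 'I_m -> I} => \prod_l G l (S l))).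
  apply: eq_Ex => S; rewrite (bigD1 j)//= (bigD1 k) 1?eq_sym//= big1 ?mulr1 ?Gj ?Gk//.
  by move=> l /G1 ->.
rewrite Ex_prod (bigD1 j)//= (bigD1 k) 1?eq_sym//= big1 ?mulr1 ?Gj ?Gk//.
by move=> l /G1 ->; rewrite Ex_cst.
Qed.

Lemma Ex_sum_proj (m : nat) (I : finType) (g : I -> R) : (0 < #|I|)%N ->
  Ex (fun S : {ffun 'I_m -> I} => \sum_j g (S j)) = m%:R * Ex g.
Proof.
move=> I0; rewrite Ex_sum (eq_bigr (fun=> Ex g)).
  by rewrite sumr_const card_ord mulr_natl.
by move=> j _; rewrite Ex_proj.
Qed.

Lemma Ex_sqr_sum (m : nat) (I : finType) (g : I -> R) : (0 < #|I|)%N -> Ex g = 0 ->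
  Ex (fun S : {ffun 'I_m -> I} => (\sum_j g (S j)) ^+ 2) = m%:R * Ex (fun i => g i ^+ 2).
Proof.
move=> I0 g0.
under eq_Ex do rewrite expr2 mulr_suml.
rewrite Ex_sum (eq_bigr (fun=> Ex (fun i => g i ^+ 2))).
  by rewrite sumr_const card_ord mulr_natl.
move=> j _; under eq_Ex do rewrite mulr_sumr.
rewrite Ex_sum (bigD1 j)//= big1 ?addr0.
  rewrite -(Ex_proj (fun i => g i ^+ 2) j I0); by under eq_Ex do rewrite -expr2.
by move=> k kj; rewrite Ex_proj2 1?eq_sym// g0 mul0r.
Qed.

Lemma chebyshev_sum (m : nat) (I : finType) (g : I -> R) (a : R) :
  (0 < #|I|)%N -> 0 < a ->
  Pr (fun S : {ffun 'I_m -> I} => a <= `|\sum_j g (S j) - m%:R * Ex g|)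
    <= m%:R * Ex (fun i => g i ^+ 2) / a ^+ 2.
Proof.
move=> I0 a0; pose g' i := g i - Ex g.
have g'0 : Ex g' = 0 by rewrite /g' ExD Ex_cst// subrr.
have sumE (S : {ffun 'I_m -> I}) : \sum_j g (S j) - m%:R * Ex g = \sum_j g' (S j).
  by rewrite /g' big_split/= sumr_const card_ord mulrC mulr_natr mulNrn.
apply: (@le_trans _ _ (Pr (fun S : {ffun 'I_m -> I} => a ^+ 2 <= (\sum_j g' (S j)) ^+ 2))).
  by apply: Pr_le => S; rewrite sumE -(real_normK (num_real (\sum_j _))) => h; rewrite lerXn2r// nnegrE ltW.
apply: (le_trans (Pr_markov _ _)); [by move=> S; exact: sqr_ge0|exact: exprn_gt0|].
rewrite Ex_sqr_sum// ler_wpM2r ?invr_ge0 ?sqr_ge0// ler_wpM2l//.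
have -> : Ex (fun i => g' i ^+ 2) = Ex (fun i => g i ^+ 2) - (Ex g) ^+ 2.
  rewrite (@eq_Ex _ _ (fun i => g i ^+ 2 + ((- 2 * Ex g) * g i + (Ex g) ^+ 2))).
    by rewrite !ExD ExZ Ex_cst//; ring.
  by move=> i; rewrite /g'; ring.
by rewrite gerBl sqr_ge0.
Qed.

(** The sharp exponent is x^2/2; with 2 x^2 the bound is elementary. Up to x = 1/2 both exponentials
    lie below quadratic polynomials, by exp(-x) >= 1 - x and exp x >= 1 + x; beyond it, x <= 2
    x^2. *)
Lemma cosh_le (x : R) : (expR x + expR (- x)) / 2 <= expR (2 * x ^+ 2).
Proof.
wlog x0 : x / 0 <= x.
  move=> H; have [/H//|/ltW x0] := lerP 0 x.
  by have := H (- x); rewrite oppr_ge0 opprK sqrrN addrC => /(_ x0).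
have [x12|x12] := lerP x (1/2).
  have e1 : expR x <= 1 + x + 2 * x ^+ 2.
    have h := expR_ge1Dx (- x); rewrite expRN in h.
    have x1 : 0 < 1 - x by lra.
    have : expR x <= (1 - x)^-1.
      by rewrite -[leLHS]invrK lef_pV2 ?posrE ?invr_gt0 ?expR_gt0.
    move=> /le_trans; apply.
    rewrite -[leLHS]mul1r ler_pdivrMr//; nra.
  have e2 : expR (- x) <= 1 - x + 2 * x ^+ 2.
    have x1 : 0 < 1 + x by lra.
    rewrite expRN; have h := expR_ge1Dx x.
    have : (expR x)^-1 <= (1 + x)^-1 by rewrite lef_pV2 ?posrE ?expR_gt0.
    move=> /le_trans; apply.
    rewrite -[leLHS]mul1r ler_pdivrMr//; nra.
  apply: le_trans (expR_ge1Dx _); lra.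
have e1 : expR (- x) <= expR x by rewrite ler_expR; lra.
have e2 : expR x <= expR (2 * x ^+ 2) by rewrite ler_expR; nra.
lra.
Qed.

Lemma Ex_bool (f : bool -> R) : Ex f = (f true + f false) / 2.
Proof. by rewrite /Ex big_bool card_bool. Qed.

Definition sgb (b : bool) : R := if b then 1 else -1.

Lemma rademacher_tail (m : nat) (c : 'I_m -> R) (V lam : R) :
  0 < V -> 0 <= lam -> \sum_j c j ^+ 2 <= V ->
  Pr (fun s : {ffun 'I_m -> bool} => lam <= `|\sum_j sgb (s j) * c j|)
    <= 2 * expR (- (lam ^+ 2 / (8 * V))).
Proof.
move=> V0 lam0 cV.
have half (c' : 'I_m -> R) : \sum_j c' j ^+ 2 <= V ->
    Pr (fun s : {ffun 'I_m -> bool} => lam <= \sum_j sgb (s j) * c' j)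
      <= expR (- (lam ^+ 2 / (8 * V))).
  (* The Chernoff parameter that minimises 2 th^2 V - th lam. *)
  move=> c'V; pose th := lam / (4 * V).
  apply: (@le_trans _ _ (Pr (fun s : {ffun 'I_m -> bool} =>
      expR (th * lam) <= expR (\sum_j th * (sgb (s j) * c' j))))).
    apply: Pr_le => s ls; rewrite ler_expR -mulr_sumr ler_wpM2l// divr_ge0//.
    by rewrite mulr_ge0// ltW.
  apply: (le_trans (Pr_markov _ (expR_gt0 _))); first by move=> s; exact: expR_ge0.
  under eq_Ex do rewrite expR_sum.
  rewrite (Ex_prod (fun j b => expR (th * (sgb b * c' j)))).
  apply: (@le_trans _ _ (expR (2 * th ^+ 2 * V) / expR (th * lam))).
    rewrite ler_wpM2r ?invr_ge0 ?expR_ge0//.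
    apply: (@le_trans _ _ (\prod_j expR (2 * (th * c' j) ^+ 2))).
      apply: ler_prod => j _; rewrite Ex_bool /= mul1r mulN1r mulrN cosh_le andbT.
      by rewrite divr_ge0// addr_ge0// expR_ge0.
    rewrite -expR_sum ler_expR -mulr_sumr.
    under eq_bigr do rewrite exprMn.
    by rewrite -mulr_sumr mulrA ler_wpM2l// mulr_ge0// sqr_ge0.
  rewrite -expRN -expRD ler_expR le_eqVlt; apply/orP; left; apply/eqP.
  rewrite /th; field; by rewrite gt_eqF.
rewrite mulr_natl mulr2n.
apply: (@le_trans _ _ (Pr (fun s : {ffun 'I_m -> bool} =>
   lam <= \sum_j sgb (s j) * c j \/ lam <= \sum_j sgb (s j) * - c j))).
  apply: Pr_le => s; rewrite ler_normr => /orP[->|]; [by left|right].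
  by rewrite (eq_bigr (fun j => - (sgb (s j) * c j))) ?sumrN// => j _; rewrite mulrN.
apply: (le_trans (PrU _ _)); apply: lerD; apply: half => //.
by under eq_bigr do rewrite sqrrN.
Qed.

End FiniteProbability.

(** * Symmetrisation and chaining *)

Section Symmetrization.
Variable R : realType.

(** A bad sample S has a witness x, which an independent ghost sample S' contradicts with
    probability 1/2. Exchanging S j and S' j at the positions selected by the signs preserves the
    law of the pair, and then one of the two signed sums must reach tau / 2; two factors 2 make the
    4. The total of the envelope [e] is invariant under these exchanges, so its bound survives in
    each half, where it confines x to a set that can be chained over. *)
Lemma symmetrization (m : nat) (I : finType) (X : Type) (T : X -> Prop)
    (h e : X -> I -> R) (tau c eta : R) (Bad good : {ffun 'I_m -> I} -> Prop) :
  (forall x i, 0 <= e x i) ->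
  (forall S, Bad S -> exists x, T x /\
     1 / 2 <= Pr R (fun S' : {ffun 'I_m -> I} =>
       tau <= `|\sum_j (h x (S j) - h x (S' j))|
       /\ \sum_j (e x (S j) + e x (S' j)) <= c)) ->
  0 <= eta ->
  (forall S, good S -> Pr R (fun s : {ffun 'I_m -> bool} =>
     exists x, T x /\ tau / 2 <= `|\sum_j sgb R (s j) * h x (S j)|
       /\ \sum_j e x (S j) <= c) <= eta) ->
  Pr R Bad <= 4 * (Pr R (fun S => ~ good S) + eta).
Proof.
move=> e0 HBad eta0 tail.
pose SS := {ffun 'I_m -> I}; pose W := {ffun 'I_m -> bool}.
pose D (S S' : SS) := exists x, T x /\
  (tau <= `|\sum_j (h x (S j) - h x (S' j))| /\ \sum_j (e x (S j) + e x (S' j)) <= c).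
pose B (S : SS) (s : W) := exists x, T x /\
  tau / 2 <= `|\sum_j sgb R (s j) * h x (S j)| /\ \sum_j e x (S j) <= c.
pose i1 (P : Prop) : R := (`[< P >])%:R.
have i1_ge0 P : 0 <= i1 P by [].
have stepA : Pr R Bad <= 2 * Ex (fun u : SS * SS => i1 (D u.1 u.2)).
  rewrite (Ex_pair (fun S S' => i1 (D S S'))) -ExZ; apply: Ex_le => S.
  case: asboolP => [/HBad[x [Tx hx]]|_]; last by rewrite mulr_ge0// Ex_ge0.
  have : 1 / 2 <= Ex (fun S' => i1 (D S S')); last by rewrite -[true%:R]/(1 : R); lra.
  by apply: (le_trans hx); apply: Pr_le => S' ?; exists x.
pose swap (s : W) (u : SS * SS) : SS * SS :=
  ([ffun j => if s j then u.1 j else u.2 j], [ffun j => if s j then u.2 j else u.1 j]).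
have swapK s : involutive (swap s).
  move=> [S S']; congr pair; apply/ffunP => j; rewrite !ffunE; by case: (s j).
have stepB s : Ex (fun u : SS * SS => i1 (D u.1 u.2)) =
    Ex (fun u : SS * SS => i1 (D (swap s u).1 (swap s u).2)).
  by rewrite (Ex_bij (fun u => i1 (D u.1 u.2)) (inv_bij (swapK s))).
have stepC s u : i1 (D (swap s u).1 (swap s u).2) <= i1 (B u.1 s) + i1 (B u.2 s).
  rewrite {1}/i1; case: asboolP => [[x [Tx [hx ex]]]|_]; last by rewrite addr_ge0.
  have ge0s (S : SS) : 0 <= \sum_j e x (S j) by apply: sumr_ge0.
  have eE : \sum_j (e x ((swap s u).1 j) + e x ((swap s u).2 j)) =
      \sum_j e x (u.1 j) + \sum_j e x (u.2 j).
    rewrite -big_split; apply: eq_bigr => j _; rewrite !ffunE; case: (s j) => //=.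
    by rewrite addrC.
  have hE : \sum_j (h x ((swap s u).1 j) - h x ((swap s u).2 j)) =
      \sum_j sgb R (s j) * h x (u.1 j) - \sum_j sgb R (s j) * h x (u.2 j).
    rewrite -sumrB; apply: eq_bigr => j _; rewrite !ffunE /sgb; case: (s j) => /=; ring.
  have ge01 := ge0s u.1; have ge02 := ge0s u.2.
  rewrite eE in ex; rewrite hE in hx.
  have [h1|h1] := lerP (tau / 2) `|\sum_j sgb R (s j) * h x (u.1 j)|.
    have -> : i1 (B u.1 s) = 1 by rewrite /i1 asboolT//; exists x; do 2 split=> //; lra.
    by rewrite lerDl.
  have -> : i1 (B u.2 s) = 1; last by rewrite lerDr.
  rewrite /i1 asboolT//; exists x; do 2 split=> //; last by lra.
  move: (le_trans hx (ler_normB _ _)) h1; lra.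
apply: (le_trans stepA).
have W0 : (0 < #|{: W}|)%N by rewrite card_ffun expn_gt0 card_bool.
have [SS0|SS0] := posnP #|{: SS}|.
  have -> : Ex (fun u : SS * SS => i1 (D u.1 u.2)) = 0.
    by rewrite /Ex card_prod SS0 mul0n invr0 mulr0.
  by rewrite mulr0 mulr_ge0// addr_ge0// Pr_ge0.
have PrBE : Pr R (fun u : SS * W => B u.1 u.2) = Ex (fun s => Ex (fun S => i1 (B S s))).
  by rewrite /Pr (Ex_pair (fun S s => i1 (B S s))) Ex_exchange.
have : Ex (fun u : SS * SS => i1 (D u.1 u.2)) <= 2 * Pr R (fun u : SS * W => B u.1 u.2).
  rewrite -[leLHS](Ex_cst _ W0) PrBE -ExZ; apply: Ex_le => s; rewrite (stepB s).
  have -> : 2 * Ex (fun S => i1 (B S s)) =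
      Ex (fun u : SS * SS => i1 (B u.1 s) + i1 (B u.2 s)).
    rewrite ExD (Ex_pair (fun S _ => i1 (B S s))) (Ex_pair (fun _ S => i1 (B S s))).
    rewrite Ex_cst// (@eq_Ex _ _ _ (fun S => i1 (B S s))); first by lra.
    by move=> S; rewrite Ex_cst.
  exact: Ex_le.
have := Pr_pair_le (P := B) eta0 tail; lra.
Qed.

(** Union bound over the links between consecutive nets: x is reached from [x0], where the sum
    vanishes, by K links of size below [lam], and at the last net absolute values suffice for the
    remainder [rho]. Both ends of a link are near the same x, so its squared length is at most 2 (V
    k + V k.+1); with the 8 of [rademacher_tail] this makes 16. *)
Lemma chaining (m : nat) (X : eqType) (T : X -> Prop) (h : X -> 'I_m -> R)
    (near : nat -> X -> X -> Prop) (s : nat -> seq X) (x0 : X) (K : nat)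
    (V : nat -> R) (lam rho del : R) :
  s 0 = [:: x0] -> (forall j, h x0 j = 0) ->
  (forall k x, (k <= K)%N -> T x -> exists2 y, y \in s k & near k x y) ->
  (forall k x y, near k x y -> \sum_j (h x j - h y j) ^+ 2 <= V k) ->
  (forall x y, near K x y -> \sum_j `|h x j - h y j| <= rho) ->
  (forall k, 0 < V k) -> 0 <= lam ->
  (forall k, (k < K)%N -> (size (s k) * size (s k.+1))%:R *
     (2 * expR (- (lam ^+ 2 / (16 * (V k + V k.+1))))) <= del) ->
  Pr R (fun g : {ffun 'I_m -> bool} =>
     exists x, T x /\ K%:R * lam + rho < `|\sum_j sgb R (g j) * h x j|) <= K%:R * del.
Proof.
move=> s0 hx0 cov nearV nearK V0 lam0 tail.
pose G x (g : {ffun 'I_m -> bool}) := \sum_j sgb R (g j) * h x j.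
pose link k (a : 'I_(size (s k)) * 'I_(size (s k.+1))) (g : {ffun 'I_m -> bool}) :=
  let y := nth x0 (s k) a.1 in let y' := nth x0 (s k.+1) a.2 in
  \sum_j (h y' j - h y j) ^+ 2 <= 2 * (V k + V k.+1) /\ lam <= `|G y' g - G y g|.
have linkP k a : Pr R (link k a) <= 2 * expR (- (lam ^+ 2 / (16 * (V k + V k.+1)))).
  set y := nth x0 (s k) a.1; set y' := nth x0 (s k.+1) a.2.
  have [le2|gt2] := lerP (\sum_j (h y' j - h y j) ^+ 2) (2 * (V k + V k.+1)); last first.
    rewrite Pr_eq0 ?mulr_ge0 ?expR_ge0// => g [].
    by rewrite -/y -/y' leNgt gt2.
  have -> : 16 * (V k + V k.+1) = 8 * (2 * (V k + V k.+1)) by ring.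
  apply: le_trans (rademacher_tail (c := fun j => h y' j - h y j) _ lam0 le2).
    apply: Pr_le => g [_]; rewrite /G -sumrB.
    by under eq_bigr do rewrite -mulrBr.
  by rewrite mulr_gt0// addr_gt0.
have chain g : (forall k a, (k < K)%N -> ~ link k a g) ->
    forall x, T x -> forall k, (k <= K)%N ->
    exists2 y, y \in s k & near k x y /\ `|G y g| <= k%:R * lam.
  move=> nolink x Tx; elim=> [_|k IH kK].
    have [y ys ny] := cov 0 x isT Tx; exists y => //; split=> //.
    move: ys; rewrite s0 inE => /eqP ->; rewrite /G big1 ?normr0 ?mul0r// => j _.
    by rewrite hx0 mulr0.
  have [y ys [ny Gy]] := IH (ltnW kK).
  have [y' ys' ny'] := cov k.+1 x kK Tx; exists y' => //; split=> //.
  pose a := (Ordinal (etrans (index_mem y (s k)) ys), Ordinal (etrans (index_mem y' (s k.+1)) ys')).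
  have := nolink k a kK; rewrite /link /= !nth_index// => nl.
  have : `|G y' g - G y g| < lam.
    rewrite ltNge; apply/negP => le; apply: nl; split=> //.
    apply: (@le_trans _ _ (2 * (\sum_j (h x j - h y j) ^+ 2 + \sum_j (h x j - h y' j) ^+ 2))).
      rewrite -big_split/= mulr_sumr; apply: ler_sum => j _.
      have := sqr_ge0 (2 * h x j - h y j - h y' j); lra.
    by rewrite ler_wpM2l// lerD// nearV.
  move=> lt; rewrite -natr1 mulrDl mul1r.
  have := ler_normD (G y g) (G y' g - G y g); rewrite addrC subrK; lra.
apply: (@le_trans _ _ (Pr R (fun g => exists k : 'I_K, exists a, link k a g))).
  apply: Pr_le => g [x [Tx big]]; apply: contrapT => none.
  have nolink k a : (k < K)%N -> ~ link k a g.
    by move=> kK l; apply: none; exists (Ordinal kK), a.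
  have [y ys [ny Gy]] := chain g nolink x Tx K (leqnn K).
  have : `|G x g - G y g| <= rho.
    rewrite /G -sumrB; apply: le_trans (nearK _ _ ny).
    apply: (le_trans (ler_norm_sum _ _ _)); apply: ler_sum => j _.
    rewrite -mulrBr normrM /sgb; case: (g j); rewrite ?normrN ?normr1 mul1r//.
  have := ler_normD (G y g) (G x g - G y g); rewrite addrC subrK.
  rewrite -/(G x g) in big; lra.
apply: (le_trans (Pr_exists _ _)).
apply: (@le_trans _ _ (\sum_(k < K) del)); last first.
  by rewrite sumr_const card_ord mulr_natl.
apply: ler_sum => k _; apply: le_trans (tail k (ltn_ord k)).
apply: (le_trans (Pr_exists _ _)).
apply: (le_trans (ler_sum _ (fun a _ => linkP k a))).
by rewrite sumr_const card_prod !card_ord -[_ *+ (_ * _)]mulr_natl.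
Qed.

End Symmetrization.

(** * Nets produced by greedy steps *)

Section Covering.
Variable R : realType.

Lemma cauchy_schwarz (V : lmodType R) (B : V -> V -> R) (x y : V) :
  (forall x y, B x y = B y x) -> (forall x y z, B (x + y) z = B x z + B y z) ->
  (forall a x y, B (a *: x) y = a * B x y) -> (forall x, 0 <= B x x) ->
  B x y ^+ 2 <= B x x * B y y.
Proof.
move=> BC BD BZ B0.
have key a : 0 <= B x x - 2 * a * B x y + a ^+ 2 * B y y.
  have := B0 (x + (- a) *: y); rewrite BD BZ [B x _]BC [B y (x + _)]BC !BD !BZ [B y x]BC; lra.
have [y0|y0] := eqVneq (B y y) 0.
  have [/eqP xy0|xy0] := boolP (B x y == 0); first by rewrite xy0 y0 mulr0 expr0n.
  (* When B y y = 0 the expression in [key] is affine in a, and this a gives it the value -1. *)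
  have := key ((B x x + 1) / (2 * B x y)).
  rewrite y0 mulr0 addr0 (_ : 2 * _ * B x y = B x x + 1); last by field.
  lra.
have yy : 0 < B y y by rewrite lt0r y0 B0.
have := key (B x y / B y y).
rewrite (_ : _ + _ = B x x - B x y ^+ 2 / B y y); last by field.
by rewrite subr_ge0 ler_pdivrMr.
Qed.

Section Greedy.
Variables (V : lmodType R) (B : V -> V -> R) (m : nat) (u : 'I_m -> V) (c : R).
Hypotheses (BC : forall x y, B x y = B y x)
  (BD : forall x y z, B (x + y) z = B x z + B y z)
  (BZ : forall a x y, B (a *: x) y = a * B x y)
  (B0 : forall x, 0 <= B x x).
Hypotheses (c0 : 0 < c) (uc : forall j, B (u j) (u j) <= c).

(* Perceptron argument: as long as some |B (u j) (x - y)| exceeds t, moving y by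
   ± (t / c) u j decreases B (x - y) (x - y) by at least t ^ 2 / c. *)
Lemma greedy_cover (t : R) (n : nat) : 0 < t ->
  exists s : seq V, [/\ (size s <= (2 * m + 1) ^ n)%N, 0 \in s &
    forall x, c * B x x <= n%:R * t ^+ 2 ->
      exists2 y, y \in s & forall j, `|B (u j) (x - y)| <= t].
Proof.
move=> t0; elim: n => [|n [s [ss s0 IH]]].
  exists [:: 0]; split; rewrite ?inE// => x; rewrite mul0r pmulr_rle0// => Bx.
  exists 0; rewrite ?inE// => j; rewrite subr0.
  have Bx0 : B x x = 0 by apply/eqP; rewrite eq_le Bx B0.
  have := cauchy_schwarz (u j) x BC BD BZ B0; rewrite Bx0 mulr0 => le0.
  have /eqP : B (u j) x ^+ 2 = 0 by apply/eqP; rewrite eq_le le0 sqr_ge0.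
  by rewrite sqrf_eq0 => /eqP ->; rewrite normr0 ltW.
pose e : seq V := 0 :: ([seq (t / c) *: u j | j <- enum 'I_m]
  ++ [seq (- (t / c)) *: u j | j <- enum 'I_m]).
exists [seq y + z | y <- s, z <- e]; split.
- have -> : size [seq y + z | y <- s, z <- e] = (size s * (2 * m + 1))%N.
    by rewrite size_allpairs /e /= size_cat !size_map -enumT size_enum_ord addnn -mul2n addn1.
  by rewrite expnSr leq_mul.
- by apply/allpairsP; exists (0, 0); rewrite /= addr0 inE eqxx s0.
move=> x Bx.
(* Keeping 0 among the moves and in the net lets the walk stop early. *)
have [all|/existsNP[j /negP]] := pselect (forall j, `|B (u j) x| <= t).
  exists 0; last by rewrite subr0.
  by apply/allpairsP; exists (0, 0); rewrite /= addr0 inE eqxx s0.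
rewrite -ltNge => jt.
pose sg : R := if 0 <= B (u j) x then 1 else -1.
have sgE : sg * B (u j) x = `|B (u j) x|.
  by rewrite /sg; case: ger0P => _; rewrite ?mul1r ?mulN1r.
have sg2 : sg * sg = 1 by rewrite /sg; case: ifP => _; rewrite ?mulr1 ?mulrNN ?mulr1.
pose z := (sg * (t / c)) *: u j.
have ze : z \in e.
  rewrite inE mem_cat; apply/orP; right; rewrite /z /sg; case: ifP => _; apply/orP; [left|right];
    apply/mapP; exists j; rewrite ?mem_enum ?mul1r ?mulN1r//.
have [|y ys hy] := IH (x - z).
  have -> : B (x - z) (x - z) = B x x - 2 * (t / c) * (sg * B (u j) x)
       + (t / c) ^+ 2 * (sg * sg) * B (u j) (u j).
    rewrite /z -scaleNr BD BZ [B x _]BC [B (u j) (x + _)]BC !BD !BZ [B x (u j)]BC; ring.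
  rewrite sgE sg2 mulr1.
  have h1 : c * ((t / c) ^+ 2 * B (u j) (u j)) <= t ^+ 2.
    rewrite (_ : t ^+ 2 = c * ((t / c) ^+ 2 * c)); last by field; rewrite gt_eqF.
    by rewrite ler_pM2l// ler_wpM2l// sqr_ge0.
  have h2 : c * (2 * (t / c) * `|B (u j) x|) >= 2 * t ^+ 2.
    rewrite (_ : c * _ = 2 * (t * `|B (u j) x|)); last by field; rewrite gt_eqF.
    by rewrite ler_pM2l// expr2 ler_pM2l// ltW.
  rewrite -natr1 mulrDl mul1r in Bx; lra.
exists (y + z); first by apply/allpairsP; exists (y, z).
by move=> i; rewrite (_ : x - (y + z) = x - z - y)// opprD addrA addrAC.
Qed.

Variables (T : V -> Prop) (x0 : V) (t0 D a G : R).
Hypotheses (t0_gt0 : 0 < t0) (D0 : 0 <= D) (a1 : 1 <= a) (Tx0 : T x0)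
  (Tsup : forall x j, T x -> `|B (u j) x| <= t0)
  (Tdiff : forall x x' t, T x -> T x' -> 0 < t ->
     (forall j, `|B (u j) (x - x')| <= 2 * t) -> B (x - x') (x - x') <= D * t `^ (2 - a))
  (GE : 4 * c * D * t0 `^ (- a) + 1 <= G).

(* Greedy steps are restarted from points of T, whose pairwise differences stay
   in 2T; this is what turns the rate t ^ -2 into t ^ -a for a < 2. *)
Lemma multiscale_cover : exists s : nat -> seq V,
  [/\ s 0 = [:: x0], forall k y, y \in s k -> T y,
      forall k, exists2 n, (size (s k) <= (2 * m + 1) ^ n)%N
                         & n%:R <= G * ((2 `^ a) ^+ k - 1)
    & forall k x, T x -> exists2 y, y \in s k
        & forall j, `|B (u j) (x - y)| <= 2 * (t0 / 2 ^+ k)].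
Proof.
suff : forall k, exists s : seq V,
  [/\ k = 0%N -> s = [:: x0], forall y, y \in s -> T y,
      exists2 n, (size s <= (2 * m + 1) ^ n)%N & n%:R <= G * ((2 `^ a) ^+ k - 1)
    & forall x, T x -> exists2 y, y \in s
        & forall j, `|B (u j) (x - y)| <= 2 * (t0 / 2 ^+ k)].
  move=> /choice[s sP]; exists s; split.
  - by have [+ _ _ _] := sP 0%N; exact.
  - by move=> k; have [] := sP k.
  - by move=> k; have [] := sP k.
  - by move=> k; have [] := sP k.
elim=> [|k [s [_ sT [n sn nG] scov]]].
  exists [:: x0]; split=> //.
  - by move=> y; rewrite inE => /eqP ->.
  - by exists 0%N => //; rewrite expr0 subrr mulr0.
  move=> x Tx; exists x0; rewrite ?inE// => j.
  rewrite expr0 divr1 BC BD -scaleN1r BZ mulN1r [B x _]BC [B x0 _]BC.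
  by apply: (le_trans (ler_normB _ _)); have := Tsup j Tx; have := Tsup j Tx0; lra.
pose t := t0 / 2 ^+ k.+1.
have t_gt0 : 0 < t by rewrite divr_gt0// exprn_gt0.
have tk : t0 / 2 ^+ k = 2 * t by rewrite /t exprS; field; rewrite expf_neq0.
pose be : R := 2 `^ a.
have be2 : 2 <= be by rewrite /be le1r_powR// ler1n.
(* Number of greedy steps from a point of the previous net: by [Tdiff], c B (x - y) (x - y) is at
   most 4 c D t0^(-a) be^k t^2. The summand 1 in [GE] pays for rounding up. *)
pose N := (Num.truncn (4 * c * D * t0 `^ (- a) * be ^+ k)).+1.
have arg0 : 0 <= 4 * c * D * t0 `^ (- a) * be ^+ k.
  by rewrite !mulr_ge0 ?powR_ge0 ?exprn_ge0 ?powR_ge0// ltW.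
have [g [gs g0 gcov]] := greedy_cover N t_gt0.
have NE : N%:R <= G * be ^+ k.
  rewrite /N -natr1; apply: (@le_trans _ _ (4 * c * D * t0 `^ (- a) * be ^+ k + 1)).
    by rewrite lerD2r; have /andP[] := truncn_itv arg0.
  have be1 : 1 <= be ^+ k by rewrite exprn_ege1//; lra.
  apply: (@le_trans _ _ ((4 * c * D * t0 `^ (- a) + 1) * be ^+ k)); last first.
    by rewrite ler_wpM2r//; lra.
  lra.
(* Greedy endpoints may leave T. A point of T within t of them costs another t, hence the factor 2
   in the resolution. *)
pose pick z := xget x0 [set x | T x /\ forall j, `|B (u j) (x - z)| <= t].
have pickT z : T (pick z) by rewrite /pick; case: xgetP => [x _ []|].
exists [seq pick (y + z) | y <- s, z <- g]; split=> //.
- by move=> y /allpairsP[[? ?] [_ _ ->]].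
- exists (n + N)%N; first by rewrite size_allpairs expnD leq_mul.
  rewrite natrD exprS; have be1 : 0 <= be ^+ k by rewrite exprn_ge0//; lra.
  have G0 : 0 <= G.
    apply: le_trans GE; rewrite addr_ge0// !mulr_ge0 ?powR_ge0// ltW//.
  (* As be >= 2, G (be^k - 1) + G be^k <= G (be^(k+1) - 1). *)
  have : G * be ^+ k * 2 <= G * be ^+ k * be by rewrite ler_wpM2l// mulr_ge0.
  move: nG NE; rewrite -/be; lra.
move=> x Tx; have [y ys hy] := scov x Tx.
have Ty := sT y ys.
have := Tdiff Tx Ty (t := 2 * t); rewrite mulr_gt0// -tk => /(_ isT hy) Bxy.
have [|z zg hz] := gcov (x - y).
  apply: (@le_trans _ _ (4 * c * D * t0 `^ (- a) * be ^+ k * t ^+ 2)); last first.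
    rewrite ler_wpM2r ?sqr_ge0//; apply: ltW; have /andP[] := truncn_itv arg0.
    by [].
  apply: (le_trans (ler_wpM2l (ltW c0) Bxy)).
  have tk0 : 0 < t0 / 2 ^+ k by rewrite divr_gt0// exprn_gt0.
  have -> : (t0 / 2 ^+ k) `^ (2 - a) = (t0 / 2 ^+ k) ^+ 2 * (t0 `^ (- a) * be ^+ k).
    rewrite powRD ?(gt_eqF tk0) ?implybT//; congr (_ * _).
      by rewrite -powR_mulrn// ltW.
    rewrite powRM ?invr_ge0 ?exprn_ge0 ?ltW//; congr (_ * _).
    rewrite -powR_invn// -powRrM mulrNN mulrC powRrM.
    by rewrite powR_mulrn// powR_ge0.
  rewrite tk le_eqVlt; apply/orP; left; apply/eqP; ring.
exists (pick (y + z)); first by apply/allpairsP; exists (y, z).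
move=> j.
have [_ hp] : T (pick (y + z)) /\ forall j, `|B (u j) (pick (y + z) - (y + z))| <= t.
  rewrite /pick; case: xgetP => [x1 _ //|/(_ x)]; case; split=> // i.
  by rewrite opprD addrA.
have {}hp := hp j; have {}hz := hz j.
have -> : x - pick (y + z) = (x - y - z) + (-1) *: (pick (y + z) - (y + z)).
  by rewrite scaleN1r opprB -[x - y - z]addrA -opprD addrA subrK.
rewrite BC BD BZ mulN1r [B _ (u j)]BC [B (pick _ - _) _]BC.
by apply: (le_trans (ler_normB _ _)); rewrite -/t; lra.
Qed.

End Greedy.
End Covering.

(** * Inequalities for real powers *)

Section PowerInequalities.
Variable R : realType.
Implicit Types p a b c t u x y z : R.

(** Young's inequality for u and 1 with the exponents p and p / (p - 1). *)
Lemma bernoulli_powR p u : 1 <= p -> 0 <= u -> 1 + p * (u - 1) <= u `^ p.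
Proof.
move=> p1 u0; have [->|pn1] := eqVneq p 1; first by rewrite powRr1// mul1r; lra.
have p_gt1 : 1 < p by rewrite lt_neqAle eq_sym pn1.
have p0 : 0 < p by lra.
have q0 : 0 < p / (p - 1) by rewrite divr_gt0//; lra.
have q : p^-1 + (p / (p - 1))^-1 = 1 by field; rewrite !gt_eqF//; lra.
have h := conjugate_powR u0 ler01 p0 q0 q.
rewrite powR1 mulr1 in h.
have {}h := ler_wpM2l (ltW p0) h.
move: h.
rewrite (_ : p * (u `^ p / p + 1 / (p / (p - 1))) = u `^ p + (p - 1)); first by lra.
by field; rewrite !gt_eqF//; lra.
Qed.

(** For b <= a, the graph of the p-th power lies above its tangent at a: this is [bernoulli_powR] at
    b / a. *)
Lemma powR_lipschitz p a b c : 1 <= p -> 0 <= a -> 0 <= b -> a <= c -> b <= c ->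
  `|a `^ p - b `^ p| <= p * `|a - b| * c `^ (p - 1).
Proof.
move=> p1; wlog ba : a b / b <= a.
  move=> H a0 b0 ac bc; have [ba|/ltW ab] := leP b a; first exact: (H a b ba a0 b0 ac bc).
  by rewrite distrC [`|a - b|]distrC; exact: (H b a ab b0 a0 bc ac).
move=> a0 b0 ac bc; have p0 : 0 <= p by lra.
rewrite !ger0_norm ?subr_ge0 ?ge0_ler_powR//.
have [az|an0] := eqVneq a 0.
  have bz : b = 0 by apply/eqP; rewrite eq_le b0 -az ba.
  by rewrite az bz !subrr mulr0 mul0r.
have a_gt0 : 0 < a by rewrite lt0r an0.
have E1 : a `^ p * (b / a) `^ p = b `^ p.
  by rewrite mulrC -powRM ?divr_ge0// divfK.
have h := ler_wpM2l (powR_ge0 a p) (bernoulli_powR p1 (divr_ge0 b0 a0)).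
rewrite E1 in h.
have E : a `^ p = a `^ (p - 1) * a by rewrite mulrC mulr_powRB1//; lra.
apply: (@le_trans _ _ (p * (a - b) * a `^ (p - 1))); last first.
  by rewrite ler_wpM2l ?mulr_ge0 ?subr_ge0// ge0_ler_powR ?nnegrE//; lra.
move: h; rewrite {1 2}E.
rewrite (_ : a `^ (p - 1) * a * (1 + p * (b / a - 1)) =
  a `^ (p - 1) * a + p * (b - a) * a `^ (p - 1)); first by rewrite -E; lra.
by field.
Qed.

Lemma powR_add3_le p x y z : 0 <= p -> 0 <= x -> 0 <= y -> 0 <= z ->
  (x + y + z) `^ p <= 3 `^ p * (x `^ p + y `^ p + z `^ p).
Proof.
move=> p0 x0 y0 z0.
pose M := Num.max x (Num.max y z).
have xM : x <= M by rewrite le_max lexx.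
have yM : y <= M by rewrite !le_max lexx orbT.
have zM : z <= M by rewrite !le_max lexx !orbT.
apply: (@le_trans _ _ ((3 * M) `^ p)); first by apply: ge0_ler_powR; rewrite ?nnegrE//; lra.
rewrite powRM// ?(le_trans x0 xM)// ler_wpM2l ?powR_ge0//.
have := powR_ge0 x p; have := powR_ge0 y p; have := powR_ge0 z p.
have : M = x \/ M = y \/ M = z.
  by rewrite /M; case: (leP y z) => _; case: leP => _; tauto.
move=> [|[|]] ->; lra.
Qed.

Lemma powRB1_le p x : 1 <= p -> 0 <= x -> x `^ (p - 1) <= 1 + x `^ p.
Proof.
move=> p1 x0; have [x1|/ltW x1] := lerP x 1.
  apply: (@le_trans _ _ (1 `^ (p - 1))); first by apply: ge0_ler_powR; rewrite ?nnegrE//; lra.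
  by rewrite powR1 lerDl powR_ge0.
apply: (@le_trans _ _ (x `^ p)); first by apply: ler_powR => //; lra.
by rewrite lerDr.
Qed.

(** The exponent with which a uniform bound on the rows enters a variance. *)
Definition xp (p : R) : R := Num.max (p - 2) 0.

(** The square of one loss increment with step v at a row of size y. The factor y^p is kept because
    its weighted sum is bounded. The rest comes from v^2 <= t^p y^(2-p) when p <= 2, and from
    y^(2p-2) <= M^(p-2) y^p when p > 2. *)
Lemma increment_le p v t y M : 1 <= p -> 0 <= v -> v <= t -> v <= y -> y <= M ->
  v ^+ 2 * (y `^ (p - 1)) ^+ 2 <= t `^ (Num.min p 2) * M `^ xp p * y `^ p.
Proof.
move=> p1 v0 vt vy yM; have y0 := le_trans v0 vy; have M0 := le_trans y0 yM.
have t0 := le_trans v0 vt.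
have [->|vn0] := eqVneq v 0; first by rewrite expr0n mul0r !mulr_ge0 ?powR_ge0.
have v_gt0 : 0 < v by rewrite lt0r vn0.
have y_gt0 : 0 < y by exact: lt_le_trans vy.
rewrite -[(y `^ _) ^+ 2]powR_mulrn ?powR_ge0// -powRrM -powR_mulrn//.
rewrite /xp; case: (leP p 2) => p2.
  rewrite (_ : Num.max (p - 2) 0 = 0) ?powRr0 ?mulr1; last by apply/max_idPr; lra.
  rewrite (_ : v `^ 2 = v `^ p * v `^ (2 - p)); last first.
    by rewrite -powRD ?(gt_eqF v_gt0) ?implybT//; congr (_ `^ _); ring.
  have -> : y `^ p = y `^ (2 - p) * y `^ ((p - 1) * 2).
    by rewrite -powRD ?(gt_eqF y_gt0) ?implybT//; congr (_ `^ _); ring.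
  rewrite -[in leLHS]mulrA; apply: ler_pM; rewrite ?mulr_ge0 ?powR_ge0//.
    by apply: ge0_ler_powR; rewrite ?nnegrE//; lra.
  rewrite ler_wpM2r ?powR_ge0//.
  by apply: ge0_ler_powR; rewrite ?nnegrE//; lra.
rewrite (_ : Num.max (p - 2) 0 = p - 2); last by apply/max_idPl; lra.
have -> : y `^ ((p - 1) * 2) = y `^ (p - 2) * y `^ p.
  by rewrite -powRD ?(gt_eqF y_gt0) ?implybT//; congr (_ `^ _); ring.
rewrite mulrA ler_wpM2r ?powR_ge0//.
by apply: ler_pM; rewrite ?powR_ge0//; apply: ge0_ler_powR; rewrite ?nnegrE//; lra.
Qed.

End PowerInequalities.

(** * Chaining along multiscale nets, for a fixed sample *)

Section ConditionalTail.
Variable R : realType.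

(** Only the signs are random here. With be = 2^min(p,2), the variance at level k is V0 / be^k, and
    the number of links has logarithm at most 5 G be^k ln (2m+1): the powers of be cancel, so a
    single [lam] serves all levels. *)
Lemma conditional_tail (p kap A W C Y B G lam del : R) (m K : nat) (V : eqType)
    (T : V -> Prop) (x0 : V) (l : V -> 'I_m -> R) (w : 'I_m -> R)
    (psi : 'I_m -> R -> R) (y : 'I_m -> R) (s : nat -> seq V) :
  1 <= p -> 0 < kap -> 0 < A -> 0 < B -> B <= Y -> 0 < C -> 0 <= G ->
  0 < del -> del <= 1 -> 0 <= lam ->
  (forall j, 0 <= w j <= kap) -> \sum_j w j <= W ->
  (forall x j, T x -> `|l x j| <= B) ->
  (forall x, T x -> \sum_j w j * `|l x j| `^ p <= C) ->
  (forall j, 0 <= y j <= Y) -> \sum_j w j * y j `^ p <= C ->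
  (forall j a b, `|psi j a - psi j b| <= A * `|a - b| * (`|a| + `|b| + y j) `^ (p - 1)) ->
  (forall j, psi j (l x0 j) = 0) ->
  s 0 = [:: x0] -> (forall k z, z \in s k -> T z) ->
  (forall k, exists2 n, (size (s k) <= (2 * m + 1) ^ n)%N
                      & n%:R <= G * ((2 `^ Num.min p 2) ^+ k - 1)) ->
  (forall k x, T x -> exists2 z, z \in s k
                      & forall j, `|l x j - l z j| <= 2 * (B / 2 ^+ k)) ->
  32 * (kap * A ^+ 2 * (3 `^ (p + 1) * C) * (3 * Y) `^ xp p * (2 * B) `^ Num.min p 2)
    * (ln (2 / del) + 5 * G * ln (2 * m + 1)%:R) <= lam ^+ 2 ->
  Pr R (fun g : {ffun 'I_m -> bool} => exists x, T x /\
      K%:R * lam + A * (2 * (B / 2 ^+ K)) * (W + 3 `^ (p + 1) * C)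
        < `|\sum_j sgb R (g j) * (w j * psi j (l x j))|) <= K%:R * del.
Proof.
move=> p1 kap0 A0 B0 BY C0 G0 del0 del1 lam0 wk wW TB TC yY yC psiL psi0 s0 sT ssz scov lamE.
have Y0 : 0 < Y by exact: lt_le_trans BY.
set a := Num.min p 2 in ssz lamE *.
have a1 : 1 <= a by rewrite /a le_min p1 ler1n.
have a2 : a <= 2 by rewrite /a ge_min lexx orbT.
pose be : R := 2 `^ a.
have be2 : 2 <= be by rewrite /be le1r_powR// ler1n.
have be4 : be <= 4.
  apply: (@le_trans _ _ (2 `^ 2)); first by apply: ler_powR => //; rewrite ler1n.
  by rewrite powR_mulrn//; lra.
have bek k : 1 <= be ^+ k by rewrite exprn_ege1//; lra.
have bek0 k : 0 < be ^+ k by exact: lt_le_trans (bek k).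
pose b1 := 3 `^ (p + 1) * C.
have b10 : 0 < b1 by rewrite mulr_gt0// powR_gt0.
pose V0 := kap * A ^+ 2 * b1 * (3 * Y) `^ xp p * (2 * B) `^ a.
have V00 : 0 < V0 by rewrite !mulr_gt0 ?exprn_gt0 ?powR_gt0 ?mulr_gt0.
pose near k x z := [/\ T x, T z & forall j, `|l x j - l z j| <= 2 * (B / 2 ^+ k)].
pose Yj x z j := `|l x j| + `|l z j| + y j.
have yj0 j : 0 <= y j by have /andP[] := yY j.
have yjY j : y j <= Y by have /andP[] := yY j.
have w0 j : 0 <= w j by have /andP[] := wk j.
have wkap j : w j <= kap by have /andP[] := wk j.
have Yj0 x z j : 0 <= Yj x z j by rewrite !addr_ge0.
have YjM x z j : T x -> T z -> Yj x z j <= 3 * Y.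
  move=> Tx Tz; rewrite /Yj; have := TB x j Tx; have := TB z j Tz; have := yjY j; lra.
have sumY x z : T x -> T z -> \sum_j w j * Yj x z j `^ p <= b1.
  move=> Tx Tz.
  apply: (@le_trans _ _ (\sum_j 3 `^ p * (w j * `|l x j| `^ p + w j * `|l z j| `^ p + w j * y j `^ p))).
    apply: ler_sum => j _; rewrite -!mulrDr mulrCA ler_wpM2l// powR_add3_le//; lra.
  rewrite -mulr_sumr !big_split/= /b1 powRD ?pnatr_eq0 ?implybT// powRr1// -mulrA ler_wpM2l ?powR_ge0//.
  have := TC x Tx; have := TC z Tz; lra.
apply: (chaining (x0 := x0) (s := s) (near := near) (V := fun k => V0 / be ^+ k)) => //.
- by move=> j; rewrite psi0 mulr0.
- move=> k x _ Tx; have [z zs hz] := scov k x Tx; exists z => //; split=> //; exact: sT zs.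
- move=> k x z [Tx Tz xz].
  apply: (@le_trans _ _ (\sum_j kap * A ^+ 2 * ((2 * (B / 2 ^+ k)) `^ a * (3 * Y) `^ xp p * (w j * Yj x z j `^ p)))).
    apply: ler_sum => j _.
    rewrite -mulrBr -(real_normK (num_real (w j * _))) normrM (ger0_norm (w0 j)) exprMn.
    apply: (@le_trans _ _ (w j ^+ 2 * (A * `|l x j - l z j| * Yj x z j `^ (p - 1)) ^+ 2)).
      rewrite ler_wpM2l ?sqr_ge0// lerXn2r ?nnegrE// ?mulr_ge0 ?powR_ge0 ?normr_ge0 ?(ltW A0)//.
    have := increment_le p1 (normr_ge0 (l x j - l z j)) (xz j) _ (YjM x z j Tx Tz).
    have -> : `|l x j - l z j| <= Yj x z j.
      by apply: (le_trans (ler_normB _ _)); rewrite lerDl.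
    move=> /(_ isT) h.
    rewrite !exprMn -/a in h *.
    rewrite (_ : w j ^+ 2 * _ = A ^+ 2 * w j * (w j * (`|l x j - l z j| ^+ 2 * (Yj x z j `^ (p - 1)) ^+ 2))); last by ring.
    rewrite (_ : kap * A ^+ 2 * _ = A ^+ 2 * kap * (w j * ((2 * (B / 2 ^+ k)) `^ a * (3 * Y) `^ xp p * Yj x z j `^ p))); last by ring.
    have A00 := ltW A0.
    apply: ler_pM; rewrite ?mulr_ge0 ?sqr_ge0 ?powR_ge0//.
      by rewrite ler_wpM2l ?sqr_ge0.
    by rewrite ler_wpM2l.
  rewrite -!mulr_sumr.
  have -> : (2 * (B / 2 ^+ k)) `^ a = (2 * B) `^ a / be ^+ k.
    rewrite mulrA powRM ?mulr_ge0 ?invr_ge0 ?exprn_ge0 ?(ltW B0)//; congr (_ * _).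
    rewrite -[2 ^- k]powR_invn// -powRrM mulNr mulrC powRN powRrM powR_mulrn ?powR_ge0//.
  rewrite (_ : V0 / _ = kap * A ^+ 2 * ((2 * B) `^ a / be ^+ k * (3 * Y) `^ xp p * b1)); last by rewrite /V0; ring.
  apply: ler_wpM2l; first by rewrite mulr_ge0 ?sqr_ge0 ?(ltW kap0).
  apply: ler_wpM2l; last exact: sumY.
  by rewrite !mulr_ge0 ?invr_ge0 ?powR_ge0// ltW.
- move=> x z [Tx Tz xz].
  apply: (@le_trans _ _ (\sum_j A * (2 * (B / 2 ^+ K)) * (w j + w j * Yj x z j `^ p))); last first.
    rewrite -mulr_sumr ler_wpM2l//; last by rewrite big_split/= lerD// sumY.
    by rewrite !mulr_ge0 ?invr_ge0 ?exprn_ge0 ?(ltW A0) ?(ltW B0).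
  apply: ler_sum => j _; rewrite -mulrBr normrM ger0_norm//.
  apply: (@le_trans _ _ (w j * (A * `|l x j - l z j| * Yj x z j `^ (p - 1)))).
    by rewrite ler_wpM2l// psiL.
  rewrite (_ : A * _ * (w j + _) = w j * (A * (2 * (B / 2 ^+ K)) * (1 + Yj x z j `^ p))); last by ring.
  rewrite ler_wpM2l// ler_pM ?powR_ge0 ?mulr_ge0 ?(ltW A0)//.
    by rewrite ler_wpM2l// ltW.
  exact: powRB1_le.
- by move=> k; rewrite divr_gt0.
move=> k _.
have [n sn nG] := ssz k; have [n' sn' nG'] := ssz k.+1.
pose L : R := ln (2 * m + 1)%:R.
have m1 : (1 : R) <= (2 * m + 1)%:R by rewrite ler1n addn1.
have L0 : 0 <= L by apply: ln_ge0.
have eL i : ((2 * m + 1) ^ i)%:R = expR (L * i%:R).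
  by rewrite expRM lnK ?posrE ?(lt_le_trans _ m1)// powR_mulrn ?ler0n// natrX.
(* G be^k + G be^(k+1) <= 5 G be^k, because be <= 4. *)
have NN : (size (s k) * size (s k.+1))%:R <= expR (L * (5 * G * be ^+ k)).
  apply: (@le_trans _ _ (expR (L * (n + n')%:R))).
    by rewrite -eL ler_nat expnD leq_mul.
  rewrite ler_expR ler_wpM2l// natrD.
  rewrite exprS -/be in nG'.
  have : G * be ^+ k * be <= G * be ^+ k * 4 by rewrite ler_wpM2l ?mulr_ge0 ?(ltW (bek0 k)).
  move: nG nG'; rewrite -/be; lra.
have lnd : 0 <= ln (2 / del) by rewrite ln_ge0// ler_pdivlMr// mul1r (le_trans del1)// ler1n.
have Vk : V0 / be ^+ k + V0 / be ^+ k.+1 <= 2 * (V0 / be ^+ k).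
  rewrite exprS invfM mulrC mulr_natl mulr2n lerD2l// [V0 * _]mulrC.
  rewrite ler_pM2r// ler_piMl ?invr_ge0 ?(ltW (bek0 k))//.
  by rewrite invf_le1 ?(le_trans _ be2) ?(lt_le_trans _ be2)// ler1n.
have VV : 0 < V0 / be ^+ k + V0 / be ^+ k.+1.
  by rewrite addr_gt0// divr_gt0.
have key : ln (2 / del) + L * (5 * G * be ^+ k) <= lam ^+ 2 / (16 * (V0 / be ^+ k + V0 / be ^+ k.+1)).
  rewrite ler_pdivlMr ?mulr_gt0//.
  apply: (@le_trans _ _ ((ln (2 / del) + L * (5 * G * be ^+ k)) * (16 * (2 * (V0 / be ^+ k))))).
    by rewrite ler_wpM2l ?ler_wpM2l// addr_ge0// !mulr_ge0// ltW.
  apply: le_trans lamE.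
  rewrite -/b1 -/V0 -/L.
  rewrite (_ : _ * (16 * _) = 32 * V0 * (ln (2 / del) / be ^+ k + 5 * G * L)); last first.
    by field; rewrite gt_eqF.
  apply: ler_wpM2l; first by rewrite mulr_ge0 ?(ltW V00).
  rewrite lerD2r ler_pdivrMr; last exact: bek0.
  by rewrite ler_peMr.
rewrite mulrA -ler_pdivlMr ?expR_gt0// expRN invrK.
apply: (@le_trans _ _ (expR (L * (5 * G * be ^+ k)) * 2)); first by rewrite ler_wpM2r.
apply: (@le_trans _ _ (del * expR (ln (2 / del) + L * (5 * G * be ^+ k)))); last first.
  by rewrite ler_pM2l// ler_expR.
rewrite expRD lnK ?posrE ?divr_gt0//; set E := expR (L * _).
by rewrite (_ : del * _ = E * 2)//; field; rewrite gt_eqF.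
Qed.

End ConditionalTail.

(** * The Euclidean dot product, and functionals represented in another form *)

Section DotProduct.
Variables (R : realType) (r : nat).
Implicit Types x y z : 'rV[R]_r.

Definition dot x y : R := \sum_i x 0 i * y 0 i.

Lemma dotC x y : dot x y = dot y x.
Proof. by apply: eq_bigr => i _; rewrite mulrC. Qed.

Lemma dotDl x y z : dot (x + y) z = dot x z + dot y z.
Proof. by rewrite -big_split; apply: eq_bigr => i _; rewrite mxE mulrDl. Qed.

Lemma dotZl a x y : dot (a *: x) y = a * dot x y.
Proof. by rewrite mulr_sumr; apply: eq_bigr => i _; rewrite mxE mulrA. Qed.

Lemma dotDr x y z : dot x (y + z) = dot x y + dot x z.
Proof. by rewrite dotC dotDl ![dot _ x]dotC. Qed.

Lemma dotZr a x y : dot x (a *: y) = a * dot x y.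
Proof. by rewrite dotC dotZl dotC. Qed.

Lemma dotBr x y z : dot x (y - z) = dot x y - dot x z.
Proof. by rewrite -scaleN1r dotDr dotZr mulN1r. Qed.

Lemma dot0r x : dot x 0 = 0.
Proof. by rewrite -(scale0r 0) dotZr mul0r. Qed.

Lemma dot_ge0 x : 0 <= dot x x.
Proof. by apply: sumr_ge0 => i _; rewrite -expr2 sqr_ge0. Qed.

Lemma dot_eq0 x : dot x x = 0 -> x = 0.
Proof.
move=> /eqP; rewrite psumr_eq0; last by move=> i _; rewrite -expr2 sqr_ge0.
move=> /allP x0; apply/rowP => i; rewrite mxE; apply/eqP.
by have := x0 i (mem_index_enum _); rewrite -expr2 sqrf_eq0.
Qed.

Lemma dot_cs x y : dot x y ^+ 2 <= dot x x * dot y y.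
Proof. apply: cauchy_schwarz; [exact: dotC|exact: dotDl|exact: dotZl|exact: dot_ge0]. Qed.

Lemma dotB_le x y : dot (x - y) (x - y) <= 2 * (dot x x + dot y y).
Proof.
rewrite /dot -big_split mulr_sumr; apply: ler_sum => i _; rewrite !mxE.
by have := sqr_ge0 (x 0 i + y 0 i); rewrite /=; lra.
Qed.

(** Riesz representation in the weighted form with Gram matrix G: u i = v i G^-1. Through it a net
    for the pairings with the u i, as the greedy construction gives, is a net for the rows v i. *)
Lemma quadratic_form_representers (m : nat) (w : 'I_m -> R) (v : 'I_m -> 'rV[R]_r) :
  (forall x, \sum_j w j * dot (v j) x ^+ 2 = 0 -> x = 0) ->
  exists u : 'I_m -> 'rV[R]_r, forall i y,
    \sum_j w j * (dot (v j) (u i) * dot (v j) y) = dot (v i) y.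
Proof.
move=> nondeg.
pose G : 'M[R]_r := \matrix_(a, b) \sum_j w j * (v j 0 a * v j 0 b).
have GE x : x *m G = \sum_j (w j * dot (v j) x) *: v j.
  apply/rowP => b; rewrite !mxE summxE.
  transitivity (\sum_a \sum_j w j * (v j 0 a * x 0 a) * v j 0 b).
    by apply: eq_bigr => a _; rewrite mxE mulr_sumr; apply: eq_bigr => j _; ring.
  rewrite exchange_big; apply: eq_bigr => j _; rewrite mxE /dot mulr_sumr mulr_suml.
  by apply: eq_bigr => a _.
have dotG x y : dot (x *m G) y = \sum_j w j * (dot (v j) x * dot (v j) y).
  rewrite GE /dot; under eq_bigr do rewrite summxE mulr_suml.
  rewrite exchange_big; apply: eq_bigr => j _; rewrite mulrA [RHS]mulr_sumr.
  by apply: eq_bigr => a _; rewrite mxE mulrA.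
have Gu : G \in unitmx.
  rewrite -row_free_unit; apply: inj_row_free => x xG; apply: nondeg.
  transitivity (dot (x *m G) x); first by rewrite dotG; apply: eq_bigr => j _; rewrite expr2.
  by rewrite xG dotC dot0r.
exists (fun i => v i *m invmx G) => i y.
by rewrite -dotG mulmxKV.
Qed.

End DotProduct.

(** * Sampled quadratic and p-norm forms, and their nets *)

Section SampledModel.
Variables (R : realType) (I : finType) (r : nat) (v : I -> 'rV[R]_r) (om : I -> R).
Variables (W CL p B : R) (m : nat).
Hypotheses (I0 : (0 < #|I|)%N) (m0 : (0 < m)%N) (p1 : 1 <= p)
  (om0 : forall i, 0 <= om i) (omW : forall i, om i <= W) (W0 : 0 < W) (CL1 : 1 <= CL)
  (v1 : forall i, dot (v i) (v i) <= 1).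

(** Under a uniform index, [om] is an importance weight: [qform] and [pnorm] are the exact quadratic
    form and p-th power of the norm, [qsample] and [psample] their unbiased estimates from m
    draws. *)
Definition qform x : R := Ex (fun i => om i * dot (v i) x ^+ 2).
Definition pnorm x : R := Ex (fun i => om i * `|dot (v i) x| `^ p).
Definition sweight (S : {ffun 'I_m -> I}) j : R := om (S j) / m%:R.
Definition qsample S x : R := \sum_j sweight S j * dot (v (S j)) x ^+ 2.
Definition psample S x : R := \sum_j sweight S j * `|dot (v (S j)) x| `^ p.

Hypotheses (lewis : forall x, dot x x <= CL * qform x)
  (B1 : 1 <= B) (pnormB : forall x, pnorm x <= 1 -> dot x x <= B ^+ 2).

Let kap := W / m%:R.

Let mR0 : 0 < m%:R :> R. Proof. by rewrite ltr0n. Qed.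
Let kap0 : 0 < kap. Proof. by rewrite divr_gt0. Qed.
Let p0 : 0 < p. Proof. exact: lt_le_trans p1. Qed.

Lemma sweightP S j : 0 <= sweight S j <= kap.
Proof. by rewrite divr_ge0//= ler_wpM2r ?invr_ge0. Qed.

Lemma sum_sweight S : \sum_j sweight S j <= W.
Proof.
apply: (@le_trans _ _ (\sum_(j < m) kap)).
  by apply: ler_sum => j _; have /andP[] := sweightP S j.
by rewrite sumr_const card_ord -[_ *+ m]mulr_natr divfK// gt_eqF.
Qed.

Lemma functional_le x b i : 0 <= b -> dot x x <= b ^+ 2 -> `|dot (v i) x| <= b.
Proof.
move=> b0 xb; rewrite -(@ler_pXn2r _ 2)// ?nnegrE// real_normK ?num_real//.
apply: (le_trans (dot_cs _ _)); apply: le_trans xb.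
by rewrite ler_piMl// dot_ge0.
Qed.

Lemma pnormZ a x : pnorm (a *: x) = `|a| `^ p * pnorm x.
Proof.
rewrite -ExZ; apply: eq_Ex => i; rewrite dotZr normrM powRM//; ring.
Qed.

Lemma psampleZ S a x : psample S (a *: x) = `|a| `^ p * psample S x.
Proof.
rewrite mulr_sumr; apply: eq_bigr => j _; rewrite dotZr normrM powRM//; ring.
Qed.

Lemma qsample_ge0 S x : 0 <= qsample S x.
Proof. by apply: sumr_ge0 => j _; rewrite mulr_ge0 ?sqr_ge0// divr_ge0. Qed.

Definition lower_isometry S := forall x, qform x <= 2 * qsample S x.

(** For p >= 2 the Euclidean form serves: the rows have norm at most 1, and differences of points of
    T have norm at most 2B. For p < 2 the form is [qsample]: on a difference whose row values are at
    most 2t it is bounded by (2t)^(2-p) times a sampled p-norm, which yields the rate t^-p. The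
    constant 65 = 4 * 2 * 8 + 1 comes from the second case and exceeds the 17 of the first. *)
Lemma sample_cover S C : lower_isometry S \/ 2 <= p -> 1 <= C ->
  let T x := pnorm x <= 1 /\ psample S x <= C in
  forall x0, T x0 -> exists s : nat -> seq 'rV[R]_r,
  [/\ s 0 = [:: x0], forall k y, y \in s k -> T y,
      forall k, exists2 n, (size (s k) <= (2 * m + 1) ^ n)%N
                         & n%:R <= (65 * CL * C) * ((2 `^ Num.min p 2) ^+ k - 1)
    & forall k x, T x -> exists2 y, y \in s k
        & forall j, `|dot (v (S j)) x - dot (v (S j)) y| <= 2 * (B / 2 ^+ k)].
Proof.
move=> LS C1 T x0 Tx0.
have B0 : 0 < B by exact: lt_le_trans B1.
have C0 : 0 < C by exact: lt_le_trans C1.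
have Tsup x j : T x -> `|dot (v (S j)) x| <= B.
  by move=> [Tx _]; apply: functional_le (pnormB Tx); exact: ltW.
have a1 : 1 <= Num.min p 2 by rewrite le_min p1 ler1n.
have CLC : 1 <= CL * C by rewrite -[leLHS]mulr1 ler_pM.
have [p2|] := boolP (2 <= p); last rewrite -ltNge => p2.
  have -> : Num.min p 2 = 2 by apply/min_idPr.
  have Tdiff x x' t : T x -> T x' -> 0 < t ->
      (forall j, `|dot (v (S j)) (x - x')| <= 2 * t) ->
      dot (x - x') (x - x') <= (4 * B ^+ 2) * t `^ (2 - 2).
    move=> [Tx _] [Tx' _] _ _; rewrite subrr powRr0 mulr1.
    apply: (le_trans (dotB_le _ _)); have := pnormB Tx; have := pnormB Tx'; lra.
  have D0 : 0 <= 4 * B ^+ 2 by rewrite mulr_ge0 ?sqr_ge0.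
  have GE : 4 * 1 * (4 * B ^+ 2) * B `^ (- 2) + 1 <= 65 * CL * C.
    rewrite powRN powR_mulrn ?(ltW B0)// (_ : _ / _ = 16); last by field; rewrite gt_eqF.
    have : 65 * 1 <= 65 * (CL * C) by rewrite ler_pM2l.
    lra.
  have [s [s0 sT sn sc]] := multiscale_cover (@dotC R r) (@dotDl R r) (@dotZl R r) (@dot_ge0 R r)
    ltr01 (fun j => v1 (S j)) B0 D0 (ler1n _ 2) Tx0 Tsup Tdiff GE.
  exists s; split=> // k x Tx; have [y ys hy] := sc k x Tx; exists y => // j.
  by rewrite -dotBr.
have {}LS : lower_isometry S by case: LS => //; lra.
have -> : Num.min p 2 = p by apply/min_idPl; exact: ltW.
have QCL x : dot x x <= (2 * CL) * qsample S x.
  apply: (le_trans (lewis x)); have := LS x => h.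
  rewrite [2 * CL]mulrC -mulrA; apply: ler_wpM2l => //; exact: le_trans CL1.
have [|u uP] := @quadratic_form_representers R r m (sweight S) (fun j => v (S j)).
  move=> x qx; apply: dot_eq0; apply/eqP; rewrite eq_le dot_ge0 andbT.
  by have := QCL x; rewrite /qsample qx mulr0.
pose BQ x y := \sum_j sweight S j * (dot (v (S j)) x * dot (v (S j)) y).
have BQq x : BQ x x = qsample S x by apply: eq_bigr => j _; rewrite expr2.
have BQC x y : BQ x y = BQ y x by apply: eq_bigr => j _; rewrite [dot _ x * _]mulrC.
have BQD x y z : BQ (x + y) z = BQ x z + BQ y z.
  by rewrite -big_split; apply: eq_bigr => j _; rewrite dotDr mulrDl mulrDr.
have BQZ a x y : BQ (a *: x) y = a * BQ x y.
  by rewrite mulr_sumr; apply: eq_bigr => j _; rewrite dotZr; ring.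
have BQ0 x : 0 <= BQ x x by rewrite BQq qsample_ge0.
have CL0 : 0 < 2 * CL by rewrite mulr_gt0// (lt_le_trans _ CL1).
(* Since u j represents v (S j), q = <v (S j), u j>, so q^2 <= |u j|^2 <= 2 CL q. *)
have uc j : BQ (u j) (u j) <= 2 * CL.
  set q := BQ (u j) (u j).
  have q2 : q ^+ 2 <= 2 * CL * q.
    rewrite {1}/q [BQ (u j) (u j)]uP; apply: (le_trans (dot_cs _ _)).
    apply: (@le_trans _ _ (dot (u j) (u j))); first by rewrite ler_piMl ?dot_ge0.
    by apply: (le_trans (QCL _)); rewrite -BQq.
  have [->|qn0] := eqVneq q 0; first exact: ltW.
  have q0 : 0 < q by rewrite lt0r qn0 BQ0.
  by rewrite -(ler_pM2r q0) -expr2.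
have Tsup' x j : T x -> `|BQ (u j) x| <= B by move=> Tx; rewrite /BQ uP Tsup.
have Tdiff x x' t : T x -> T x' -> 0 < t ->
    (forall j, `|BQ (u j) (x - x')| <= 2 * t) ->
    BQ (x - x') (x - x') <= (8 * C) * t `^ (2 - p).
  move=> [_ Tx] [_ Tx'] t0 ht; rewrite BQq.
  apply: (@le_trans _ _ (\sum_j (2 * t) `^ (2 - p) * (2 `^ p * (sweight S j * `|dot (v (S j)) x| `^ p
     + sweight S j * `|dot (v (S j)) x'| `^ p)))).
    apply: ler_sum => j _; have /andP[wj0 _] := sweightP S j.
    have := ht j; rewrite /BQ uP => hj.
    set z := `|dot (v (S j)) (x - x')| in hj *.
    have z0 : 0 <= z by exact: normr_ge0.
    have -> : dot (v (S j)) (x - x') ^+ 2 = z `^ (2 - p) * z `^ p.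
      rewrite -powRD; last by rewrite subrK pnatr_eq0.
      by rewrite subrK powR_mulrn// real_normK// num_real.
    set a := `|dot (v (S j)) x|; set b := `|dot (v (S j)) x'|.
    rewrite [leRHS](_ : _ = sweight S j * ((2 * t) `^ (2 - p) * (2 `^ p * (a `^ p + b `^ p)))); last by ring.
    apply: ler_wpM2l => //; apply: ler_pM; rewrite ?powR_ge0//.
      by apply: ge0_ler_powR; rewrite ?nnegrE ?(le_trans z0 hj)//; lra.
    have zle : z <= 2 * Num.max a b.
      rewrite /z dotBr; apply: (le_trans (ler_normB _ _)).
      change (a + b <= 2 * Num.max a b).
      have aM : a <= Num.max a b by rewrite le_max lexx.
      have bM : b <= Num.max a b by rewrite le_max lexx orbT.
      lra.
    apply: (@le_trans _ _ ((2 * Num.max a b) `^ p)).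
      by apply: ge0_ler_powR; rewrite ?nnegrE ?(le_trans z0 zle) ?(ltW p0).
    rewrite powRM ?le_max ?normr_ge0//; apply: ler_wpM2l; first exact: powR_ge0.
    have [->|->] : Num.max a b = a \/ Num.max a b = b by case: (leP a b); tauto.
      by rewrite lerDl powR_ge0.
    by rewrite lerDr powR_ge0.
  rewrite -!mulr_sumr big_split/= -/(psample S x) -/(psample S x').
  rewrite powRM ?(ltW t0)//.
  rewrite (_ : 2 `^ (2 - p) * t `^ (2 - p) * (2 `^ p * _) =
    (2 `^ (2 - p) * 2 `^ p) * (psample S x + psample S x') * t `^ (2 - p)); last by ring.
  rewrite -powRD ?pnatr_eq0 ?implybT// subrK powR_mulrn// ler_wpM2r ?powR_ge0//.
  by rewrite -natrX; lra.
have D0 : 0 <= 8 * C by rewrite mulr_ge0 ?(ltW C0).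
have GE : 4 * (2 * CL) * (8 * C) * B `^ (- p) + 1 <= 65 * CL * C.
  have Bp : B `^ (- p) <= 1.
    rewrite powRN invf_le1 ?powR_gt0//.
    exact: le_trans B1 (le1r_powR B1 p1).
  apply: (@le_trans _ _ (4 * (2 * CL) * (8 * C) * 1 + 1)).
    rewrite lerD2r ler_wpM2l// !mulr_ge0 ?(ltW C0)// ?(le_trans _ CL1)//.
  move: CLC; rewrite -[65 * _ * _]mulrA; lra.
have [s [s0 sT sn sc]] := multiscale_cover BQC BQD BQZ BQ0
    CL0 uc B0 D0 p1 Tx0 Tsup' Tdiff GE.
exists s; split=> // k x Tx; have [y ys hy] := sc k x Tx; exists y => // j.
by rewrite -dotBr; have := hy j; rewrite /BQ uP.
Qed.

Lemma sample_tail S (psi : I -> R -> R) (y : I -> R) (x0 : 'rV[R]_r)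
    (A C Y lam del : R) (K : nat) : lower_isometry S \/ 2 <= p ->
  0 < A -> B <= Y -> 1 <= C -> 0 < del <= 1 -> 0 <= lam ->
  pnorm x0 <= 1 -> psample S x0 <= C ->
  (forall i, 0 <= y i <= Y) -> \sum_j sweight S j * y (S j) `^ p <= C ->
  (forall i a b, `|psi i a - psi i b| <= A * `|a - b| * (`|a| + `|b| + y i) `^ (p - 1)) ->
  (forall i, psi i (dot (v i) x0) = 0) ->
  32 * (kap * A ^+ 2 * (3 `^ (p + 1) * C) * (3 * Y) `^ xp p * (2 * B) `^ Num.min p 2)
    * (ln (2 / del) + 5 * (65 * CL * C) * ln (2 * m + 1)%:R) <= lam ^+ 2 ->
  Pr R (fun g : {ffun 'I_m -> bool} => exists x, (pnorm x <= 1 /\ psample S x <= C) /\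
      K%:R * lam + A * (2 * (B / 2 ^+ K)) * (W + 3 `^ (p + 1) * C)
        < `|\sum_j sgb R (g j) * (sweight S j * psi (S j) (dot (v (S j)) x))|) <= K%:R * del.
Proof.
move=> LS A0 BY C1 /andP[del0 del1] lam0 x01 x0C yY yC psiL psi0 lamE.
have B0 : 0 < B by exact: lt_le_trans B1.
have C0 : 0 < C by exact: lt_le_trans C1.
have CL0 : 0 < CL by exact: lt_le_trans CL1.
have [s [s0 sT sn sc]] := sample_cover LS C1 (conj x01 x0C).
have G0 : 0 <= 65 * CL * C by rewrite !mulr_ge0// ltW.
have TB (x : 'rV[R]_r) j : pnorm x <= 1 /\ psample S x <= C -> `|dot (v (S j)) x| <= B.
  by move=> [Tx _]; apply: functional_le (pnormB Tx); exact: ltW.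
exact: (@conditional_tail R p kap A W C Y B _ lam del m K _
  (fun x => pnorm x <= 1 /\ psample S x <= C) x0 (fun x j => dot (v (S j)) x)
  (sweight S) (fun j => psi (S j)) (fun j => y (S j)) s p1 kap0 A0 B0 BY C0 G0 del0 del1 lam0
  (sweightP S) (sum_sweight S) TB (fun x h => proj2 h) (fun j => yY (S j)) yC
  (fun j => psiL (S j)) (fun j => psi0 (S j)) s0 sT sn sc lamE).
Qed.

End SampledModel.

(** * Events of high probability for the sample *)

Section UniformDeviation.
Variables (R : realType) (I : finType) (r : nat) (v : I -> 'rV[R]_r) (om : I -> R).
Variables (W CL p B : R) (m : nat).
Hypotheses (I0 : (0 < #|I|)%N) (m0 : (0 < m)%N) (p1 : 1 <= p)
  (om0 : forall i, 0 <= om i) (omW : forall i, om i <= W) (W0 : 0 < W) (CL1 : 1 <= CL)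
  (v1 : forall i, dot (v i) (v i) <= 1)
  (lewis : forall x, dot x x <= CL * qform v om x)
  (B1 : 1 <= B) (pnormB : forall x, pnorm v om p x <= 1 -> dot x x <= B ^+ 2).

Let kap := W / m%:R.
Let mR0 : 0 < m%:R :> R. Proof. by rewrite ltr0n. Qed.
Let kap0 : 0 < kap. Proof. by rewrite divr_gt0. Qed.
Let p_gt0 : 0 < p. Proof. exact: lt_le_trans p1. Qed.
Let CL0 : 0 < CL. Proof. exact: lt_le_trans CL1. Qed.
Let B0 : 0 < B. Proof. exact: lt_le_trans B1. Qed.

Let norm_powR2 (a : R) : `|a| `^ 2 = a ^+ 2.
Proof. by rewrite powR_mulrn// real_normK// num_real. Qed.

(** Bounds two quantities at once: the variance of a sampled increment, used with Chebyshev for the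
    ghost sample, and the variance of the coarsest level of the chain in [conditional_tail]. *)
Definition increment_variance A C Y q b : R :=
  kap * A ^+ 2 * (3 `^ (q + 1) * C) * (3 * Y) `^ xp q * (2 * b) `^ Num.min q 2.

Definition tail_budget A C Y q b del : R :=
  32 * increment_variance A C Y q b
    * (ln (2 / del) + 5 * (65 * CL * C) * ln (2 * m + 1)%:R).

(** This is the model with exponent 2, where [sample_cover] takes its Euclidean branch, so nothing
    is circular. A failing x is scaled to [qform] 1; its sampled form is below 1/2, while the ghost
    sample is within 1/4 of 1 with probability at least 1/2. The form is its own envelope, as 1/2 +
    5/4 <= 2. *)
Lemma lower_isometry_whp (lam del : R) (K : nat) :
  0 < del <= 1 -> 0 <= lam -> tail_budget 1 2 CL 2 CL del <= lam ^+ 2 ->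
  K%:R * lam + 1 * (2 * (CL / 2 ^+ K)) * (W + 3 `^ (2 + 1) * 2) < 1 / 8 ->
  32 * kap * CL <= 1 ->
  Pr R (fun S : {ffun 'I_m -> I} => ~ lower_isometry v om S) <= 4 * (K%:R * del).
Proof.
move=> del01 lam0 tb lamK kapCL.
have del0 : 0 < del by case/andP: del01.
have qE x : pnorm v om 2 x = qform v om x.
  by apply: eq_Ex => i; rewrite norm_powR2.
have qsE (S : {ffun 'I_m -> I}) x : psample v om 2 S x = qsample v om S x.
  by apply: eq_bigr => i _; rewrite norm_powR2.
pose h (x : 'rV[R]_r) i := om i / m%:R * dot (v i) x ^+ 2.
have h0 x i : 0 <= h x i by rewrite mulr_ge0 ?sqr_ge0 ?divr_ge0.
have Exh x : m%:R * Ex (h x) = qform v om x.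
  by rewrite -ExZ; apply: eq_Ex => i; rewrite /h; field; rewrite gt_eqF.
have sumh (S : {ffun 'I_m -> I}) x : \sum_j h x (S j) = qsample v om S x by [].
have dotq x : qform v om x <= 1 -> dot x x <= CL.
  by move=> qx; apply: (le_trans (lewis x)); rewrite ger_pMr.
have CLs : CL <= CL ^+ 2 by rewrite expr2 ler_peMr// ltW.
have := @symmetrization R m I _ (fun x => qform v om x <= 1) h h (1 / 4) 2
  (K%:R * del) (fun S => ~ lower_isometry v om S) (fun=> True) h0.
rewrite [Pr R (fun=> ~ True)]Pr_eq0; last by move=> S; apply.
rewrite add0r; apply; last 2 first.
- by rewrite mulr_ge0// ltW.
- move=> S _.
  have B2 : 1 <= CL by [].
  have pB x : pnorm v om 2 x <= 1 -> dot x x <= CL ^+ 2.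
    by rewrite qE => /dotq /le_trans; apply.
  have z1 : pnorm v om 2 (0 : 'rV[R]_r) <= 1.
    rewrite -(scale0r 0) pnormZ normr0 powR0 ?mul0r//.
  have z2 : psample v om 2 S (0 : 'rV[R]_r) <= 2.
    by rewrite -(scale0r 0) psampleZ normr0 powR0 ?mul0r.
  have y0 (i : I) : (0 : R) <= 0 <= CL by rewrite lexx ltW.
  have sy : \sum_j sweight om S j * 0 `^ 2 <= 2.
    by rewrite big1// => j _; rewrite powR0 ?mulr0.
  have psiL (i : I) (a b : R) : `|a ^+ 2 - b ^+ 2| <= 1 * `|a - b| * (`|a| + `|b| + 0) `^ (2 - 1).
    rewrite (_ : 2 - 1 = 1 :> R); last by ring.
    rewrite mul1r addr0 powRr1 ?addr_ge0// subr_sqr normrM ler_wpM2l//.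
    exact: ler_normD.
  have psi0 (i : I) : dot (v i) 0 ^+ 2 = 0 by rewrite dot0r expr0n.
  have := sample_tail (psi := fun _ s => s ^+ 2) (y := fun=> 0) (A := 1) (C := 2) (Y := CL) (p := 2) (B := CL)
    m0 (ler1n _ 2) om0 omW W0 CL1 v1 lewis CL1 pB K (or_intror (lexx _)) ltr01 (lexx _) (ler1n _ 2)
    del01 lam0 z1 z2 y0 sy psiL psi0 tb.
  move/(le_trans _); apply; apply: Pr_le => g [x [qx [hx sx]]]; exists x.
  rewrite qE qsE; split=> //; move: hx; rewrite (_ : 1 / 4 / 2 = 1 / 8); last by field.
  exact: lt_le_trans.
move=> S /existsNP[x /negP]; rewrite -ltNge => qx.
have q0 : 0 < qform v om x.
  by apply: le_lt_trans qx; rewrite mulr_ge0// qsample_ge0.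
pose x' := (Num.sqrt (qform v om x))^-1 *: x.
have sc2 : `|(Num.sqrt (qform v om x))^-1| `^ 2 = (qform v om x)^-1.
  by rewrite norm_powR2 exprVn sqr_sqrtr// ltW.
have qx' : qform v om x' = 1 by rewrite -qE pnormZ qE sc2 mulVf// gt_eqF.
have qsx' : qsample v om S x' < 1 / 2.
  by rewrite -qsE psampleZ qsE sc2 mulrC ltr_pdivrMr//; lra.
exists x'; rewrite qx'; split=> //.
have S0 := card_ffun_gt0 m I0.
have := chebyshev_sum m (h x') I0 (a := 1 / 4); rewrite Exh qx' => /(_ ltac:(lra)) cheb.
have var : m%:R * Ex (fun i => h x' i ^+ 2) / (1 / 4) ^+ 2 <= 1 / 2.
  have : m%:R * Ex (fun i => h x' i ^+ 2) <= kap * CL; last by lra.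
  rewrite -ExZ -[leRHS]mulr1 -{2}qx' -ExZ; apply: Ex_le => i.
  have d1 : dot (v i) x' ^+ 2 <= CL.
    apply: (le_trans (dot_cs _ _)); apply: (le_trans _ (dotq x' _)); last by rewrite qx'.
    by rewrite ler_piMl// dot_ge0.
  rewrite /h; move: (dot (v i) x' ^+ 2) (sqr_ge0 (dot (v i) x')) d1 => q q_ge0 d1.
  rewrite (_ : m%:R * _ = om i / m%:R * (om i * q) * q); last by field; rewrite gt_eqF.
  rewrite (_ : kap * CL * _ = kap * (om i * q) * CL); last by ring.
  apply: ler_pM; rewrite ?mulr_ge0 ?invr_ge0//.
  apply: ler_wpM2r; first by rewrite mulr_ge0.
  by apply: ler_wpM2r; rewrite ?invr_ge0.
have := PrN R (fun S' : {ffun 'I_m -> I} => 1 / 4 <= `|\sum_j h x' (S' j) - 1|) S0 => Pn.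
apply: (@le_trans _ _ (Pr R (fun S' : {ffun 'I_m -> I} => ~ 1 / 4 <= `|\sum_j h x' (S' j) - 1|))).
  by rewrite Pn; have := le_trans cheb var; lra.
apply: Pr_le => S' /negP; rewrite -ltNge ltr_norml => /andP[l1 l2].
rewrite sumrB big_split /= sumh in l1 l2 *.
rewrite !sumh in l1 l2 *.
split; last by lra.
by rewrite distrC ler_normr; apply/orP; left; lra.
Qed.

(** A failing x is scaled down until its sampled form is exactly 3, which keeps the envelope
    bounded: by Markov the ghost sample stays below 2 with probability at least 1/2, so the two
    differ by at least 1 and add up to at most 5. *)
Lemma upper_norm_whp (lam del : R) (K : nat) (C : R) : 5 <= C ->
  0 < del <= 1 -> 0 <= lam -> tail_budget p C B p B del <= lam ^+ 2 ->
  K%:R * lam + p * (2 * (B / 2 ^+ K)) * (W + 3 `^ (p + 1) * C) < 1 / 2 ->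
  Pr R (fun S : {ffun 'I_m -> I} => ~ (forall x, pnorm v om p x <= 1 -> psample v om p S x <= 3))
    <= 4 * (Pr R (fun S : {ffun 'I_m -> I} => ~ (lower_isometry v om S \/ 2 <= p)) + K%:R * del).
Proof.
move=> C5 del01 lam0 tb lamK.
have del0 : 0 < del by case/andP: del01.
pose h (x : 'rV[R]_r) i := om i / m%:R * `|dot (v i) x| `^ p.
have h0 x i : 0 <= h x i by rewrite mulr_ge0 ?powR_ge0 ?divr_ge0.
have Exh x : m%:R * Ex (h x) = pnorm v om p x.
  by rewrite -ExZ; apply: eq_Ex => i; rewrite /h; field; rewrite gt_eqF.
have sumh (S : {ffun 'I_m -> I}) x : \sum_j h x (S j) = psample v om p S x by [].
apply: (@symmetrization R m I _ (fun x => pnorm v om p x <= 1) h h 1 5 _ _ _ h0); last 2 first.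
- by rewrite mulr_ge0// ltW.
- move=> S LS.
  have C1 : 1 <= C by lra.
  have z1 : pnorm v om p (0 : 'rV[R]_r) <= 1.
    by rewrite -(scale0r 0) pnormZ normr0 powR0 ?mul0r// gt_eqF.
  have z2 : psample v om p S (0 : 'rV[R]_r) <= C.
    by rewrite -(scale0r 0) psampleZ normr0 powR0 ?gt_eqF// mul0r; lra.
  have y0 (i : I) : (0 : R) <= 0 <= B by rewrite lexx ltW.
  have sy : \sum_j sweight om S j * 0 `^ p <= C.
    by rewrite big1 ?(le_trans _ C1)// => j _; rewrite powR0 ?mulr0// gt_eqF.
  have psiL (i : I) (a b : R) : `| `|a| `^ p - `|b| `^ p| <= p * `|a - b| * (`|a| + `|b| + 0) `^ (p - 1).
    apply: (le_trans (powR_lipschitz (c := `|a| + `|b| + 0) p1 _ _ _ _)) => //; rewrite ?addr0 ?lerDl ?lerDr//.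
    by rewrite ler_wpM2r ?powR_ge0// ler_wpM2l ?(ltW p_gt0)// ler_dist_dist.
  have psi0 (i : I) : `|dot (v i) 0| `^ p = 0 by rewrite dot0r normr0 powR0// gt_eqF.
  have := sample_tail (psi := fun _ s => `|s| `^ p) (y := fun=> 0) (A := p) (C := C) (Y := B) (B := B)
    m0 p1 om0 omW W0 CL1 v1 lewis B1 pnormB K LS p_gt0 (lexx _) C1
    del01 lam0 z1 z2 y0 sy psiL psi0 tb.
  move/(le_trans _); apply; apply: Pr_le => g [x [qx [hx sx]]]; exists x.
  split; first by split=> //; exact: le_trans sx C5.
  exact: lt_le_trans hx.
move=> S /existsNP[x /not_implyP[nx /negP]]; rewrite -ltNge => zx.
have z0 : 0 < psample v om p S x by lra.
pose a := (3 / psample v om p S x) `^ p^-1.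
have ap : `|a| `^ p = 3 / psample v om p S x.
  by rewrite ger0_norm ?powR_ge0// -powRrM mulVf ?gt_eqF// powRr1// divr_ge0// ltW.
pose x' := a *: x.
have zx' : psample v om p S x' = 3 by rewrite psampleZ ap divfK// gt_eqF.
have nx' : pnorm v om p x' <= 1.
  rewrite pnormZ ap; apply: (@le_trans _ _ (1 * 1)); last by rewrite mulr1.
  apply: ler_pM => //; first by rewrite divr_ge0// ltW.
    by apply: Ex_ge0 => i; rewrite mulr_ge0 ?powR_ge0.
  by rewrite ler_pdivrMr//; lra.
exists x'; split=> //.
have S0 := card_ffun_gt0 m I0.
have mk : Pr R (fun S' : {ffun 'I_m -> I} => 2 <= \sum_j h x' (S' j)) <= 1 / 2.
  apply: (le_trans (Pr_markov _ _)) => //; first by move=> S'; exact: sumr_ge0.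
  by rewrite Ex_sum_proj// Exh; lra.
have := PrN R (fun S' : {ffun 'I_m -> I} => 2 <= \sum_j h x' (S' j)) S0 => Pn.
apply: (@le_trans _ _ (Pr R (fun S' : {ffun 'I_m -> I} => ~ 2 <= \sum_j h x' (S' j)))).
  by rewrite Pn; lra.
apply: Pr_le => S' /negP; rewrite -ltNge sumrB big_split /= !sumh zx' => lt.
split; last by lra.
by rewrite ler_normr; apply/orP; left; lra.
Qed.

(** Symmetrisation runs over pairs of a scale and a point, then a union bound over the scales. By
    Chebyshev the ghost sample is within eps / 2 of the mean with probability at least 1/2. The
    envelope is 0, since [good] already bounds the sampled forms. *)
Lemma uniform_deviation (J : finType) (psi : J -> I -> R -> R) (y : J -> I -> R)
    (xs : J -> 'rV[R]_r) (good : {ffun 'I_m -> I} -> Prop) (A C Y lam del eps : R) (K : nat) :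
  0 < A -> B <= Y -> 3 <= C -> 0 < del <= 1 -> 0 <= lam -> 0 < eps ->
  (forall k, pnorm v om p (xs k) <= 1) ->
  (forall k i, 0 <= y k i <= Y) -> (forall k, Ex (fun i => om i * y k i `^ p) <= C) ->
  (forall k i a b, `|psi k i a - psi k i b| <= A * `|a - b| * (`|a| + `|b| + y k i) `^ (p - 1)) ->
  (forall k i, psi k i (dot (v i) (xs k)) = 0) ->
  (forall S, good S -> [/\ lower_isometry v om S \/ 2 <= p,
     forall x, pnorm v om p x <= 1 -> psample v om p S x <= 3
     & forall k, \sum_j sweight om S j * y k (S j) `^ p <= C]) ->
  tail_budget A C Y p B del <= lam ^+ 2 ->
  K%:R * lam + A * (2 * (B / 2 ^+ K)) * (W + 3 `^ (p + 1) * C) < eps / 4 ->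
  8 * increment_variance A C Y p B <= eps ^+ 2 ->
  Pr R (fun S : {ffun 'I_m -> I} => exists k x, pnorm v om p x <= 1 /\
      eps < `|\sum_j sweight om S j * psi k (S j) (dot (v (S j)) x)
              - Ex (fun i => om i * psi k i (dot (v i) x))|)
    <= 4 * (Pr R (fun S => ~ good S) + #|J|%:R * (K%:R * del)).
Proof.
move=> A0 BY C3 del01 lam0 eps0 xs1 yY yC psiL psi0 goodP tb lamK varE.
have del0 : 0 < del by case/andP: del01.
have C1 : 1 <= C by lra.
have C0 : 0 < C by lra.
have Y0 : 0 < Y by exact: lt_le_trans BY.
pose h (kx : J * 'rV[R]_r) i := om i / m%:R * psi kx.1 i (dot (v i) kx.2).
have Exh kx : m%:R * Ex (h kx) = Ex (fun i => om i * psi kx.1 i (dot (v i) kx.2)).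
  by rewrite -ExZ; apply: eq_Ex => i; rewrite /h; field; rewrite gt_eqF.
apply: (@symmetrization R m I _ (fun kx => pnorm v om p kx.2 <= 1) h (fun _ _ => 0) (eps / 2) 0);
  last 2 first.
- by rewrite !mulr_ge0// ltW.
- move=> S /goodP[LS US YS].
  apply: (@le_trans _ _ (Pr R (fun g : {ffun 'I_m -> bool} => exists k : J, exists x,
      (pnorm v om p x <= 1 /\ psample v om p S x <= C) /\
      K%:R * lam + A * (2 * (B / 2 ^+ K)) * (W + 3 `^ (p + 1) * C)
        < `|\sum_j sgb R (g j) * (sweight om S j * psi k (S j) (dot (v (S j)) x))|))).
    apply: Pr_le => g [[k x]] /= [nx [hx _]]; exists k, x; split.
      by split=> //; apply: le_trans C3; exact: US.
    by apply: lt_le_trans hx; lra.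
  apply: (le_trans (Pr_exists _ _)).
  apply: (@le_trans _ _ (\sum_(k : J) (K%:R * del))); last by rewrite sumr_const -[_ *+ #|_|]mulr_natl.
  apply: ler_sum => k _.
  exact: (sample_tail m0 p1 om0 omW W0 CL1 v1 lewis B1 pnormB K LS A0 BY C1 del01 lam0
    (xs1 k) (le_trans (US _ (xs1 k)) C3) (yY k) (YS k) (psiL k) (psi0 k) tb).
  by [].
move=> S [k [x [nx dev]]]; exists (k, x); split=> //=.
have S0 := card_ffun_gt0 m I0.
have e20 : 0 < eps / 2 by rewrite divr_gt0.
have cheb := chebyshev_sum m (h (k, x)) I0 e20.
have funB z i : pnorm v om p z <= 1 -> `|dot (v i) z| <= B.
  by move=> nz; apply: functional_le (pnormB nz) => //; exact: ltW.
have var : m%:R * Ex (fun i => h (k, x) i ^+ 2) <= increment_variance A C Y p B.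
  have coef0 : 0 <= kap * A ^+ 2 * (2 * B) `^ Num.min p 2 * (3 * Y) `^ xp p.
    exact: mulr_ge0 (mulr_ge0 (mulr_ge0 (ltW kap0) (sqr_ge0 A)) (powR_ge0 _ _)) (powR_ge0 _ _).
  pose Yi i := `|dot (v i) x| + `|dot (v i) (xs k)| + y k i.
  have yk0 i : 0 <= y k i by case/andP: (yY k i).
  have Yi0 i : 0 <= Yi i by rewrite !addr_ge0.
  have YiY i : Yi i <= 3 * Y.
    rewrite /Yi; have := funB x i nx; have := funB _ i (xs1 k).
    by case/andP: (yY k i) => _; lra.
  apply: (@le_trans _ _ (Ex (fun i => (kap * A ^+ 2 * (2 * B) `^ Num.min p 2 * (3 * Y) `^ xp p)
       * (3 `^ p * (om i * `|dot (v i) x| `^ p + om i * `|dot (v i) (xs k)| `^ p + om i * y k i `^ p))))).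
    rewrite -ExZ; apply: Ex_le => i.
    set z := dot (v i) x; set zs := dot (v i) (xs k).
    have ps2 : psi k i z ^+ 2 <= A ^+ 2 * ((2 * B) `^ Num.min p 2 * (3 * Y) `^ xp p * Yi i `^ p).
      have := psiL k i z zs; rewrite psi0 subr0 => pl.
      apply: (@le_trans _ _ ((A * `|z - zs| * Yi i `^ (p - 1)) ^+ 2)).
        rewrite -(real_normK (num_real (psi k i z))) lerXn2r ?nnegrE//.
        by rewrite !mulr_ge0 ?powR_ge0// ltW.
      rewrite !exprMn -mulrA ler_wpM2l ?sqr_ge0//.
      have zB : `|z - zs| <= 2 * B.
        by apply: (le_trans (ler_normB _ _)); have := funB x i nx; have := funB _ i (xs1 k); rewrite -/z -/zs; lra.
      apply: increment_le => //.
      by apply: (le_trans (ler_normB _ _)); rewrite lerDl.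
    rewrite /h /= -/z (_ : m%:R * _ = om i / m%:R * (om i * psi k i z ^+ 2)); last first.
      by field; rewrite gt_eqF.
    move: (psi k i z ^+ 2) (sqr_ge0 (psi k i z)) ps2 => q q_ge0 ps2.
    apply: (@le_trans _ _ (kap * (om i * (A ^+ 2 * ((2 * B) `^ Num.min p 2 * (3 * Y) `^ xp p * Yi i `^ p))))).
      apply: ler_pM; rewrite ?mulr_ge0 ?invr_ge0//.
        by rewrite ler_wpM2r ?invr_ge0.
      by rewrite ler_wpM2l.
    rewrite [leLHS](_ : _ = kap * A ^+ 2 * (2 * B) `^ Num.min p 2 * (3 * Y) `^ xp p * (om i * Yi i `^ p)); last by ring.
    apply: ler_wpM2l; first exact: coef0.
    rewrite -!mulrDr mulrCA; apply: ler_wpM2l => //.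
    by apply: powR_add3_le => //; exact: ltW.
  rewrite ExZ ExZ !ExD -/(pnorm v om p x) -/(pnorm v om p (xs k)).
  rewrite /increment_variance.
  rewrite [leRHS](_ : _ = kap * A ^+ 2 * (2 * B) `^ Num.min p 2 * (3 * Y) `^ xp p * (3 `^ (p + 1) * C)); last by ring.
  apply: ler_wpM2l; first exact: coef0.
  rewrite powRD ?pnatr_eq0 ?implybT// powRr1// -mulrA; apply: ler_wpM2l; first exact: powR_ge0.
  by have := yC k; have := xs1 k; lra.
have cheb2 : Pr R (fun S' : {ffun 'I_m -> I} => eps / 2 <= `|\sum_j h (k, x) (S' j) - m%:R * Ex (h (k, x))|) <= 1 / 2.
  apply: (le_trans cheb); rewrite ler_pdivrMr ?exprn_gt0//.
  by rewrite exprMn; lra.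
have := PrN R (fun S' : {ffun 'I_m -> I} => eps / 2 <= `|\sum_j h (k, x) (S' j) - m%:R * Ex (h (k, x))|) S0 => Pn.
apply: (@le_trans _ _ (Pr R (fun S' : {ffun 'I_m -> I} => ~ eps / 2 <= `|\sum_j h (k, x) (S' j) - m%:R * Ex (h (k, x))|))).
  by rewrite Pn; lra.
apply: Pr_le => S' /negP; rewrite -ltNge => lt; split; last by rewrite big1// => j _; rewrite addr0.
rewrite Exh /= in lt; rewrite sumrB.
have := ler_normD (\sum_j h (k, x) (S j) - \sum_j h (k, x) (S' j))
  (\sum_j h (k, x) (S' j) - Ex (fun i => om i * psi k i (dot (v i) x))).
rewrite addrA subrK; move: dev lt; rewrite /h /sweight /=; lra.
Qed.

End UniformDeviation.

(** Bookkeeping for [approx_minimizer_risk]: [N] and [nx] are the p-th powers of the norms of the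
    minimiser and of [xs], [rp] is the scale, [T1] and [T2] are the exact and sampled scaled losses,
    q = p 2^p. The deviation rp e / 2 is at most e rho / 2 + e N, and e N cancels against the
    regulariser in the last hypothesis. *)
Lemma excess_risk_arith (R : realFieldType) (DS SR SX RX RS DE rp T1 T2 N e q rho nx : R) :
  DS <= SR - SX -> RX - RS = DE -> DE <= rp * T1 + q * e * RS ->
  rp * T2 <= DS + q * e * SX -> rp * T1 <= rp * T2 + rp * (e / 2) ->
  rp * (e / 2) <= (rho + 2 * N) * (e / 2) -> q * e * RS <= q * e * rho ->
  q * e * SX <= q * e * (100 * rho) -> e * (SX + e * nx) <= e * (101 * rho) ->
  e * nx <= e * rho -> 0 <= e * rho ->
  SR + e * N <= (1 + e) * (SX + e * nx) ->
  RX <= RS + (103 + 101 * q) * (e * rho).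
Proof. lra. Qed.

(** [D], [U] and [L] are the failure probabilities of the deviation bound, the upper norm bound and
    the lower isometry; [Z] is that of Markov's bound at [xs]. In total 100 e + 5 Z <= 100/3000 +
    5/100 < 1/10. *)
Lemma failure_probability_arith (R : realFieldType) (e kd D U L L' Z G : R) :
  D <= 4 * (G + e) -> U <= 4 * (L' + kd) -> L <= 4 * kd -> L' <= L -> Z <= 1 / 100 ->
  G <= L + (U + Z) -> e <= 1 / 3000 -> kd <= e -> D + Z <= 1 / 10.
Proof. lra. Qed.

(** * Excess risk of approximate minimisers of the sampled objective *)

Section SampledRegression.
Variables (R : realType) (I : finType) (r : nat) (v : I -> 'rV[R]_r) (om : I -> R).
Variables (W CL p B : R) (m : nat).
Hypotheses (I0 : (0 < #|I|)%N) (m0 : (0 < m)%N) (p1 : 1 <= p)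
  (om0 : forall i, 0 <= om i) (omW : forall i, om i <= W) (W0 : 0 < W) (CL1 : 1 <= CL)
  (v1 : forall i, dot (v i) (v i) <= 1)
  (lewis : forall x, dot x x <= CL * qform v om x)
  (B1 : 1 <= B) (pnormB : forall x, pnorm v om p x <= 1 -> dot x x <= B ^+ 2).
Variables (F : I -> R -> R) (beta : I -> R).
Hypothesis FL : forall i s t, `|F i s - F i t| <= `|s - t|.

Definition loss i s : R := `|F i s - beta i| `^ p.
Definition risk x : R := Ex (fun i => om i * loss i (dot (v i) x)).
Definition sample_risk (S : {ffun 'I_m -> I}) x : R :=
  \sum_j sweight om S j * loss (S j) (dot (v (S j)) x).

Variables (eps rho : R) (xs : 'rV[R]_r).
Hypotheses (eps0 : 0 < eps) (eps1 : eps <= 1) (rho0 : 0 < rho)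
  (risk_rho : risk xs + pnorm v om p xs <= rho).

Let p_gt0 : 0 < p. Proof. exact: lt_le_trans p1. Qed.
Let p_ge0 : 0 <= p. Proof. exact: ltW. Qed.
Let B0 : 0 < B. Proof. exact: lt_le_trans B1. Qed.
Definition noise i := F i (dot (v i) xs) - beta i.
(** Two points at scale k differ on a row by at most 2 B radius k, which is eps times [cutoff] times
    radius k. *)
Definition cutoff := 2 * B / eps.
Definition radius (k : nat) : R := (rho * 2 ^+ k) `^ p^-1.
(* Outside the inliers, the loss between [xs] and a point at scale [k] changes by
   a fraction of order [eps] of its value at [xs]. *)
Definition inlier k i := `|noise i| <= cutoff * radius k.
(** The argument is measured in units of [radius k] and the value in its p-th power, so that every
    scale becomes an instance of the unit ball in [uniform_deviation]. *)
Definition scaled_loss (k : nat) i s : R :=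
  if inlier k i then (loss i (radius k * s) - loss i (dot (v i) xs)) / (rho * 2 ^+ k) else 0.
(** Supplies [y] in [uniform_deviation]: the part of a residual that does not depend on the
    argument, in units of [radius k]. *)
Definition offset (k : nat) i : R :=
  `|dot (v i) xs| / radius k + (if inlier k i then `|noise i| / radius k else 0).
(** 103 = 3 + 100: the sampled p-norm on the unit ball is at most 3, and the sampled risk of [xs] at
    most 100 rho, on the good event. *)
Definition variance_const := 103 * 3 `^ p.

Let rho2_gt0 k : 0 < rho * 2 ^+ k. Proof. by rewrite mulr_gt0 ?exprn_gt0. Qed.
Let radius_gt0 k : 0 < radius k. Proof. exact: powR_gt0. Qed.
Lemma radiusXp k : radius k `^ p = rho * 2 ^+ k.
Proof. by rewrite -powRrM mulVf ?gt_eqF// powRr1// ltW. Qed.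

Lemma loss_diff i s t c : `|F i s - beta i| <= c -> `|F i t - beta i| <= c ->
  `|loss i s - loss i t| <= p * `|s - t| * c `^ (p - 1).
Proof.
move=> sc tc; apply: (le_trans (powR_lipschitz p1 _ _ sc tc)); rewrite ?normr_ge0//.
rewrite ler_wpM2r ?powR_ge0//; apply: ler_wpM2l => //.
apply: le_trans (FL i s t); apply: (le_trans (ler_dist_dist _ _)).
by rewrite (_ : F i s - beta i - (F i t - beta i) = F i s - F i t)//; ring.
Qed.

Lemma F_le i s : `|F i s - beta i| <= `|s - dot (v i) xs| + `|noise i|.
Proof.
have -> : F i s - beta i = F i s - F i (dot (v i) xs) + noise i by rewrite /noise; ring.
by apply: (le_trans (ler_normD _ _)); rewrite lerD2r FL.
Qed.

Lemma scaled_loss_lip k i a b :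
  `|scaled_loss k i a - scaled_loss k i b| <= p * `|a - b| * (`|a| + `|b| + offset k i) `^ (p - 1).
Proof.
rewrite /scaled_loss /offset; case: ifP => ik; last first.
  by rewrite subrr normr0 !mulr_ge0 ?powR_ge0.
set yk := _ + _ / radius k; have r0 := radius_gt0 k.
have ykE : radius k * yk = `|dot (v i) xs| + `|noise i|.
  by rewrite /yk; field; rewrite gt_eqF.
have bnd s : `|s| <= `|a| + `|b| -> `|F i (radius k * s) - beta i| <= radius k * (`|a| + `|b| + yk).
  move=> sab; apply: (le_trans (F_le i _)); rewrite [leRHS]mulrDr ykE addrA lerD2r.
  apply: (le_trans (ler_normB _ _)); rewrite lerD2r normrM gtr0_norm//.
  by rewrite ler_pM2l.
have -> : (loss i (radius k * a) - loss i (dot (v i) xs)) / (rho * 2 ^+ k) -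
   (loss i (radius k * b) - loss i (dot (v i) xs)) / (rho * 2 ^+ k) =
   (loss i (radius k * a) - loss i (radius k * b)) / (rho * 2 ^+ k) by ring.
rewrite normrM [X in _ * X]ger0_norm ?invr_ge0 ?(ltW (rho2_gt0 k))// ler_pdivrMr ?rho2_gt0//.
have ba : `|a| <= `|a| + `|b| by rewrite lerDl.
have bb : `|b| <= `|a| + `|b| by rewrite lerDr.
apply: (le_trans (loss_diff (bnd a ba) (bnd b bb))).
have yk0 : 0 <= yk by apply: addr_ge0; rewrite divr_ge0// ltW.
have ab0 : 0 <= `|a| + `|b| + yk by rewrite addr_ge0// addr_ge0.
rewrite -mulrBr normrM gtr0_norm// powRM ?(ltW r0)//.
rewrite -radiusXp -(mulr_powRB1 (ltW r0) p_gt0).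
by rewrite le_eqVlt; apply/orP; left; apply/eqP; ring.
Qed.

Definition xscaled k : 'rV[R]_r := (radius k)^-1 *: xs.

Lemma norm_radV k (a : R) : (`|a| / radius k) `^ p = `|a| `^ p / (rho * 2 ^+ k).
Proof.
rewrite powRM ?invr_ge0 ?(ltW (radius_gt0 k))//; congr (_ * _).
by rewrite -radiusXp -powR_inv1 ?(ltW (radius_gt0 k))// -powRrM mulN1r powRN.
Qed.

Lemma pnormV k x : pnorm v om p ((radius k)^-1 *: x) = pnorm v om p x / (rho * 2 ^+ k).
Proof.
have := norm_radV k 1; rewrite normr1 powR1 !mul1r => e.
by rewrite pnormZ normrV ?unitfE ?gt_eqF// gtr0_norm// e mulrC.
Qed.

Let pnorm_ge0 x : 0 <= pnorm v om p x.
Proof. by apply: Ex_ge0 => i; rewrite mulr_ge0 ?powR_ge0. Qed.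

Let risk_ge0 x : 0 <= risk x.
Proof. by apply: Ex_ge0 => i; rewrite mulr_ge0 ?powR_ge0. Qed.

Lemma rho_le k : rho <= rho * 2 ^+ k.
Proof. by rewrite ler_pMr// exprn_ege1// ler1n. Qed.

Lemma xscaled_pnorm k : pnorm v om p (xscaled k) <= 1.
Proof.
rewrite pnormV ler_pdivrMr// mul1r; apply: le_trans (rho_le k).
by have := risk_ge0 xs; move: risk_rho; lra.
Qed.

Lemma scaled_loss0 k i : scaled_loss k i (dot (v i) (xscaled k)) = 0.
Proof.
rewrite /scaled_loss; case: ifP => // _.
by rewrite dotZr mulVKf ?gt_eqF// subrr mul0r.
Qed.

Lemma xscaled_le k i : `|dot (v i) xs| / radius k <= B.
Proof.
have := functional_le v1 i (ltW B0) (pnormB (xscaled_pnorm k)).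
by rewrite dotZr normrM normfV (gtr0_norm (radius_gt0 k)) mulrC.
Qed.

Lemma offset_bounds k i : 0 <= offset k i <= 3 * B / eps.
Proof.
have be : B <= B / eps by rewrite ler_pdivlMr// ler_piMr// ltW.
rewrite /offset; have := xscaled_le k i; case: ifP => ik h; apply/andP; split.
- by rewrite addr_ge0// divr_ge0// ltW.
- have : `|noise i| / radius k <= 2 * B / eps by rewrite ler_pdivrMr.
  by rewrite -!mulrA; lra.
- by rewrite addr0 divr_ge0// ltW.
- by rewrite addr0 -mulrA; have := divr_ge0 (ltW B0) (ltW eps0); lra.
Qed.

Lemma offset_le k i : offset k i `^ p <= 3 `^ p * (`|dot (v i) (xscaled k)| `^ p + loss i (dot (v i) xs) / rho).
Proof.
have r0 := radius_gt0 k; have ir0 : 0 <= (radius k)^-1 by rewrite invr_ge0 ltW.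
apply: (@le_trans _ _ ((`|dot (v i) (xscaled k)| + `|noise i| / radius k + 0) `^ p)).
  case/andP: (offset_bounds k i) => o0 _.
  apply: ge0_ler_powR; rewrite ?nnegrE//; first by rewrite addr0 addr_ge0 ?mulr_ge0.
  rewrite addr0  /offset dotZr normrM normfV (gtr0_norm (radius_gt0 k)) mulrC lerD2l.
  by case: ifP => // _; rewrite mulr_ge0.
apply: (le_trans (powR_add3_le _ _ _ _)); rewrite ?mulr_ge0//.
rewrite powR0 ?gt_eqF// addr0; apply: ler_wpM2l; first exact: powR_ge0.
rewrite lerD2l norm_radV -[`|noise i| `^ p]/(loss i (dot (v i) xs)).
apply: ler_wpM2l; first exact: powR_ge0.
by rewrite lef_pV2 ?posrE// rho_le.
Qed.

Lemma offset_mean k : Ex (fun i => om i * offset k i `^ p) <= variance_const.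
Proof.
apply: (@le_trans _ _ (Ex (fun i => 3 `^ p * (om i * `|dot (v i) (xscaled k)| `^ p + rho^-1 * (om i * loss i (dot (v i) xs)))))).
  apply: Ex_le => i; apply: (le_trans (ler_wpM2l (om0 i) (offset_le k i))).
  by rewrite le_eqVlt; apply/orP; left; apply/eqP; ring.
rewrite ExZ ExD ExZ -/(pnorm v om p (xscaled k)) -/(risk xs) /variance_const mulrC.
apply: ler_wpM2r; first exact: powR_ge0.
have : rho^-1 * risk xs <= 1.
  by rewrite mulrC ler_pdivrMr// mul1r; have := pnorm_ge0 xs; move: risk_rho; lra.
by have := xscaled_pnorm k; lra.
Qed.

(** The argument moves by at most eps |noise i|, so both residuals are at most 2 |noise i|, and
    [loss_diff] applies with this bound. *)
Lemma outlier_diff k i x : pnorm v om p ((radius k)^-1 *: x) <= 1 -> ~~ inlier k i ->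
  `|loss i (dot (v i) x) - loss i (dot (v i) xs)| <= p * 2 `^ p * eps * loss i (dot (v i) xs).
Proof.
rewrite -ltNge => nx out.
have r0 := radius_gt0 k.
have xB : `|dot (v i) x| <= B * radius k.
  have := functional_le v1 i (ltW B0) (pnormB nx).
  by rewrite dotZr normrM normfV (gtr0_norm (radius_gt0 k)) mulrC ler_pdivrMr.
have xsB : `|dot (v i) xs| <= B * radius k by rewrite -ler_pdivrMr//; exact: xscaled_le.
have d : `|dot (v i) x - dot (v i) xs| <= eps * `|noise i|.
  apply: (@le_trans _ _ (2 * B * radius k)); first by apply: (le_trans (ler_normB _ _)); lra.
  rewrite [eps * _]mulrC -ler_pdivrMr//.
  rewrite (_ : 2 * B * radius k / eps = cutoff * radius k) ?(ltW out)//.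
  by rewrite /cutoff; ring.
have z0 := normr_ge0 (noise i).
have ez : eps * `|noise i| <= `|noise i| by rewrite ler_piMl.
apply: (le_trans (loss_diff (c := 2 * `|noise i|) _ _)).
- by apply: (le_trans (F_le i _)); lra.
- by rewrite -/(noise i); lra.
rewrite powRM//.
have E : 2 `^ p = 2 * 2 `^ (p - 1) :> R by rewrite mulr_powRB1.
have Ez : loss i (dot (v i) xs) = `|noise i| * `|noise i| `^ (p - 1) by rewrite mulr_powRB1.
rewrite E Ez.
apply: (@le_trans _ _ (p * (eps * `|noise i|) * (2 `^ (p - 1) * `|noise i| `^ (p - 1)))).
  by rewrite ler_wpM2r ?mulr_ge0 ?powR_ge0// ler_wpM2l.
rewrite (_ : p * (2 * _) * eps * _ = 2 * (p * (eps * `|noise i|) * (2 `^ (p - 1) * `|noise i| `^ (p - 1)))); last by ring.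
rewrite ler_peMl ?ler1n// !mulr_ge0 ?powR_ge0// ltW//.
Qed.

Definition dev_event K2 (S : {ffun 'I_m -> I}) := exists (k : 'I_K2) x, pnorm v om p x <= 1 /\
  eps / 2 < `|\sum_j sweight om S j * scaled_loss k (S j) (dot (v (S j)) x)
              - Ex (fun i => om i * scaled_loss k i (dot (v i) x))|.

(** The comparison takes place at the least scale k with pnorm xh <= rho 2^k. Near-minimality bounds
    eps pnorm xh by 2 * 101 rho, so k < K2. Leastness gives rho 2^k <= rho + 2 pnorm xh, so the
    deviation at this scale is within what the regulariser pays. *)
Lemma approx_minimizer_risk (S : {ffun 'I_m -> I}) (K2 : nat) (xh : 'rV[R]_r) :
  ~ dev_event K2 S -> sample_risk S xs <= 100 * rho ->
  202 / eps <= 2 ^+ K2 / 2 -> (0 < K2)%N ->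
  sample_risk S xh + eps * pnorm v om p xh
    <= (1 + eps) * (sample_risk S xs + eps * pnorm v om p xs) ->
  risk xh <= risk xs + (103 + 101 * (p * 2 `^ p)) * (eps * rho).
Proof.
move=> ndev Srho K2E K20 xhmin.
have nxs : pnorm v om p xs <= rho by have := risk_ge0 xs; move: risk_rho; lra.
have rxs : risk xs <= rho by have := pnorm_ge0 xs; move: risk_rho; lra.
have nxs0 := pnorm_ge0 xs.
have nxh0 := pnorm_ge0 xh.
have sr0 x : 0 <= sample_risk S x.
  by apply: sumr_ge0 => j _; rewrite mulr_ge0 ?powR_ge0 ?divr_ge0.
set n := pnorm v om p xh in xhmin nxh0 *.
have Jxs : sample_risk S xs + eps * pnorm v om p xs <= 101 * rho.
  have : eps * pnorm v om p xs <= 1 * rho by apply: ler_pM => //; exact: ltW.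
  lra.
have Jxs0 : 0 <= sample_risk S xs + eps * pnorm v om p xs.
  by rewrite addr_ge0// mulr_ge0// ltW.
have nle : eps * n <= 202 * rho.
  have : (1 + eps) * (sample_risk S xs + eps * pnorm v om p xs) <= 2 * (101 * rho).
    by apply: ler_pM => //; have := ltW eps0; move: eps1; lra.
  by have := sr0 xh; move: xhmin; lra.
have ex : exists k, n <= rho * 2 ^+ k.
  exists K2.-1; rewrite -(@ler_pM2l _ eps)//; apply: (le_trans nle).
  move: K2E; rewrite -{1}(prednK K20) exprS ler_pdivrMr//.
  rewrite (_ : 2 * 2 ^+ K2.-1 / 2 * eps = 2 ^+ K2.-1 * eps); last by field.
  by move=> /(ler_wpM2r (ltW rho0)); rewrite (_ : eps * _ = 2 ^+ K2.-1 * eps * rho)//; ring.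
have K2n : n <= rho * 2 ^+ K2.-1.
  rewrite -(@ler_pM2l _ eps)//; apply: (le_trans nle).
  move: K2E; rewrite -{1}(prednK K20) exprS ler_pdivrMr//.
  rewrite (_ : 2 * 2 ^+ K2.-1 / 2 * eps = 2 ^+ K2.-1 * eps); last by field.
  by move=> /(ler_wpM2r (ltW rho0)); rewrite (_ : eps * _ = 2 ^+ K2.-1 * eps * rho)//; ring.
case: (ex_minnP ex) => k kn kmin.
have kK2 : (k < K2)%N by rewrite -(prednK K20) ltnS; exact: kmin.
have k2 : rho * 2 ^+ k <= rho + 2 * n.
  case: k kmin kn {kK2} => [|k'] kmin kn; first by rewrite expr0; lra.
  have : ~~ (n <= rho * 2 ^+ k') by apply/negP => /kmin; rewrite ltnn.
  by rewrite -ltNge exprS; lra.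
pose x := (radius k)^-1 *: xh.
have nx : pnorm v om p x <= 1 by rewrite pnormV ler_pdivrMr// mul1r.
have dev : `|\sum_j sweight om S j * scaled_loss k (S j) (dot (v (S j)) x)
              - Ex (fun i => om i * scaled_loss k i (dot (v i) x))| <= eps / 2.
  by rewrite leNgt; apply/negP => h; apply: ndev; exists (Ordinal kK2), x.
pose D i := loss i (dot (v i) xh) - loss i (dot (v i) xs).
have psiE i : (rho * 2 ^+ k) * scaled_loss k i (dot (v i) x) = if inlier k i then D i else 0.
  rewrite /scaled_loss; case: ifP => _; last by rewrite mulr0.
  by rewrite dotZr mulVKf ?gt_eqF// mulrC divfK ?gt_eqF.
have outE i : `|D i - (rho * 2 ^+ k) * scaled_loss k i (dot (v i) x)| <= p * 2 `^ p * eps * loss i (dot (v i) xs).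
  rewrite psiE; case: (boolP (inlier k i)) => ik.
    by rewrite subrr normr0 !mulr_ge0 ?powR_ge0// ltW.
  by rewrite subr0; apply: outlier_diff ik.
have c0 : 0 <= p * 2 `^ p * eps by rewrite !mulr_ge0 ?powR_ge0// ltW.
have hS : \sum_j sweight om S j * D (S j) <= sample_risk S xh - sample_risk S xs.
  by rewrite /sample_risk -sumrB; apply: ler_sum => j _; rewrite mulrBr.
have hR : risk xh - risk xs = Ex (fun i => om i * D i).
  rewrite /risk -[- Ex _]mulN1r -ExZ -ExD; apply: eq_Ex => i; rewrite /D; ring.
have e1 : Ex (fun i => om i * D i) <= rho * 2 ^+ k * Ex (fun i => om i * scaled_loss k i (dot (v i) x))
    + p * 2 `^ p * eps * risk xs.
  rewrite /risk -!ExZ -ExD; apply: Ex_le => i.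
  rewrite mulrCA [p * _ * _ * _]mulrCA -mulrDr ler_wpM2l//.
  by have := le_trans (ler_norm _) (outE i); lra.
have e2 : rho * 2 ^+ k * (\sum_j sweight om S j * scaled_loss k (S j) (dot (v (S j)) x))
   <= \sum_j sweight om S j * D (S j) + p * 2 `^ p * eps * sample_risk S xs.
  rewrite /sample_risk !mulr_sumr -big_split; apply: ler_sum => j _ /=.
  rewrite mulrCA [p * _ * _ * _]mulrCA -mulrDr; apply: ler_wpM2l; first by rewrite divr_ge0.
  by have := outE (S j); rewrite distrC => /(le_trans (ler_norm _)); lra.
have e3 : rho * 2 ^+ k * Ex (fun i => om i * scaled_loss k i (dot (v i) x)) <=
    rho * 2 ^+ k * (\sum_j sweight om S j * scaled_loss k (S j) (dot (v (S j)) x)) + rho * 2 ^+ k * (eps / 2).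
  rewrite -mulrDr; apply: ler_wpM2l; first exact: ltW.
  by move: dev; rewrite distrC => /(le_trans (ler_norm _)); lra.
have e4 : rho * 2 ^+ k * (eps / 2) <= (rho + 2 * n) * (eps / 2).
  by rewrite ler_wpM2r// divr_ge0// ltW.
have e5 : p * 2 `^ p * eps * risk xs <= p * 2 `^ p * eps * rho by rewrite ler_wpM2l.
have e6 : p * 2 `^ p * eps * sample_risk S xs <= p * 2 `^ p * eps * (100 * rho) by rewrite ler_wpM2l.
have e7 : eps * (sample_risk S xs + eps * pnorm v om p xs) <= eps * (101 * rho).
  by rewrite ler_wpM2l// ltW.
have e8 : eps * pnorm v om p xs <= eps * rho by rewrite ler_wpM2l// ltW.
have e9 : 0 <= eps * rho by rewrite mulr_ge0// ltW.
move: hS hR e1 e2 e3 e4 e5 e6 e7 e8 e9 xhmin; exact: excess_risk_arith.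
Qed.

Lemma sampled_regression (lam lam1 del : R) (K K2 : nat) :
  0 < del <= 1 -> 0 <= lam -> 0 <= lam1 ->
  tail_budget W CL m 1 2 CL 2 CL del <= lam1 ^+ 2 ->
  K%:R * lam1 + 1 * (2 * (CL / 2 ^+ K)) * (W + 3 `^ (2 + 1) * 2) < 1 / 8 ->
  32 * (W / m%:R) * CL <= 1 ->
  tail_budget W CL m p variance_const B p B del <= lam ^+ 2 ->
  tail_budget W CL m p variance_const (3 * B / eps) p B del <= lam ^+ 2 ->
  K%:R * lam + p * (2 * (B / 2 ^+ K)) * (W + 3 `^ (p + 1) * variance_const) < eps / 8 ->
  8 * increment_variance W m p variance_const (3 * B / eps) p B <= (eps / 2) ^+ 2 ->
  202 / eps <= 2 ^+ K2 / 2 -> (0 < K2)%N -> K2%:R * (K%:R * del) <= 1 / 3000 ->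
  9 / 10 <= Pr R (fun S : {ffun 'I_m -> I} => forall xh,
    sample_risk S xh + eps * pnorm v om p xh
      <= (1 + eps) * (sample_risk S xs + eps * pnorm v om p xs) ->
    risk xh <= risk xs + (103 + 101 * (p * 2 `^ p)) * (eps * rho)).
Proof.
move=> del01 lam0 lam10 tb1 K1 kCL tb2 tb3 KE vE K2E K20 K2del.
have del0 : 0 < del by case/andP: del01.
have S0 := card_ffun_gt0 m I0.
have C5 : 5 <= variance_const.
  have : 1 <= 3 `^ p :> R by apply: le_trans (le1r_powR _ p1); rewrite ?ler1n.
  move=> h; apply: (@le_trans _ _ (103 * 1)); first by rewrite mulr1 ler_nat.
  exact: ler_wpM2l.
pose LI (S : {ffun 'I_m -> I}) := lower_isometry v om S.
pose UN (S : {ffun 'I_m -> I}) := forall x, pnorm v om p x <= 1 -> psample v om p S x <= 3.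
pose EZ (S : {ffun 'I_m -> I}) := sample_risk S xs <= 100 * rho.
have PL := lower_isometry_whp I0 m0 om0 omW W0 CL1 v1 lewis del01 lam10 tb1 K1 kCL.
have K8 : K%:R * lam + p * (2 * (B / 2 ^+ K)) * (W + 3 `^ (p + 1) * variance_const) < 1 / 2.
  apply: (lt_le_trans KE); apply: ler_pM => //; first exact: ltW.
  by rewrite lef_pV2 ?posrE// ler_nat.
have PU := upper_norm_whp I0 m0 p1 om0 omW W0 CL1 v1 lewis B1 pnormB C5 del01 lam0 tb2 K8.
have PL' : Pr R (fun S : {ffun 'I_m -> I} => ~ (LI S \/ 2 <= p)) <= Pr R (fun S => ~ LI S).
  by apply: Pr_le => S nLI LS; apply: nLI; left.
have PZ : Pr R (fun S => ~ EZ S) <= 1 / 100.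
  apply: (@le_trans _ _ (Pr R (fun S : {ffun 'I_m -> I} => 100 * rho <= sample_risk S xs))).
    by apply: Pr_le => S /negP; rewrite -ltNge => /ltW.
  apply: (le_trans (Pr_markov _ _)); first by move=> S; apply: sumr_ge0 => j _; rewrite mulr_ge0 ?powR_ge0 ?divr_ge0.
    by rewrite mulr_gt0// ltr0n.
  have -> : Ex (fun S => sample_risk S xs) = risk xs.
    rewrite (Ex_sum_proj m (fun i => om i / m%:R * loss i (dot (v i) xs)) I0) -ExZ.
    by apply: eq_Ex => i; field; rewrite pnatr_eq0 -lt0n.
  rewrite ler_pdivrMr; last by rewrite mulr_gt0// ltr0n.
  rewrite (_ : 1 / 100 * (100 * rho) = rho); last by field.
  by apply: le_trans risk_rho; rewrite lerDl pnorm_ge0.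
pose good S := [/\ LI S, UN S & EZ S].
have Pgood : Pr R (fun S => ~ good S) <=
    Pr R (fun S => ~ LI S) + (Pr R (fun S => ~ UN S) + Pr R (fun S => ~ EZ S)).
  apply: le_trans (lerD (lexx _) (PrU _ _ _)); apply: le_trans (PrU _ _ _).
  apply: Pr_le => S nG; have [l|] := pselect (LI S); last by left.
  right; have [u|] := pselect (UN S); last by left.
  by right => z; apply: nG.
have e20 : 0 < eps / 2 by rewrite divr_gt0.
have BY : B <= 3 * B / eps.
  rewrite ler_pdivlMr//; have : B * eps <= B * 1 by rewrite ler_wpM2l// ltW.
  by move/le_trans; apply; rewrite mulr1 ler_peMl ?ler1n// ltW.
have C3 : 3 <= variance_const by apply: le_trans C5; rewrite ler_nat.
have goodP S : good S -> [/\ LI S \/ 2 <= p, UN S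
     & forall k : 'I_K2, \sum_j sweight om S j * offset k (S j) `^ p <= variance_const].
  move=> [l u z]; split=> // [|k]; first by left.
  apply: (@le_trans _ _ (\sum_j 3 `^ p * (sweight om S j * `|dot (v (S j)) (xscaled k)| `^ p
     + rho^-1 * (sweight om S j * loss (S j) (dot (v (S j)) xs))))).
    apply: ler_sum => j _; apply: (le_trans (ler_wpM2l _ (offset_le k (S j)))).
      by rewrite divr_ge0.
    by rewrite le_eqVlt; apply/orP; left; apply/eqP; ring.
  rewrite -mulr_sumr big_split/= -mulr_sumr -/(psample v om p S (xscaled k)) -/(sample_risk S xs).
  rewrite /variance_const mulrC; apply: ler_wpM2r; first exact: powR_ge0.
  have : rho^-1 * sample_risk S xs <= 100 by rewrite mulrC ler_pdivrMr.
  move=> sr; rewrite (_ : 103 = 3 + 100); last by rewrite -natrD.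
  exact: lerD (u _ (xscaled_pnorm k)) sr.
have KE' : K%:R * lam + p * (2 * (B / 2 ^+ K)) * (W + 3 `^ (p + 1) * variance_const) < eps / 2 / 4.
  by rewrite (_ : eps / 2 / 4 = eps / 8)//; field.
have PD := @uniform_deviation R I r v om W CL p B m I0 m0 p1 om0 omW W0 CL1 v1 lewis B1 pnormB
  'I_K2 (fun k => scaled_loss k) (fun k => offset k) (fun k => xscaled k) good p variance_const (3 * B / eps) lam del (eps / 2) K
  p_gt0 BY C3 del01 lam0 e20 (fun k => xscaled_pnorm k) (fun k => offset_bounds k) (fun k => offset_mean k)
  (fun k => scaled_loss_lip k) (fun k => scaled_loss0 k) goodP tb3 KE' vE.
rewrite card_ord in PD.
have bad : Pr R (fun S => dev_event K2 S \/ ~ EZ S) <= 1 / 10.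
  apply: (le_trans (PrU _ _ _)).
  have : K%:R * del <= K2%:R * (K%:R * del).
    by rewrite ler_peMl ?ler1n// mulr_ge0// ltW.
  rewrite -/(dev_event K2) in PD.
  move: PD PU PL PL' PZ Pgood K2del; exact: failure_probability_arith.
have := PrN R (fun S => dev_event K2 S \/ ~ EZ S) S0 => Pn.
apply: (@le_trans _ _ (Pr R (fun S : {ffun 'I_m -> I} => ~ (dev_event K2 S \/ ~ EZ S)))).
  rewrite Pn (_ : 9 / 10 = 1 - 1 / 10); last by field.
  by rewrite lerD2l lerN2.
apply: Pr_le => S /not_orP[nd /contrapT ez] xh.
exact: approx_minimizer_risk nd ez K2E K20.
Qed.

End SampledRegression.

(** * A Lewis-type position from near-maximal determinants *)

Section LewisWeights.
Variable R : realType.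

(** The two Schur complements of one bordered matrix have the same determinant. *)
Lemma det_rank1_update (r : nat) (x : 'rV[R]_r) :
  \det (1%:M + x^T *m x) = 1 + dot x x.
Proof.
have e1 : block_mx 1%:M (- x) x^T 1%:M = block_mx 1%:M 0 x^T 1%:M *m
    block_mx 1%:M (- x) 0 (1%:M + x^T *m x) :> 'M[R]_(1 + r).
  rewrite mulmx_block !mul1mx !mul0mx !mulmx1 ?mulmx0 !addr0 ?add0r.
  by rewrite mulmxN addrCA addNr addr0.
have e2 : block_mx 1%:M (- x) x^T 1%:M = block_mx (1%:M + x *m x^T) (- x) 0 1%:M *m
    block_mx 1%:M 0 x^T 1%:M :> 'M[R]_(1 + r).
  rewrite mulmx_block !mul1mx !mul0mx !mulmx1 ?mulmx0 !add0r ?addr0.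
  by rewrite mulNmx addrK.
have : \det (block_mx 1%:M (- x) x^T 1%:M : 'M[R]_(1 + r)) =
       \det (block_mx 1%:M (- x) x^T 1%:M : 'M[R]_(1 + r)) by [].
rewrite {1}e1 e2 !det_mulmx !det_ublock !det_lblock !det1 !mulr1 !mul1r => ->.
rewrite det_mx11 !mxE eqxx; congr (1 + _); apply: eq_bigr => i _.
by rewrite mxE.
Qed.

(** The crude Leibniz bound; it makes the supremum in [near_max_det] finite. *)
Lemma det_bound (r : nat) (M : 'M[R]_r) (c : R) : 0 <= c ->
  (forall i j, `|M i j| <= c) -> `|\det M| <= (r`!)%:R * c ^+ r.
Proof.
move=> c0 Mc; rewrite /determinant; apply: (le_trans (ler_norm_sum _ _ _)).
apply: (@le_trans _ _ (\sum_(s : 'S_r) c ^+ r)).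
  apply: ler_sum => s _; rewrite normrM normrX normrN1 expr1n mul1r normr_prod.
  apply: (@le_trans _ _ (\prod_(i < r) c)); last by rewrite prodr_const card_ord.
  by apply: ler_prod => i _; rewrite normr_ge0 Mc.
by rewrite sumr_const -[_ *+ #|_|]mulr_natl card_Sn.
Qed.

Definition rownorm (n r : nat) (U : 'M[R]_(n, r)) i : R := Num.sqrt (dot (row i U) (row i U)).

Lemma rownorm_ge0 (n r : nat) (U : 'M[R]_(n, r)) i : 0 <= rownorm U i.
Proof. exact: sqrtr_ge0. Qed.

Lemma rownorm2 (n r : nat) (U : 'M[R]_(n, r)) i : rownorm U i ^+ 2 = dot (row i U) (row i U).
Proof. by rewrite sqr_sqrtr// dot_ge0. Qed.

Lemma rownormZ (n r : nat) (U : 'M[R]_(n, r)) a i : rownorm (a *: U) i = `|a| * rownorm U i.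
Proof.
rewrite /rownorm [row i (a *: U)]linearZ/= dotZl dotZr mulrA -expr2 sqrtrM ?sqr_ge0//.
by rewrite sqrtr_sqr.
Qed.

Definition rowpower p (n r : nat) (U : 'M[R]_(n, r)) : R := \sum_i rownorm U i `^ p.

Lemma rowpower_ge0 p (n r : nat) (U : 'M[R]_(n, r)) : 0 <= rowpower p U.
Proof. by apply: sumr_ge0 => i _; exact: powR_ge0. Qed.

Lemma rowpowerZ p (n r : nat) (U : 'M[R]_(n, r)) a :
  rowpower p (a *: U) = `|a| `^ p * rowpower p U.
Proof.
rewrite /rowpower mulr_sumr; apply: eq_bigr => i _.
by rewrite rownormZ powRM ?rownorm_ge0.
Qed.

Lemma entry_le_rownorm (n r : nat) (U : 'M[R]_(n, r)) i j : `|U i j| <= rownorm U i.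
Proof.
rewrite -sqrtr_sqr ler_sqrt; last exact: dot_ge0.
rewrite /dot (bigD1 j)//= !mxE -expr2 lerDl.
by apply: sumr_ge0 => k _; rewrite -expr2 sqr_ge0.
Qed.

(** With the exponent raised to the integer P, the left side is convex in s and lies below its chord
    on [0, 1]. *)
Lemma powR_1p3s_le (p : R) (P : nat) (s : R) : 1 <= p -> p <= P%:R -> 0 <= s <= 1 ->
  (1 + 3 * s) `^ (p / 2) <= 1 + 4 ^+ P * s.
Proof.
move=> p1 pP /andP[s0 s1].
apply: (@le_trans _ _ ((1 + 3 * s) ^+ P)).
  rewrite -powR_mulrn; last by lra.
  by apply: ler_powR; lra.
have h4 k : 1 <= 4 ^+ k :> R by rewrite exprn_ege1// ler1n.
apply: (@le_trans _ _ (1 + (4 ^+ P - 1) * s)); last by lra.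
elim: P {p1 pP} => [|P IH]; first by rewrite !expr0; lra.
rewrite !exprS; apply: (@le_trans _ _ ((1 + 3 * s) * (1 + (4 ^+ P - 1) * s))).
  by rewrite ler_wpM2l//; lra.
have := h4 P; set q := 4 ^+ P => h41.
have : (q - 1) * (s * s) <= (q - 1) * s.
  by rewrite ler_wpM2l ?subr_ge0// ler_piMr.
lra.
Qed.

(** The matrix 1 + x^T x doubles the component along the unit vector x, so |u|^2 grows by 3 <u,
    x>^2. Then [powR_1p3s_le] applies with s = (<u, x> / |u|)^2. *)
Lemma rownorm_update (n r : nat) (U : 'M[R]_(n, r)) (x : 'rV[R]_r) i (p : R) (P : nat) :
  1 <= p -> p <= P%:R -> dot x x = 1 ->
  rownorm (U *m (1%:M + x^T *m x)) i `^ p <=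
    rownorm U i `^ p + 4 ^+ P * (rownorm U i `^ p * (dot (row i U) x / rownorm U i) ^+ 2).
Proof.
move=> p1 pP x1.
set u := row i U.
have rowE : row i (U *m (1%:M + x^T *m x)) = u + dot u x *: x.
  rewrite row_mul -/u mulmxDr mulmx1 mulmxA; congr (_ + _).
  rewrite [u *m x^T]mx11_scalar mul_scalar_mx; congr (_ *: _).
  by rewrite mxE; apply: eq_bigr => j _; rewrite [x^T _ _]mxE.
have sq : rownorm (U *m (1%:M + x^T *m x)) i ^+ 2 = rownorm U i ^+ 2 + 3 * dot u x ^+ 2.
  rewrite !rownorm2 rowE -/u dotDl !dotDr !dotZl !dotZr x1 [dot x u]dotC; ring.
have [z|nz] := eqVneq (rownorm U i) 0.
  have u0 : u = 0 by apply: dot_eq0; rewrite -rownorm2 z expr0n.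
  have : rownorm (U *m (1%:M + x^T *m x)) i = 0.
    apply/eqP; rewrite -sqrf_eq0 sq z u0 dotC dot0r; apply/eqP; ring.
  by move=> ->; rewrite z powR0 ?mul0r ?mulr0 ?addr0// gt_eqF//; lra.
have gz : 0 < rownorm U i by rewrite lt0r nz rownorm_ge0.
set s := (dot u x / rownorm U i) ^+ 2.
have s01 : 0 <= s <= 1.
  rewrite sqr_ge0 /s expr_div_n ler_pdivrMr ?exprn_gt0// mul1r rownorm2.
  by apply: (le_trans (dot_cs _ _)); rewrite x1 mulr1.
have sq2 : rownorm (U *m (1%:M + x^T *m x)) i = rownorm U i * (1 + 3 * s) `^ 2^-1.
  apply/eqP; rewrite -(eqrXn2 (n := 2))// ?rownorm_ge0 ?mulr_ge0 ?powR_ge0 ?rownorm_ge0//.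
  rewrite sq exprMn -[(_ `^ _) ^+ 2]powR_mulrn ?powR_ge0// -powRrM mulVf// powRr1; last first.
    by case/andP: s01 => *; lra.
  by apply/eqP; rewrite /s; field.
rewrite sq2 powRM ?powR_ge0 ?rownorm_ge0// -powRrM [2^-1 * p]mulrC.
have := powR_1p3s_le p1 pP s01 => /(ler_wpM2l (powR_ge0 (rownorm U i) p)) h.
apply: (le_trans h); lra.
Qed.

(* The bound [9 / 10] replaces exact maximality of [\det M], so that no compactness is needed. *)
Lemma near_max_det (p : R) (n r : nat) (A0 : 'M[R]_(n, r)) (L' : 'M[R]_(r, n)) :
  0 < p -> (0 < r)%N -> L' *m A0 = 1%:M ->
  exists M : 'M[R]_r, [/\ \det M != 0, rowpower p (A0 *m M) <= 1
    & forall N : 'M[R]_r, \det N != 0 -> 9 / 10 * `|\det N| <= rowpower p (A0 *m (M *m N)) `^ (r%:R / p)].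
Proof.
move=> p_gt0 r_gt0 L'E.
have rR : 0 < r%:R :> R by rewrite ltr0n.
pose K := [set z : R | exists M : 'M[R]_r, rowpower p (A0 *m M) <= 1 /\ z = `|\det M|]%classic.
have rownorm1 (U : 'M[R]_(n, r)) i : rowpower p U <= 1 -> rownorm U i <= 1.
  move=> U1; rewrite leNgt; apply/negP => gt1.
  have : 1 `^ p < rownorm U i `^ p by apply: gt0_ltr_powR; rewrite ?nnegrE ?rownorm_ge0.
  rewrite powR1 ltNge => /negP; apply; apply: le_trans U1.
  by rewrite /rowpower (bigD1 i)//= lerDl; apply: sumr_ge0 => j _; exact: powR_ge0.
pose c : R := \sum_i \sum_j `|L' i j|.
have c_ge0 : 0 <= c by apply: sumr_ge0 => i _; exact: sumr_ge0.
have ubK : ubound K ((r`!)%:R * c ^+ r).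
  move=> z [M [M1 ->]]; apply: det_bound => // i j.
  rewrite -[M]mul1mx -L'E -mulmxA mxE; apply: (le_trans (ler_norm_sum _ _ _)).
  apply: (@le_trans _ _ (\sum_k `|L' i k|)).
    apply: ler_sum => k _; rewrite normrM ler_piMr//.
    exact: le_trans (entry_le_rownorm _ _ _) (rownorm1 _ _ M1).
  rewrite /c [leRHS](bigD1 i)//= lerDl; apply: sumr_ge0 => k _; exact: sumr_ge0.
(* The determinant is homogeneous of degree r and [rowpower] of degree p; hence the exponent r /
   p. *)
have scaling (M : 'M[R]_r) : 0 < rowpower p (A0 *m M) ->
    K (`|\det M| / rowpower p (A0 *m M) `^ (r%:R / p)).
  move=> s0; set s := rowpower p _ in s0 *.
  exists (s `^ (- p^-1) *: M); split.
    rewrite -scalemxAr rowpowerZ ger0_norm ?powR_ge0// -powRrM mulNr mulVf ?gt_eqF//.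
    by rewrite powRN powRr1 ?(ltW s0)// mulVf// gt_eqF.
  rewrite detZ normrM normrX (ger0_norm (powR_ge0 _ _)) mulrC; congr (_ * _).
  rewrite -powR_mulrn ?powR_ge0// -powRrM mulNr powRN; congr (_ `^ _)^-1.
  by rewrite mulrC.
have posdef (M : 'M[R]_r) : \det M != 0 -> 0 < rowpower p (A0 *m M).
  move=> dM; rewrite lt0r rowpower_ge0 andbT; apply/negP => /eqP s0.
  have z : A0 *m M = 0.
    apply/matrixP => i j; rewrite [RHS]mxE; apply/eqP; rewrite -normr_eq0 eq_le normr_ge0 andbT.
    apply: le_trans (entry_le_rownorm _ _ _) _.
    have := rowpower_ge0 p (A0 *m M); rewrite /rowpower.
    have : rownorm (A0 *m M) i `^ p <= 0.
      rewrite -s0 /rowpower (bigD1 i)//= lerDl; apply: sumr_ge0 => k _; exact: powR_ge0.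
    move=> h _; have /eqP := le_anti (introT andP (conj h (powR_ge0 _ _))).
    by rewrite powR_eq0 => /andP[/eqP ->].
  have : M = 0 by rewrite -[M]mul1mx -L'E -mulmxA z mulmx0.
  by move=> M0; move/eqP: dM; apply; rewrite M0 -(scale0r 1%:M) detZ expr0n gtn_eqF// mul0r.
have s1 : 0 < rowpower p (A0 *m 1%:M) by apply: posdef; rewrite det1 oner_neq0.
have K1 := scaling 1%:M s1; rewrite det1 normr1 in K1.
have supK : has_sup K by split; [exists (1 / rowpower p (A0 *m 1%:M) `^ (r%:R / p))|exists ((r`!)%:R * c ^+ r)].
have sup0 : 0 < sup K.
  apply: lt_le_trans (ub_le_sup (proj2 supK) K1).
  by rewrite divr_gt0// powR_gt0.
have [|z [M [M1 zE]] zsup] := @sup_adherent R K (sup K / 10) _ supK; first by rewrite divr_gt0.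
have dM0 : 0 < `|\det M|.
  by rewrite -zE; apply: lt_trans zsup; rewrite subr_gt0 ltr_pdivrMr// ltr_pMr// ltr1n.
exists M; split=> //; first by rewrite -normr_gt0.
move=> N dN; have dMN : \det (M *m N) != 0 by rewrite det_mulmx mulf_neq0// -normr_gt0.
have sMN := posdef _ dMN; have KMN := scaling _ sMN.
have sr0 : 0 < rowpower p (A0 *m (M *m N)) `^ (r%:R / p) by exact: powR_gt0.
have := ub_le_sup (proj2 supK) KMN; rewrite det_mulmx normrM ler_pdivrMr// => hs.
rewrite -(ler_pM2l sup0); apply: le_trans hs; rewrite mulrA ler_wpM2r//.
by rewrite -zE; apply: ltW; rewrite (_ : sup K * (9 / 10) = sup K - sup K / 10)//; field.
Qed.

(** Near-maximality is tested against N = 1 + x^T x, of determinant 2, for unit x. The row power, at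
    most 1 before, must become at least (9/5)^(p/r) >= 1 + p ln (9/5) / r, while by [rownorm_update]
    it grows by at most 4^P times the quadratic form. This bounds the form below on the unit sphere,
    and scaling by r^(1/p) removes the factor 1/r. *)
Lemma lewis_position (p : R) : 1 <= p -> exists2 CL : R, 1 <= CL &
  forall (n d : nat) (A : 'M[R]_(n, d)), exists r : nat, exists U : 'M[R]_(n, r),
  exists D : 'M[R]_(d, r), exists E : 'M[R]_(r, d),
  [/\ (r <= d)%N, U = A *m D, A = U *m E, rowpower p U <= r%:R
    & forall x, dot x x <= CL * \sum_i rownorm U i `^ p * (dot (row i U) x / rownorm U i) ^+ 2].
Proof.
move=> p1; have p_gt0 : 0 < p by exact: lt_le_trans p1.
pose P := (Num.truncn p).+1.
have pP : p <= P%:R by apply: ltW; have /andP[] := truncn_itv (ltW p_gt0).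
pose L : R := ln (9 / 5).
have L0 : 0 < L by rewrite ln_gt0//; lra.
pose CL := Num.max 1 (4 ^+ P / (p * L)).
exists CL; first by rewrite le_max lexx.
move=> n d A.
pose r := \rank A.
pose A0 : 'M[R]_(n, r) := col_base A.
have AE : A = A0 *m row_base A by rewrite mulmx_base.
have [D0 D0E] : exists D0 : 'M[R]_(d, r), row_base A *m D0 = 1%:M.
  by apply/row_freeP; rewrite row_base_free.
have [L' L'E] : exists L' : 'M[R]_(r, n), L' *m A0 = 1%:M.
  by apply/row_fullP; rewrite col_base_full.
have A0E : A0 = A *m D0 by rewrite AE -mulmxA D0E mulmx1.
have [r0|r_gt0] := posnP r.
  exists r, A0, D0, (row_base A); split=> //.
  - by rewrite rank_leq_col.
  - rewrite /rowpower big1 ?ler0n// => i _.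
    rewrite (_ : rownorm A0 i = 0) ?powR0 ?gt_eqF//.
    by rewrite /rownorm /dot big1 ?sqrtr0// => -[j jr]; exfalso; rewrite r0 in jr.
  move=> x; rewrite (_ : dot x x = 0); last first.
    by rewrite /dot big1// => -[j jr]; exfalso; rewrite r0 in jr.
  rewrite mulr_ge0 ?le_max ?ler01//; apply: sumr_ge0 => i _.
  by rewrite mulr_ge0 ?powR_ge0 ?sqr_ge0.
have rR : 0 < r%:R :> R by rewrite ltr0n.
have [M [dM MU Mmax]] := near_max_det p_gt0 r_gt0 L'E.
pose U1 := A0 *m M.
have key x : dot x x = 1 -> p * L / r%:R <= 4 ^+ P * \sum_i rownorm U1 i `^ p * (dot (row i U1) x / rownorm U1 i) ^+ 2.
  move=> x1; pose N : 'M[R]_r := 1%:M + x^T *m x.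
  have dN : \det N = 2 by rewrite det_rank1_update x1; ring.
  have := Mmax N; rewrite dN pnatr_eq0 => /(_ isT); rewrite [`|2|]ger0_norm//.
  rewrite (_ : 9 / 10 * 2 = 9 / 5); last by field.
  have := rowpower_ge0 p (A0 *m (M *m N)).
  have su : rowpower p (A0 *m (M *m N)) <= rowpower p U1 +
      4 ^+ P * \sum_i rownorm U1 i `^ p * (dot (row i U1) x / rownorm U1 i) ^+ 2.
    rewrite mulmxA -/U1 /rowpower mulr_sumr -big_split; apply: ler_sum => i _.
    exact: rownorm_update.
  move: (rowpower p (A0 *m (M *m N))) su => s su s_ge0 hs2.
  have hs3 : 1 + p * L / r%:R <= s.
    have pr0 : 0 <= p / r%:R by rewrite divr_ge0 ?ler0n// ltW.
    apply: (le_trans (expR_ge1Dx _)).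
    have E : (s `^ (r%:R / p)) `^ (p / r%:R) = s.
      rewrite -powRrM (_ : r%:R / p * (p / r%:R) = 1) ?powRr1//.
      by field; rewrite !gt_eqF.
    rewrite -[leRHS]E (_ : p * L / r%:R = L * (p / r%:R)); last by ring.
    rewrite expRM /L lnK ?posrE ?divr_gt0//.
    have s2 := powR_ge0 s (r%:R / p).
    by apply: ge0_ler_powR => //; rewrite nnegrE divr_ge0.
  have := le_trans su (lerD MU (lexx _)); have := hs3; set q := 4 ^+ P * _.
  by move=> h1 /(le_trans h1); rewrite lerD2l.
pose a := r%:R `^ p^-1 : R.
have ap : a `^ p = r%:R by rewrite -powRrM mulVf ?gt_eqF// powRr1// ler0n.
have a0 : 0 < a by exact: powR_gt0.
have Mu : M \in unitmx by rewrite unitmxE unitfE.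
exists r, (a *: U1), (D0 *m (a *: M)), ((a^-1 *: invmx M) *m row_base A); split.
- by rewrite rank_leq_col.
- by rewrite mulmxA -A0E scalemxAr.
- rewrite mulmxA -scalemxAl -scalemxAr scalerA divff ?gt_eqF// scale1r /U1 mulmxK//.
- by rewrite rowpowerZ gtr0_norm// ap ler_piMr ?ler0n.
have E i x : rownorm (a *: U1) i `^ p * (dot (row i (a *: U1)) x / rownorm (a *: U1) i) ^+ 2 =
    r%:R * (rownorm U1 i `^ p * (dot (row i U1) x / rownorm U1 i) ^+ 2).
  rewrite rownormZ gtr0_norm// powRM ?(ltW a0) ?rownorm_ge0// ap -mulrA; congr (_ * (_ * _)).
  rewrite [row i (a *: U1)]linearZ/= dotZl invfM; congr (_ ^+ 2).
  by rewrite mulrACA divff ?gt_eqF// mul1r.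
move=> x; under eq_bigr do rewrite E.
rewrite -mulr_sumr.
have [->|xn0] := eqVneq x 0.
  rewrite dot0r mulr_ge0 ?le_max ?ler01// mulr_ge0 ?ler0n//; apply: sumr_ge0 => i _.
  by rewrite mulr_ge0 ?powR_ge0 ?sqr_ge0.
have xx0 : 0 < dot x x.
  by rewrite lt0r dot_ge0 andbT; apply: contra xn0 => /eqP /dot_eq0 ->.
pose b := (Num.sqrt (dot x x))^-1.
have b2 : b ^+ 2 = (dot x x)^-1 by rewrite exprVn sqr_sqrtr// ltW.
have := key (b *: x); rewrite dotZl dotZr mulrA -expr2 b2 mulVf ?gt_eqF// => /(_ erefl).
have -> : \sum_i rownorm U1 i `^ p * (dot (row i U1) (b *: x) / rownorm U1 i) ^+ 2 =
    (dot x x)^-1 * \sum_i rownorm U1 i `^ p * (dot (row i U1) x / rownorm U1 i) ^+ 2.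
  rewrite mulr_sumr; apply: eq_bigr => i _; rewrite dotZr -b2; ring.
set q := \sum_i _ => h.
have q0 : 0 <= q by apply: sumr_ge0 => i _; rewrite mulr_ge0 ?powR_ge0 ?sqr_ge0.
have h2 : dot x x <= 4 ^+ P / (p * L) * (r%:R * q).
  have pL : 0 < p * L by rewrite mulr_gt0.
  have := ler_wpM2r (ltW (mulr_gt0 xx0 (divr_gt0 rR pL))) h.
  rewrite (_ : p * L / r%:R * (dot x x * (r%:R / (p * L))) = dot x x); last by field; rewrite !gt_eqF.
  by rewrite (_ : 4 ^+ P * _ * _ = 4 ^+ P / (p * L) * (r%:R * q))//; field; rewrite !gt_eqF.
apply: (le_trans h2); apply: ler_wpM2r; first by rewrite mulr_ge0 ?ler0n.
by rewrite le_max lexx orbT.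
Qed.

End LewisWeights.

(** * Norm comparison, sampling by counting, and approximate minimisers *)

Section Discretization.
Variable R : realType.

(** For p <= 2 and s = |x| >= 1, each z = <v i, x> has z^2 <= s |z|^p, so s^2 <= CL s. For p > 2,
    values below th contribute at most W th^2, and the others satisfy z^2 <= th^(2-p) |z|^p; th =
    W^(-1/p) makes both terms W^(1-2/p). *)
Lemma pnorm_bound (I : finType) (r : nat) (v : I -> 'rV[R]_r) (om : I -> R) (W CL p : R) :
  (0 < #|I|)%N -> 1 <= p -> (forall i, 0 <= om i) -> (forall i, om i <= W) -> 1 <= W -> 1 <= CL ->
  (forall i, dot (v i) (v i) <= 1) -> (forall x, dot x x <= CL * qform v om x) ->
  forall x, pnorm v om p x <= 1 -> dot x x <= (3 * CL * W `^ Num.max 0 (1 / 2 - 1 / p)) ^+ 2.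
Proof.
move=> I0 p1 om0 omW W1 CL1 v1 lewis x nx.
have p0 : 0 < p by exact: lt_le_trans p1.
have W0 : 0 < W by exact: lt_le_trans W1.
have CL0 : 0 < CL by exact: lt_le_trans CL1.
have x0 := dot_ge0 x.
have CLsq : CL <= CL ^+ 2 by rewrite expr2 ler_peMr// ltW.
have [p2|] := boolP (p <= 2).
  have ip : 1 / 2 <= 1 / p by rewrite !mul1r lef_pV2 ?posrE.
  have -> : Num.max 0 (1 / 2 - 1 / p) = 0 by apply/max_idPl; lra.
  rewrite powRr0 mulr1; pose s := Num.sqrt (dot x x).
  have s2 : s ^+ 2 = dot x x by rewrite sqr_sqrtr.
  have s_ge0 : 0 <= s by exact: sqrtr_ge0.
  suff : s <= CL.
    move=> sC; rewrite -s2 lerXn2r ?nnegrE//; first by rewrite mulr_ge0 ?ler0n// ltW.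
    by apply: (le_trans sC); rewrite ler_peMl ?ler1n// ltW.
  have [s1|/ltW s1] := lerP s 1; first exact: le_trans CL1.
  have s_gt0 : 0 < s by exact: lt_le_trans s1.
  rewrite -(ler_pM2r s_gt0) -expr2 s2; apply: (le_trans (lewis x)).
  rewrite ler_wpM2l ?(ltW CL0)//.
  apply: (@le_trans _ _ (Ex (fun i => s * (om i * `|dot (v i) x| `^ p)))); last first.
    by rewrite ExZ -[leRHS]mulr1 ler_wpM2l.
  apply: Ex_le => i; rewrite [leRHS]mulrCA; apply: ler_wpM2l => //.
  have xs : `|dot (v i) x| <= s by apply: functional_le; rewrite ?s2.
  move: (dot (v i) x) xs => z zs; rewrite -real_normK ?num_real//.
  have [->|zn0] := eqVneq `|z| 0; first by rewrite powR0 ?gt_eqF// expr0n mulr0.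
  have z0 : 0 < `|z| by rewrite lt0r zn0 normr_ge0.
  rewrite -powR_mulrn// (_ : 2%:R = (2 - p) + p); last by ring.
  rewrite powRD ?(gt_eqF z0) ?implybT// ler_wpM2r ?powR_ge0//.
  apply: (@le_trans _ _ (s `^ (2 - p))); first by apply: ge0_ler_powR; rewrite ?nnegrE//; lra.
  by apply: ler1_powR => //; lra.
rewrite -ltNge => p2.
have ip : 1 / p <= 1 / 2 by rewrite !mul1r lef_pV2 ?posrE// ltW.
have -> : Num.max 0 (1 / 2 - 1 / p) = 1 / 2 - 1 / p by apply/max_idPr; lra.
pose th := W `^ (- p^-1).
have th0 : 0 < th by exact: powR_gt0.
have E1 : W * th ^+ 2 = W `^ (1 - 2 / p).
  rewrite -powR_mulrn ?(ltW th0)// -powRrM -{1}(powRr1 (ltW W0)) -powRD ?(gt_eqF W0) ?implybT//.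
  by congr (_ `^ _); ring.
have E2 : th `^ (2 - p) = W `^ (1 - 2 / p).
  by rewrite -powRrM; congr (_ `^ _); field; rewrite gt_eqF.
have h : qform v om x <= 2 * W `^ (1 - 2 / p).
  apply: (@le_trans _ _ (Ex (fun i => W * th ^+ 2 + th `^ (2 - p) * (om i * `|dot (v i) x| `^ p)))).
    apply: Ex_le => i.
    have : dot (v i) x ^+ 2 <= th ^+ 2 + th `^ (2 - p) * `|dot (v i) x| `^ p.
      move: (dot (v i) x) => z; rewrite -real_normK ?num_real//.
      have [zt|/ltW tz] := lerP `|z| th.
        apply: (@le_trans _ _ (th ^+ 2)); first by rewrite lerXn2r ?nnegrE// ltW.
        by rewrite lerDl mulr_ge0 ?powR_ge0.
      have z0 : 0 < `|z| by exact: lt_le_trans tz.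
      apply: (@le_trans _ _ (th `^ (2 - p) * `|z| `^ p)); last by rewrite lerDr sqr_ge0.
      have -> : `|z| ^+ 2 = `|z| `^ (2 - p) * `|z| `^ p.
        by rewrite -powRD ?(gt_eqF z0) ?implybT// subrK powR_mulrn.
      apply: ler_wpM2r; first exact: powR_ge0.
      rewrite -(opprB p 2).
      rewrite !powRN lef_pV2 ?posrE ?powR_gt0//.
      by apply: ge0_ler_powR; rewrite ?nnegrE ?(ltW th0)//; lra.
    move=> /(ler_wpM2l (om0 i)) /le_trans; apply.
    by rewrite mulrDr [om i * (th `^ _ * _)]mulrCA lerD2r ler_wpM2r ?sqr_ge0.
  rewrite ExD Ex_cst// ExZ E1 E2 -/(pnorm v om p x).
  have : W `^ (1 - 2 / p) * pnorm v om p x <= W `^ (1 - 2 / p) * 1 by rewrite ler_wpM2l ?powR_ge0.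
  by lra.
apply: (le_trans (lewis x)); apply: (@le_trans _ _ (CL * (2 * W `^ (1 - 2 / p)))).
  by rewrite ler_wpM2l// ltW.
rewrite exprMn -[(_ `^ _) ^+ 2]powR_mulrn ?powR_ge0// -powRrM.
rewrite (_ : (1 / 2 - 1 / p) * 2 = 1 - 2 / p); last by field; rewrite gt_eqF.
rewrite mulrA ler_wpM2r ?powR_ge0// exprMn; lra.
Qed.

(** Enumerates the disjoint union of blocks of sizes [c i]. *)
Lemma fiber_map (n N : nat) (c : 'I_n -> nat) : (\sum_i c i = N)%N ->
  exists g : 'I_N -> 'I_n, forall F : 'I_n -> R,
    \sum_k F (g k) = \sum_i (c i)%:R * F i.
Proof.
move=> cN; pose T := {i : 'I_n & 'I_(c i)}.
have cT : #|{: T}| = N.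
  by rewrite card_tagged -cN sumnE big_map big_enum; apply: eq_bigr => i _; rewrite card_ord.
exists (fun k => tag (enum_val (cast_ord (esym cT) k))) => F.
pose h (k : 'I_N) : T := enum_val (cast_ord (esym cT) k).
have bh : bijective h.
  exists (fun t => cast_ord cT (enum_rank t)) => k.
    by rewrite /h enum_valK cast_ordKV.
  by rewrite /h cast_ordK enum_rankK.
transitivity (\sum_(t : T) F (tag t)).
  by rewrite (reindex h) //; apply: onW_bij.
rewrite -(sig_big_dep xpredT (fun _ _ => true) (fun i (_ : 'I_(c i)) => F i)) /=.
by apply: eq_bigr => i _; rewrite sumr_const card_ord mulr_natl.
Qed.

(** Row i gets c i >= n w i / W of the 2n slots. Rounding up adds at most n slots in total, and what
    is left over goes to row [i0]. Dividing by the actual c i keeps the estimate exactly unbiased,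
    and rounding up bounds the weights by 2W. *)
Lemma sampling_map (n : nat) (w : 'I_n -> R) (W : R) : (0 < n)%N -> 0 < W ->
  (forall i, 0 <= w i) -> \sum_i w i <= W ->
  exists (g : 'I_(2 * n) -> 'I_n) (om : 'I_n -> R),
    (forall i, 0 <= om i <= 2 * W) /\
    forall F : 'I_n -> R, Ex (fun k => om (g k) * F (g k)) = \sum_i w i * F i.
Proof.
move=> n0 W0 w0 wW.
have nR : 0 < n%:R :> R by rewrite ltr0n.
pose i0 := Ordinal n0.
have a0 i : 0 <= n%:R * w i / W by rewrite divr_ge0 ?mulr_ge0 ?ler0n// ltW.
pose c0 i := (Num.truncn (n%:R * w i / W)).+1.
have c0sum : (\sum_i c0 i <= 2 * n)%N.
  rewrite -(ler_nat R) natr_sum.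
  apply: (@le_trans _ _ (\sum_i (n%:R * w i / W + 1))).
    apply: ler_sum => i _; rewrite -natr1 lerD2r.
    by have /andP[] := truncn_itv (a0 i).
  rewrite big_split/= sumr_const card_ord natrM -mulr_suml -mulr_sumr.
  have : n%:R * (\sum_i w i) / W <= n%:R by rewrite ler_pdivrMr// ler_wpM2l ?ler0n.
  by lra.
pose c i := (c0 i + (if i == i0 then 2 * n - \sum_i c0 i else 0))%N.
have csum : (\sum_i c i = 2 * n)%N.
  by rewrite /c big_split/= -big_mkcond big_pred1_eq subnKC.
have [g gE] := fiber_map csum.
have cgt i : 0 < (c i)%:R :> R by rewrite ltr0n.
exists g, (fun i => w i * (2 * n)%:R / (c i)%:R); split.
  move=> i; rewrite divr_ge0 ?mulr_ge0 ?ler0n//= ler_pdivrMr//.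
  have h1 : n%:R * w i / W <= (c i)%:R.
    apply: (@le_trans _ _ (c0 i)%:R); last by rewrite ler_nat leq_addr.
    by apply: ltW; have /andP[] := truncn_itv (a0 i).
  rewrite ler_pdivrMr// in h1; rewrite natrM; move: h1; set cc := (c i)%:R => h1; lra.
move=> F; rewrite /Ex (gE (fun i => w i * (2 * n)%:R / (c i)%:R * F i)) card_ord mulr_suml; apply: eq_bigr => i _.
by field; rewrite (gt_eqF nR) (gt_eqF (cgt i)).
Qed.

(** Unless J x0 = 0, when x0 is a minimiser, the comparison with J x0 makes the infimum positive, so
    that a relative error is attained. *)
Lemma near_minimizer (X : Type) (J : X -> R) (x0 : X) (C e : R) :
  (forall x, 0 <= J x) -> (forall x, J x0 <= C * J x) -> 0 < e ->
  exists x, forall z, J x <= (1 + e) * J z.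
Proof.
move=> J0 JC e0; have [z0|nz] := eqVneq (J x0) 0.
  by exists x0 => z; rewrite z0 mulr_ge0// addr_ge0// ltW.
have Jx0 : 0 < J x0 by rewrite lt0r nz J0.
have C0 : 0 < C.
  rewrite ltNge; apply/negP => C0; have := JC x0; rewrite leNgt => /negP; apply.
  by apply: le_lt_trans Jx0; rewrite mulr_le0_ge0.
pose K := range J.
have lb : lbound K (J x0 / C) by move=> _ [x _ <-]; rewrite ler_pdivrMr// mulrC.
have hK : has_inf K by split; [exists (J x0); exists x0|exists (J x0 / C)].
have inf0 : 0 < inf K.
  by apply: lt_le_trans (lb_le_inf (proj1 hK) lb); rewrite divr_gt0.
have [|_ [x _ <-] h] := @inf_adherent R K (e * inf K) _ hK; first by rewrite mulr_gt0.
exists x => z; apply: (le_trans (ltW h)).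
rewrite (_ : inf K + _ = (1 + e) * inf K); last by ring.
apply: ler_wpM2l; first by rewrite addr_ge0// ltW.
by apply: ge_inf; [case: hK|exists z].
Qed.

(** The estimator receives f but not L, so the regulariser needs a Lipschitz constant determined by
    f. *)
Lemma least_lipschitz (f : R -> R) (L : R) : 0 <= L -> Lip L f ->
  exists L0, [/\ 0 <= L0, Lip L0 f & forall L', 0 <= L' -> Lip L' f -> L0 <= L'].
Proof.
move=> L_ge0 fL; have [f0 _] := fL.
pose K := [set l : R | 0 <= l /\ Lip l f]%classic.
have hK : has_inf K by split; [exists L|exists 0 => l []].
exists (inf K); split.
- by apply: lb_le_inf; [exists L|move=> l []].
- split=> // x y; have [->|xy] := eqVneq x y; first by rewrite !subrr normr0 mulr0.
  have xy0 : 0 < `|x - y| by rewrite normr_gt0 subr_eq0.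
  rewrite -ler_pdivrMr//; apply: lb_le_inf; first by exists L.
  by move=> l [_ [_ fl]]; rewrite ler_pdivrMr.
- by move=> L' L'0 fL'; apply: ge_inf; [case: hK|].
Qed.

End Discretization.

Ltac nonneg := repeat first
  [ assumption | solve [apply: ltW; assumption] | exact: ler0n | exact: ler01 | exact: sqr_ge0 | exact: powR_ge0
  | apply: exprn_ge0 | rewrite invr_ge0 | apply: mulr_ge0 | apply: addr_ge0 ].

(** * Choice of the sample size and of the chaining parameters *)

Section SampleBudget.
Variable R : realType.

Definition query_rate (p : R) (d : nat) (eps : R) : R :=
  d%:R `^ Num.max 1 (p / 2) / eps `^ Num.max 2 p.

Lemma query_rate_ge1 p d eps : (0 < d)%N -> 0 < eps -> eps < 1 -> 1 <= query_rate p d eps.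
Proof.
move=> d0 e0 e1; have D1 : 1 <= d%:R :> R by rewrite ler1n.
have h1 : 1 <= d%:R `^ Num.max 1 (p / 2) :> R.
  by apply: le_trans (le1r_powR D1 _); rewrite ?le_max ?lexx.
rewrite /query_rate ler_pdivlMr ?powR_gt0// mul1r; apply: le_trans h1.
have e01 : 0 < eps <= 1 by rewrite e0 ltW.
apply: (@le_trans _ _ (eps `^ 0)); last by rewrite powRr0.
by apply: ger_powR => //; rewrite le_max ler0n.
Qed.

Lemma dim_div_query_rate p d eps : (0 < d)%N -> 0 < eps -> eps < 1 ->
  d%:R / query_rate p d eps <= eps ^+ 2.
Proof.
move=> d0 e0 e1; have D1 : 1 <= d%:R :> R by rewrite ler1n.
have D0 : 0 < d%:R :> R by rewrite ltr0n.
have e01 : 0 < eps <= 1 by rewrite e0 ltW.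
have -> : d%:R / query_rate p d eps = d%:R / d%:R `^ Num.max 1 (p / 2) * eps `^ Num.max 2 p.
  by rewrite /query_rate invfM invrK mulrA.
rewrite -[leRHS]mul1r; apply: ler_pM; rewrite ?divr_ge0 ?powR_ge0//.
  by rewrite ler_pdivrMr ?powR_gt0// mul1r le1r_powR// le_max lexx.
by rewrite -powR_mulrn ?(ltW e0)//; apply: ger_powR => //; rewrite le_max lexx.
Qed.

Lemma ln_query_rate p d eps : 1 <= p -> (0 < d)%N -> 0 < eps -> eps < 1 ->
  ln (query_rate p d eps) <= 3 * p * ln (d%:R / eps).
Proof.
move=> p1 d0 e0 e1; have D1 : 1 <= d%:R :> R by rewrite ler1n.
have D0 : 0 < d%:R :> R by rewrite ltr0n.
have Q1 := query_rate_ge1 p d0 e0 e1.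
have Xd : d%:R <= d%:R / eps by rewrite ler_pdivlMr// ler_piMr// ltW.
have Xe : eps^-1 <= d%:R / eps by rewrite ler_peMl// invr_ge0 ltW.
have X1 : 1 <= d%:R / eps by exact: le_trans Xd.
rewrite -ln_powR ler_ln ?posrE ?powR_gt0 ?divr_gt0 ?powR_gt0//.
have -> : 3 * p = p + 2 * p by ring.
rewrite powRD; last by rewrite (gt_eqF (lt_le_trans ltr01 X1)) implybT.
apply: ler_pM; rewrite ?invr_ge0 ?powR_ge0//.
  apply: (@le_trans _ _ ((d%:R / eps) `^ Num.max 1 (p / 2))).
    apply: ge0_ler_powR; rewrite ?nnegrE ?le_max ?ler01 ?ler0n//.
    by rewrite divr_ge0 ?ler0n// ltW.
  by apply: ler_powR => //; rewrite ge_max p1 /=; lra.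
have -> : (eps `^ Num.max 2 p)^-1 = eps^-1 `^ Num.max 2 p.
  by rewrite -[X in _ = X `^ _]powR_inv1 ?(ltW e0)// -powRrM mulN1r powRN.
apply: (@le_trans _ _ ((d%:R / eps) `^ Num.max 2 p)).
  apply: ge0_ler_powR; rewrite ?nnegrE ?le_max ?ler0n ?invr_ge0 ?(ltW e0)//.
  by rewrite divr_ge0 ?ler0n// ltW.
by apply: ler_powR => //; rewrite ge_max; apply/andP; split; lra.
Qed.

(** This is where the exponents of the query rate come from. For p > 2, B^p is of order d^(p/2-1),
    and (B/eps)^(p-2) B^2 d = B^p d eps^(2-p) is of order eps^2 times d^(p/2) / eps^p. For p <= 2, B
    is constant and d / query_rate is at most eps^2. *)
Lemma variance_rate (p CL C5 : R) : 1 <= p -> 1 <= CL -> 1 <= C5 ->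
  exists2 G : R, 0 < G & forall d eps, (0 < d)%N -> 0 < eps -> eps < 1 ->
  forall B, B = 3 * CL * (2 * d%:R) `^ Num.max 0 (1 / 2 - 1 / p) ->
  (3 * (3 * B / (eps / C5))) `^ xp p * (2 * B) `^ Num.min p 2
    * (2 * d%:R / query_rate p d eps) <= G * eps ^+ 2.
Proof.
move=> p1 CL1 C51; have p0 : 0 < p by exact: lt_le_trans p1.
have CL0 : 0 < CL by exact: lt_le_trans CL1.
have C50 : 0 < C5 by exact: lt_le_trans C51.
pose G1 : R := 2 * (6 * CL) `^ p.
pose G2 : R := 8 * (9 * C5) `^ (p - 2) * (3 * CL) `^ p * 2 `^ (p / 2 - 1).
have G10 : 0 < G1 by rewrite mulr_gt0 ?powR_gt0 ?mulr_gt0.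
have G20 : 0 < G2 by rewrite !mulr_gt0 ?powR_gt0 ?mulr_gt0.
exists (G1 + G2); first exact: addr_gt0.
move=> d eps d0 e0 e1 B defB.
have D0 : 0 < d%:R :> R by rewrite ltr0n.
have dq := dim_div_query_rate p d0 e0 e1.
have [p2|] := boolP (p <= 2).
  have ip : 1 / 2 <= 1 / p by rewrite !mul1r lef_pV2 ?posrE.
  rewrite /xp (_ : Num.max (p - 2) 0 = 0); last by apply/max_idPr; lra.
  rewrite (_ : Num.min p 2 = p); last by apply/min_idPl.
  rewrite powRr0 mul1r defB (_ : Num.max 0 (1 / 2 - 1 / p) = 0); last by apply/max_idPl; lra.
  rewrite powRr0 mulr1 (_ : 2 * (3 * CL) = 6 * CL); last by ring.
  apply: (@le_trans _ _ (G1 * eps ^+ 2)); last by rewrite ler_wpM2r ?sqr_ge0// lerDl ltW.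
  rewrite /G1 -!mulrA mulrCA; apply: ler_wpM2l => //.
  by apply: ler_wpM2l; rewrite ?powR_ge0.
rewrite -ltNge => p2.
have ip : 1 / p <= 1 / 2 by rewrite !mul1r lef_pV2 ?posrE// ltW.
apply: (@le_trans _ _ (G2 * eps ^+ 2)); last by rewrite ler_wpM2r ?sqr_ge0// lerDr ltW.
rewrite /xp (_ : Num.max (p - 2) 0 = p - 2); last by apply/max_idPl; lra.
rewrite (_ : Num.min p 2 = 2); last by apply/min_idPr; lra.
have BE : B = 3 * CL * (2 * d%:R) `^ (1 / 2 - 1 / p).
  by rewrite defB; congr (_ * _ `^ _); apply/max_idPr; lra.
have B0 : 0 < B by rewrite BE !mulr_gt0 ?powR_gt0 ?mulr_gt0.
have Bp : B `^ p = (3 * CL) `^ p * 2 `^ (p / 2 - 1) * d%:R `^ (p / 2 - 1).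
  rewrite BE powRM ?powR_ge0 ?mulr_ge0 ?(ltW CL0)// -powRrM -mulrA; congr (_ * _).
  rewrite (_ : (1 / 2 - 1 / p) * p = p / 2 - 1); last by field; rewrite !gt_eqF.
  by rewrite powRM// ltW.
have Q : query_rate p d eps = d%:R `^ (p / 2) / eps `^ p.
  rewrite /query_rate (_ : Num.max 1 (p / 2) = p / 2); last by apply/max_idPr; lra.
  by rewrite (_ : Num.max 2 p = p)//; apply/max_idPr; lra.
have E1 : (3 * (3 * B / (eps / C5))) `^ (p - 2) = (9 * C5) `^ (p - 2) * B `^ (p - 2) * eps `^ (2 - p).
  rewrite (_ : 3 * (3 * B / (eps / C5)) = 9 * C5 * B * eps^-1); last by field; rewrite !gt_eqF.
  rewrite powRM ?invr_ge0 ?mulr_ge0 ?(ltW C50) ?(ltW B0) ?(ltW e0)//.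
  rewrite powRM ?mulr_ge0 ?(ltW C50) ?(ltW B0)//; congr (_ * _).
  by rewrite -powR_inv1 ?(ltW e0)// -powRrM mulN1r opprB.
have E2 : (2 * B) `^ 2 = 4 * B `^ 2 by rewrite powRM ?(ltW B0)// powR_mulrn//; ring.
have E3 : B `^ (p - 2) * B `^ 2 = B `^ p by rewrite -powRD ?(gt_eqF B0) ?implybT// subrK.
have E4 : d%:R `^ (p / 2 - 1) * d%:R = d%:R `^ (p / 2) :> R.
  by rewrite -{2}[d%:R]powRr1 ?ler0n// -powRD ?(gt_eqF D0) ?implybT// subrK.
have E5 : eps `^ (2 - p) * eps `^ p = eps ^+ 2.
  by rewrite -powRD ?(gt_eqF e0) ?implybT// subrK powR_mulrn// ltW.
rewrite E1 E2 Q.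
have dp : d%:R `^ (p / 2) != 0 :> R by rewrite gt_eqF// powR_gt0.
rewrite (_ : _ * (2 * d%:R / _) = 8 * (9 * C5) `^ (p - 2) * (B `^ (p - 2) * B `^ 2) * (eps `^ (2 - p) * eps `^ p) * d%:R / d%:R `^ (p / 2)); last first.
  by field; rewrite dp gt_eqF// powR_gt0.
rewrite E3 E5 Bp.
rewrite (_ : 8 * (9 * C5) `^ (p - 2) * _ * eps ^+ 2 * d%:R / _ =
  G2 * eps ^+ 2 * (d%:R `^ (p / 2 - 1) * d%:R / d%:R `^ (p / 2))); last by rewrite /G2; ring.
by rewrite E4 divff// mulr1.
Qed.

(** As exp (1/2) <= 2, 2^K >= exp (K/2). *)
Lemma pow2_ge (K : nat) (Lam : R) : 8 * Lam <= K%:R -> expR Lam ^+ 4 <= 2 ^+ K.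
Proof.
move=> LK.
have e2 : expR (1 / 2) <= 2 :> R.
  have := @expR_ge1Dx R (- (1 / 2)); rewrite expRN => h.
  rewrite -[leLHS]invrK -[leRHS]invrK lef_pV2 ?posrE ?invr_gt0 ?expR_gt0//.
  by apply: le_trans h; lra.
apply: (@le_trans _ _ (expR (1 / 2) ^+ K)).
  by rewrite -!expRM_natl ler_expR; lra.
by rewrite lerXn2r ?nnegrE ?expR_ge0.
Qed.

Lemma absorb_constants (c Lam : R) : 0 <= c -> c <= Lam -> 1 <= Lam -> c <= Lam ^+ 2.
Proof. by move=> c0 cL L1; apply: (le_trans cL); rewrite expr2 ler_peMl// (le_trans _ L1). Qed.

(** The chain has K links, K of order Lam, each allowed lam of order eps / Lam, and the nets
    contribute one more Lam: this takes three of the five powers of Lam in m. The other two absorb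
    the constants through [absorb_constants]. K >= 8 Lam makes 2^K at least (d/eps)^4, which settles
    the remainder of the chain and also lets K serve as the number of scales. *)
Lemma budget_parameters (p CL C5 : R) : 1 <= p -> 1 <= CL -> 1 <= C5 ->
  exists2 T : R, 1 <= T & forall d (eps Lam : R), (0 < d)%N -> 0 < eps -> eps < 1 ->
  Lam = ln (d%:R / eps) -> T <= Lam ->
  forall (m : nat) (W B e C : R), m = (Num.truncn (query_rate p d eps * Lam ^+ 5)).+1 ->
  W = 2 * d%:R -> B = 3 * CL * W `^ Num.max 0 (1 / 2 - 1 / p) -> e = eps / C5 ->
  C = 103 * 3 `^ p ->
  m%:R <= 2 * query_rate p d eps * Lam ^+ 5 /\
  exists (lam lam1 del : R) (K : nat), [/\ 0 < del <= 1, 0 <= lam & 0 <= lam1] /\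
  [/\ tail_budget W CL m 1 2 CL 2 CL del <= lam1 ^+ 2,
      K%:R * lam1 + 1 * (2 * (CL / 2 ^+ K)) * (W + 3 `^ (2 + 1) * 2) < 1 / 8
    & 32 * (W / m%:R) * CL <= 1] /\
  [/\ tail_budget W CL m p C B p B del <= lam ^+ 2,
      tail_budget W CL m p C (3 * B / e) p B del <= lam ^+ 2,
      K%:R * lam + p * (2 * (B / 2 ^+ K)) * (W + 3 `^ (p + 1) * C) < e / 8
    & 8 * increment_variance W m p C (3 * B / e) p B <= (e / 2) ^+ 2] /\
  [/\ 202 / e <= 2 ^+ K / 2, (0 < K)%N & K%:R * (K%:R * del) <= 1 / 3000].
Proof.
move=> p1 CL1 C51; have p0 : 0 < p by exact: lt_le_trans p1.
have CL0 : 0 < CL by exact: lt_le_trans CL1.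
have C50 : 0 < C5 by exact: lt_le_trans C51.
(* The large numerals are made opaque: [//] and [lra] are slow on them. *)
have num_ge1 (k : nat) : (0 < k)%N -> exists n : R, 1 <= n /\ n = k%:R.
  by move=> k0; exists k%:R; rewrite ler1n.
have [n3000 [n3000_ge1 n3000E]] := num_ge1 3000%N isT.
have [n144 [n144_ge1 n144E]] := num_ge1 144%N isT.
have [n404 [n404_ge1 n404E]] := num_ge1 404%N isT.
clear num_ge1.
have n144_0 : 0 < n144 by exact: lt_le_trans n144_ge1.
have n3000_0 : 0 < n3000 by exact: lt_le_trans n3000_ge1.
have n404_0 : 0 < n404 by exact: lt_le_trans n404_ge1.
have [G3 G30 varP] := variance_rate p1 CL1 C51.
pose C : R := 103 * 3 `^ p.
have defC : C = 103 * 3 `^ p by [].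
have C1 : 2 <= C.
  have : 1 <= 3 `^ p :> R by apply: le_trans (le1r_powR _ p1); rewrite ?ler1n.
  by rewrite /C; clear; lra.
have C0 : 0 < C by exact: lt_le_trans C1.
clearbody C.
pose c3 : R := 3 `^ (p + 1) * C.
have defc3 : c3 = 3 `^ (p + 1) * C by [].
have c30 : 0 < c3 by rewrite mulr_gt0// powR_gt0.
clearbody c3.
pose G1 : R := 19 + 5 * (65 * CL * C) * (3 * p + 6).
have defG1 : G1 = 19 + 5 * (65 * CL * C) * (3 * p + 6) by [].
have G10 : 0 < G1 by rewrite addr_gt0// !mulr_gt0// addr_gt0// mulr_gt0.
clearbody G1.
pose G2 : R := p ^+ 2 * c3 * G3.
have defG2 : G2 = p ^+ 2 * c3 * G3 by [].
have G20 : 0 < G2 by rewrite !mulr_gt0// exprn_gt0.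
clearbody G2.
pose c2 : R := p * (2 * (6 * CL)) * (2 + c3).
have defc2 : c2 = p * (2 * (6 * CL)) * (2 + c3) by [].
have c20 : 0 < c2 by rewrite !mulr_gt0// addr_gt0.
clearbody c2.
pose l1 : R := ln (2 * n3000).
have defl1 : l1 = ln (2 * n3000) by [].
pose l2 : R := ln 6.
have defl2 : l2 = ln 6 by [].
have l10 : 0 <= l1 by rewrite ln_ge0//; move: n3000_ge1; clear; lra.
clearbody l1.
have l20 : 0 <= l2 by rewrite ln_ge0//; clear; lra.
clearbody l2.
(* Each [t] is a constant that one of the requirements below wants dominated by Lam or a power of
   it; the threshold T is 1 plus the sum of these and of [l1], [l2]. *)
pose t1 : R := 32 * G2 * G1 * (C5 ^+ 2 * n144 ^+ 2).
have deft1 : t1 = 32 * G2 * G1 * (C5 ^+ 2 * n144 ^+ 2) by [].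
pose t2 : R := 32 * (3 `^ (2 + 1) * 2 * 4 * CL ^+ 2 * 2) * G1 * n144 ^+ 2.
have deft2 : t2 = 32 * (3 `^ (2 + 1) * 2 * 4 * CL ^+ 2 * 2) * G1 * n144 ^+ 2 by [].
pose t3 : R := 32 * G2 * C5 ^+ 2.
have deft3 : t3 = 32 * G2 * C5 ^+ 2 by [].
pose t4 : R := 16 * C5 * c2.
have deft4 : t4 = 16 * C5 * c2 by [].
pose t5 : R := 64 * CL.
have deft5 : t5 = 64 * CL by [].
pose t6 : R := 64 * CL * (2 + 3 `^ (2 + 1) * 2).
have deft6 : t6 = 64 * CL * (2 + 3 `^ (2 + 1) * 2) by [].
pose t7 : R := n404 * C5.
have deft7 : t7 = n404 * C5 by [].
have t10 : 0 <= t1 by rewrite deft1 !mulr_ge0 ?exprn_ge0 ?(ltW G10) ?(ltW G20) ?(ltW C50) ?(ltW n144_0).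
clearbody t1.
have t20 : 0 <= t2 by rewrite deft2 !mulr_ge0 ?exprn_ge0 ?powR_ge0 ?(ltW G10) ?(ltW CL0) ?(ltW n144_0).
clearbody t2.
have t30 : 0 <= t3 by rewrite !mulr_ge0 ?exprn_ge0 ?(ltW G20) ?(ltW C50).
clearbody t3.
have t40 : 0 <= t4 by rewrite !mulr_ge0 ?(ltW c20) ?(ltW C50).
clearbody t4.
have t50 : 0 <= t5 by rewrite deft5; exact: mulr_ge0 (ler0n _ _) (ltW CL0).
clearbody t5.
have t60 : 0 <= t6 by rewrite !mulr_ge0 ?addr_ge0 ?mulr_ge0 ?powR_ge0 ?(ltW CL0).
clearbody t6.
have t70 : 0 <= t7 by rewrite deft7; exact: mulr_ge0 (ltW n404_0) (ltW C50).
clearbody t7.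
exists (1 + (l1 + l2 + t1 + t2 + t3 + t4 + t5 + t6 + t7)).
  by rewrite lerDl !addr_ge0.
move=> d eps Lam d0 e0 e1 defLam TL m W B e C' defm defW defB defe ->.
rewrite -defC {C'}.
have /and4P[L1 Ll1 Ll2 /and4P[Lt1 Lt2 Lt3 /and4P[Lt4 Lt5 Lt6 Lt7]]] :
  [&& 1 <= Lam, l1 <= Lam, l2 <= Lam & [&& t1 <= Lam, t2 <= Lam, t3 <= Lam &
    [&& t4 <= Lam, t5 <= Lam, t6 <= Lam & t7 <= Lam]]].
  clear -TL l10 l20 t10 t20 t30 t40 t50 t60 t70.
  move: l1 l2 t1 t2 t3 t4 t5 t6 t7 l10 l20 t10 t20 t30 t40 t50 t60 t70 TL => ? ? ? ? ? ? ? ? ? *.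
  by repeat (apply/andP; split); lra.
clear TL l10 l20.
have L0 : 0 < Lam by exact: lt_le_trans L1.
have D1 : 1 <= d%:R :> R by rewrite ler1n.
have D0 : 0 < d%:R :> R by rewrite ltr0n.
set Q := query_rate p d eps.
have Q1 : 1 <= Q by exact: query_rate_ge1.
have Q0 : 0 < Q by exact: lt_le_trans Q1.
have DQ : d%:R / Q <= eps ^+ 2 by exact: dim_div_query_rate.
pose X := d%:R / eps.
have X0 : 0 < X by rewrite divr_gt0.
have XE : expR Lam = X by rewrite defLam lnK ?posrE.
have DX : d%:R = X * eps by rewrite /X divfK// gt_eqF.
have LX : Lam < X by rewrite -XE; apply: lt_le_trans (expR_ge1Dx _); rewrite ltrDr.
have X1 : 1 <= X by exact: ltW (le_lt_trans L1 LX).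
have L51 : 1 <= Lam ^+ 5 by rewrite exprn_ege1.
have L50 : 0 < Lam ^+ 5 by exact: lt_le_trans L51.
have QL1 : 1 <= Q * Lam ^+ 5 by rewrite -[leLHS]mulr1 ler_pM.
have QL0 : 0 < Q * Lam ^+ 5 by exact: lt_le_trans QL1.
have mlt : Q * Lam ^+ 5 <= m%:R.
  by rewrite defm; apply: ltW; have /andP[] := truncn_itv (ltW QL0).
have mle : m%:R <= 2 * Q * Lam ^+ 5.
  rewrite defm -natr1; have /andP[h _] := truncn_itv (ltW QL0).
  by rewrite -mulrA; move: h QL1; clear; lra.
have m0 : 0 < m%:R :> R by exact: lt_le_trans mlt.
split=> //.
have kap_le : W / m%:R <= 2 * d%:R / Q / Lam ^+ 5.
  rewrite defW -[leRHS]mulrA -invfM; apply: ler_wpM2l; first by rewrite mulr_ge0 ?ler0n.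
  by rewrite lef_pV2 ?posrE.
have kap0 : 0 <= W / m%:R by rewrite defW divr_ge0 ?mulr_ge0 ?ler0n.
have eps2 : eps ^+ 2 <= 1 by rewrite expr_le1// ltW.
have kap2 : W / m%:R <= 2 / Lam ^+ 5.
  apply: (le_trans kap_le); apply: ler_wpM2r; first by rewrite invr_ge0 ltW.
  by move: DQ eps2; clear; lra.
have W1 : 1 <= W by rewrite defW; move: D1; clear; lra.
have B1 : 1 <= B.
  rewrite defB; have : 1 <= W `^ Num.max 0 (1 / 2 - 1 / p).
    by rewrite -{1}(powRr0 W); apply: ler_powR => //; rewrite le_max lexx.
  by move=> h; rewrite -[leLHS]mulr1; apply: ler_pM => //; move: CL1; clear; lra.
have B0 : 0 < B by exact: lt_le_trans B1.
have BD : B <= 6 * CL * d%:R.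
  rewrite defB (_ : 6 * CL * d%:R = 3 * CL * W); last by rewrite defW; ring.
  apply: ler_wpM2l; first by rewrite mulr_ge0// ltW.
  have ip : 0 <= 1 / p by rewrite divr_ge0// ltW.
  by apply: ler1_powR => //; rewrite ge_max; apply/andP; split; move: ip; clear; lra.
have e_gt0 : 0 < e by rewrite defe divr_gt0.
have e_le : e <= 1 by rewrite defe ler_pdivrMr// mul1r; exact: ltW (lt_le_trans e1 C51).
pose K := (Num.truncn (8 * Lam)).+1.
have L8 : 0 <= 8 * Lam by rewrite mulr_ge0// ltW.
have KL : K%:R <= 9 * Lam.
  by rewrite /K -natr1; have /andP[h _] := truncn_itv L8; move: h L1; clear; lra.
have LK : 8 * Lam <= K%:R by apply: ltW; have /andP[] := truncn_itv L8.
have K0 : 0 < K%:R :> R by rewrite ltr0n.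
have XK : X ^+ 4 <= 2 ^+ K by rewrite -XE; exact: pow2_ge.
have X40 : 0 < X ^+ 4 by rewrite exprn_gt0.
(* Chosen so that K (K del) is exactly 1/3000. *)
pose del : R := (n3000 * K%:R ^+ 2)^-1.
have K21 : 1 <= K%:R ^+ 2 :> R by rewrite exprn_ege1// ler1n.
have dd : 0 < n3000 * K%:R ^+ 2 :> R by rewrite mulr_gt0// exprn_gt0.
have del0 : 0 < del by rewrite invr_gt0.
have del1 : del <= 1 by rewrite invf_le1// -[leLHS]mulr1; apply: ler_pM.
have lndel : ln (2 / del) <= 19 * Lam.
  rewrite /del invrK mulrA lnM ?posrE ?exprn_gt0 ?mulr_gt0//.
  rewrite -defl1 lnXn//; have := ln_sublinear K0; rewrite -mulr_natl; move: Ll1 KL; clear; lra.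
have lndel0 : 0 <= ln (2 / del) by rewrite ln_ge0// ler_pdivlMr//; move: del1; clear; lra.
have lnm : ln (2 * m + 1)%:R <= (3 * p + 6) * Lam :> R.
  apply: (@le_trans _ _ (ln (6 * (Q * Lam ^+ 5)))).
    rewrite natrD natrM; have a0 : 0 < 2 * m%:R + 1 :> R by move: m0; clear; lra.
    have b0 : 0 < 6 * (Q * Lam ^+ 5) by rewrite mulr_gt0.
    have m1 : 1 <= m%:R :> R by rewrite defm ler1n.
    rewrite ler_ln ?posrE//.
    by move: mle m1; clear; lra.
  rewrite lnM ?posrE ?exprn_gt0// lnM ?posrE ?exprn_gt0// lnXn// -defl2.
  have := ln_query_rate p1 d0 e0 e1; rewrite -defLam -/Q; have := ln_sublinear L0.
  by rewrite -mulr_natl; move: Ll2; clear; lra.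
have lnm0 : 0 <= ln (2 * m + 1)%:R :> R by rewrite ln_ge0// ler1n addn1.
have logs Cx : 0 <= Cx -> Cx <= C ->
    0 <= ln (2 / del) + 5 * (65 * CL * Cx) * ln (2 * m + 1)%:R <= G1 * Lam.
  move=> Cx0 CxC.
  have q0 : 0 <= 5 * (65 * CL * Cx).
    by apply: mulr_ge0 => //; apply: mulr_ge0 => //; apply: mulr_ge0 => //; exact: ltW.
  apply/andP; split; first by apply: addr_ge0 => //; exact: mulr_ge0.
  have -> : G1 * Lam = 19 * Lam + 5 * (65 * CL * C) * ((3 * p + 6) * Lam) by rewrite defG1; ring.
  apply: lerD => //; apply: ler_pM => //.
  by apply: ler_wpM2l => //; apply: ler_wpM2l => //; apply: mulr_ge0 => //; exact: ltW.
have V : increment_variance W m p C (3 * B / e) p B <= G2 * eps ^+ 2 / Lam ^+ 5.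
  rewrite /increment_variance -defc3 defe.
  have := varP d eps d0 e0 e1 B; rewrite -defW => /(_ defB).
  move: (powR_ge0 (3 * (3 * B / (eps / C5))) (xp p)) (powR_ge0 (2 * B) (Num.min p 2)).
  move: (_ `^ xp p) (_ `^ Num.min p 2) => Yx Bx Yx0 Bx0 h.
  have nn : 0 <= p ^+ 2 * c3 * Yx * Bx.
    by apply: mulr_ge0 => //; apply: mulr_ge0 => //; apply: mulr_ge0; [exact: sqr_ge0|exact: ltW].
  rewrite (_ : _ * _ * _ * _ * Bx = W / m%:R * (p ^+ 2 * c3 * Yx * Bx)); last by clear; ring.
  apply: (le_trans (ler_wpM2r nn kap_le)).
  rewrite (_ : _ * (_ * Bx) = p ^+ 2 * c3 / Lam ^+ 5 * (Yx * Bx * (W / Q))); last first.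
    by rewrite defW; clear; ring.
  rewrite (_ : G2 * eps ^+ 2 / Lam ^+ 5 = p ^+ 2 * c3 / Lam ^+ 5 * (G3 * eps ^+ 2)); last by rewrite defG2; clear; ring.
  apply: ler_wpM2l => //; apply: mulr_ge0; last by rewrite invr_ge0 ltW.
  by apply: mulr_ge0; [exact: sqr_ge0|exact: ltW].
have V' : increment_variance W m p C B p B <= G2 * eps ^+ 2 / Lam ^+ 5.
  apply: le_trans V; rewrite /increment_variance.
  apply: ler_wpM2r; first exact: powR_ge0.
  apply: ler_wpM2l.
    apply: mulr_ge0; last by apply: mulr_ge0; [exact: powR_ge0|exact: ltW].
    by apply: mulr_ge0 => //; exact: sqr_ge0.
  have y1 : 0 <= 3 * B by rewrite mulr_ge0 ?(ltW B0).
  have y2 : 3 * B <= 3 * (3 * B / e).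
    apply: ler_wpM2l => //; rewrite ler_pdivlMr//.
    have : B * e <= B * 1 by rewrite ler_wpM2l// ltW.
    by move: (ltW B0); clear; lra.
  apply: ge0_ler_powR => //; first by rewrite le_max lexx orbT.
  by rewrite nnegrE (le_trans y1 y2).
(* As K <= 9 Lam, K lam <= e / 16 and K lam1 <= 1 / 16, half of what is allowed; the remainders of
   the chains take the other half. *)
pose lam := e / (n144 * Lam); pose lam1 : R := (n144 * Lam)^-1.
have L144 : 0 < n144 * Lam by rewrite mulr_gt0.
have tb Vx : Vx <= G2 * eps ^+ 2 / Lam ^+ 5 -> 32 * Vx * (ln (2 / del) + 5 * (65 * CL * C) * ln (2 * m + 1)%:R) <= lam ^+ 2.
  move=> Vle; have /andP[lg0 lg] := logs C (ltW C0) (lexx _).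
  apply: (@le_trans _ _ (32 * (G2 * eps ^+ 2 / Lam ^+ 5) * (G1 * Lam))).
    apply: (@le_trans _ _ (32 * (G2 * eps ^+ 2 / Lam ^+ 5) * (ln (2 / del) + 5 * (65 * CL * C) * ln (2 * m + 1)%:R))).
      by apply: ler_wpM2r => //; apply: ler_wpM2l.
    apply: ler_wpM2l => //.
    by nonneg.
  have := absorb_constants t10 Lt1 L1; rewrite deft1 => h.
  rewrite /lam defe (_ : (eps / C5 / (n144 * Lam)) ^+ 2 = eps ^+ 2 / (C5 ^+ 2 * n144 ^+ 2 * Lam ^+ 4) * Lam ^+ 2); last first.
    by field; rewrite !gt_eqF.
  rewrite (_ : 32 * _ * _ = eps ^+ 2 / (C5 ^+ 2 * n144 ^+ 2 * Lam ^+ 4) * (32 * G2 * G1 * (C5 ^+ 2 * n144 ^+ 2))); last first.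
    by field; rewrite !gt_eqF.
  apply: ler_wpM2l => //; nonneg.
exists lam, lam1, del, K; split; [|split; [|split]].
- by split; [rewrite del0 del1|rewrite /lam; nonneg|rewrite /lam1; nonneg].
- split.
  + rewrite /tail_budget /increment_variance expr1n mulr1.
    have /andP[lg0 lg] := logs 2 (ler0n _ _) C1.
    have -> : xp 2 = 0 :> R by rewrite /xp subrr; apply/max_idPl.
    have -> : Num.min 2 2 = 2 :> R by apply/min_idPl.
    rewrite powRr0 mulr1 (powRM _ (ler0n _ 2) (ltW CL0)) !powR_mulrn ?(ltW CL0)//.
    apply: (@le_trans _ _ (32 * (2 / Lam ^+ 5 * (3 `^ (2 + 1) * 2) * (2 ^+ 2 * CL ^+ 2)) * (G1 * Lam))).
      apply: ler_pM => //.
        by nonneg.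
      apply: ler_wpM2l => //; apply: ler_wpM2r; first by nonneg.
      by apply: ler_wpM2r => //; nonneg.
    have := absorb_constants t20 Lt2 L1; rewrite deft2 => h.
    rewrite /lam1 (_ : ((n144 * Lam)^-1) ^+ 2 = (n144 ^+ 2 * Lam ^+ 4)^-1 * Lam ^+ 2); last first.
      by field; rewrite !gt_eqF.
    rewrite (_ : 32 * _ * _ = (n144 ^+ 2 * Lam ^+ 4)^-1 * (32 * (3 `^ (2 + 1) * 2 * 4 * CL ^+ 2 * 2) * G1 * n144 ^+ 2)); last first.
      by field; rewrite !gt_eqF.
    by apply: ler_wpM2l => //; nonneg.
  + have h1 : K%:R * lam1 <= 1 / 16.
      rewrite /lam1 ler_pdivrMr// n144E; move: KL; clear; lra.
    have h2 : 1 * (2 * (CL / 2 ^+ K)) * (W + 3 `^ (2 + 1) * 2) <= t6 / 32 / X.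
      have K2 : (2 ^+ K)^-1 <= (X ^+ 4)^-1 :> R by rewrite lef_pV2 ?posrE ?exprn_gt0.
      have w3 : W + 3 `^ (2 + 1) * 2 <= (2 + 3 `^ (2 + 1) * 2) * X.
        have : 3 `^ (2 + 1) * 2 * 1 <= 3 `^ (2 + 1) * 2 * X by rewrite ler_wpM2l// mulr_ge0 ?powR_ge0.
        have : d%:R <= X * 1 by rewrite DX ler_wpM2l// ltW.
        by rewrite defW; clear; move: (3 `^ (2 + 1) * 2) => z; lra.
      apply: (@le_trans _ _ (1 * (2 * (CL / X ^+ 4)) * ((2 + 3 `^ (2 + 1) * 2) * X))).
        have W0 := le_trans ler01 W1; apply: ler_pM => //; [by nonneg|by nonneg|].
        by rewrite !mul1r ler_wpM2l// ler_wpM2l// ltW.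
      rewrite (_ : _ * (_ * X) = t6 / 32 / X * (X ^+ 2)^-1); last by rewrite deft6; field; rewrite !gt_eqF.
      apply: ler_piMr; first by nonneg.
      by rewrite invf_le1 ?exprn_gt0//; exact: exprn_ege1.
    have h3 : t6 / 32 / X < 1 / 16.
      rewrite ltr_pdivrMr//; have h : t6 < X by exact: le_lt_trans LX.
      by move: h X0; clear; move: X t6 => x t; lra.
    move: h1 h2 h3; clear; lra.
  + apply: (@le_trans _ _ (32 * (2 / Lam ^+ 5) * CL)).
      by apply: ler_wpM2r; [exact: ltW|apply: ler_wpM2l].
    rewrite (_ : 32 * _ * CL = t5 / Lam ^+ 5); last by rewrite deft5; field; rewrite !gt_eqF.
    rewrite ler_pdivrMr// mul1r; apply: (le_trans Lt5).
    by rewrite -[leLHS]expr1 ler_weXn2l.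
- split.
  + exact: tb.
  + exact: tb.
  + have h1 : K%:R * lam <= e / 16.
      rewrite /lam mulrA ler_pdivrMr// (_ : e / 16 * (n144 * Lam) = e * (9 * Lam)); last by rewrite n144E; clear; field.
      by rewrite mulrC ler_wpM2l// ltW.
    have h2 : p * (2 * (B / 2 ^+ K)) * (W + c3) <= c2 * eps ^+ 2 / X.
      have K2 : (2 ^+ K)^-1 <= (X ^+ 4)^-1 :> R by rewrite lef_pV2 ?posrE ?exprn_gt0.
      have w3 : W + c3 <= (2 + c3) * d%:R.
        have : c3 * 1 <= c3 * d%:R by rewrite ler_wpM2l// ltW.
        by rewrite defW; move: D1; clear; lra.
      apply: (@le_trans _ _ (p * (2 * (6 * CL * d%:R / X ^+ 4)) * ((2 + c3) * d%:R))).
        apply: ler_pM => //.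
        - by nonneg.
        - by apply: addr_ge0; [exact: le_trans ler01 W1|exact: ltW].
        apply: ler_wpM2l; first exact: ltW.
        by apply: ler_wpM2l => //; apply: ler_pM => //; nonneg.
      rewrite DX (_ : _ * (_ * (X * eps)) = c2 * eps ^+ 2 / X * X^-1); last by rewrite defc2; field; rewrite !gt_eqF.
      by apply: ler_piMr; [nonneg|rewrite invf_le1].
    have h3 : c2 * eps ^+ 2 / X < e / 16.
      rewrite ltr_pdivrMr// defe.
      have : eps * (t4 * eps) < eps * (X * 1).
        rewrite ltr_pM2l//; apply: (@le_lt_trans _ _ (t4 * 1)).
          by apply: ler_wpM2l => //; exact: ltW.
        by rewrite !mulr1; exact: le_lt_trans Lt4 LX.
      have -> : eps * (t4 * eps) = c2 * eps ^+ 2 * (16 * C5) by rewrite deft4; ring.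
      have -> : eps / C5 / 16 * X = eps * (X * 1) / (16 * C5) by field; rewrite !gt_eqF.
      by rewrite ltr_pdivlMr// mulr_gt0.
    rewrite -defc3; move: h1 h2 h3 e_gt0; clear; lra.
  + apply: (@le_trans _ _ (8 * (G2 * eps ^+ 2 / Lam ^+ 5))); first by apply: ler_wpM2l.
    rewrite defe (_ : (eps / C5 / 2) ^+ 2 = eps ^+ 2 / (4 * C5 ^+ 2)); last by field; rewrite !gt_eqF.
    rewrite (_ : 8 * _ = eps ^+ 2 / (4 * C5 ^+ 2) * (t3 / Lam ^+ 5)); last by rewrite deft3; field; rewrite !gt_eqF.
    rewrite ler_piMr//; first by nonneg.
    rewrite ler_pdivrMr// mul1r.
    by apply: (le_trans Lt3); rewrite -[leLHS]expr1 ler_weXn2l.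
- split=> //.
  + rewrite ler_pdivlMr//; apply: le_trans XK.
    rewrite defe (_ : 202 / (eps / C5) * 2 = t7 / eps); last by rewrite deft7 n404E; move: (gt_eqF C50) (gt_eqF e0); clear => c5 ce; field; rewrite c5 ce.
    rewrite (_ : X ^+ 4 = X ^+ 2 * (X * X)); last by ring.
    rewrite -[leLHS]mul1r; apply: ler_pM; rewrite ?divr_ge0 ?(ltW e0)//; first exact: exprn_ege1.
    apply: ler_pM; rewrite ?invr_ge0 ?(ltW e0)//; first exact: ltW (le_lt_trans Lt7 LX).
    by rewrite /X ler_peMl// invr_ge0 ltW.
  + rewrite /del -n3000E (_ : K%:R * (K%:R * _) = 1 / n3000)//; field.
    by rewrite !gt_eqF.
Qed.

End SampleBudget.

(** Realised on [nat], all of whose subsets are measurable, by normalising a sum of Dirac masses at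
    the ranks of the elements. *)
Lemma uniform_probability_space (R : realType) (T : finType) : (0 < #|T|)%N ->
  exists (dsp : measure_display) (Omega : measurableType dsp) (P : probability Omega R) (dec : Omega -> T),
  forall Q : T -> Prop, measurable [set w | Q (dec w)]%classic /\
    P [set w | Q (dec w)]%classic = (Pr R Q)%:E.
Proof.
move=> T0; have t0 : T := enum_val (Ordinal T0).
pose mu : {measure set nat -> \bar R} := msum (fun k : nat => \d_k) #|T|.
exists _, nat, (mnormalize mu \d_0%N), (fun k => nth t0 (enum T) k) => Q.
split=> //.
have muE A : mu A = (\sum_(k < #|T|) (`[< A k >])%:R)%:E.
  rewrite /mu /msum/= -sumEFin; apply: eq_bigr => k _.
  by rewrite /= /dirac indicE; congr (_%:R%:E); apply/idP/asboolP; rewrite in_setE.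
have muT : mu [set: nat]%classic = #|T|%:R%:E.
  rewrite muE; congr (_%:E).
  rewrite (eq_bigr (fun _ => 1)) ?sumr_const ?card_ord// => k _.
  by rewrite asboolT.
have nE U : mnormalize mu \d_0%N U = (mu U * (fine (mu [set: nat]%classic))^-1%:E)%E.
  rewrite /mnormalize ifF// muT orbF.
  by apply/eqP => -[] /eqP; rewrite pnatr_eq0 gtn_eqF.
transitivity (mu [set w | Q (nth t0 (enum T) w)]%classic * (fine (mu [set: nat]%classic))^-1%:E)%E.
  exact: nE.
rewrite muT muE -EFinM; congr (_%:E).
rewrite /Pr /Ex; congr (_ / _).
rewrite -[RHS]big_enum (big_nth t0) big_mkord -cardE.
by apply: eq_bigr.
Qed.

Lemma Pr_eq1 (R : realType) (T : finType) (P : T -> Prop) :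
  (0 < #|T|)%N -> (forall t, P t) -> Pr R P = 1.
Proof.
move=> T0 PT; rewrite -[RHS](Ex_cst 1 T0).
by apply: eq_Ex => t; rewrite asboolT.
Qed.

(** * The objective that the algorithm minimises, and its queries *)

Section Sketch.
Variables (R : realType) (n d m : nat) (p : R).
Hypothesis p1 : 1 <= p.

Definition sketch_objective (f : R -> R) (A : 'M[R]_(n, d)) (c : 'I_n -> R) (e : R)
    (ix : 'I_m -> 'I_n) (s : 'I_m -> R) (x : 'cV[R]_d) : R :=
  \sum_j c (ix j) / m%:R * `|f ((A *m x) (ix j) 0) - s j| `^ p + e * lpp p (A *m x).

Lemma lpp_ge0 k (u : 'cV[R]_k) : 0 <= lpp p u.
Proof. by apply: sumr_ge0 => i _; exact: powR_ge0. Qed.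

Lemma lpp_eq0 k (u : 'cV[R]_k) : lpp p u <= 0 -> u = 0.
Proof.
move=> u0; have /eqP : lpp p u = 0 by apply/le_anti; rewrite u0 lpp_ge0.
rewrite psumr_eq0 => [/allP h|i _]; last exact: powR_ge0.
apply/colP => i; rewrite mxE.
by have := h i (mem_index_enum _); rewrite /= powR_eq0 normr_eq0 => /andP[/eqP].
Qed.

Lemma sketch_objective_ge0 f A c e ix s x : (forall i, 0 <= c i) -> 0 <= e ->
  0 <= sketch_objective f A c e ix s x.
Proof.
move=> c0 e0; apply: addr_ge0; last by apply: mulr_ge0 => //; exact: lpp_ge0.
by apply: sumr_ge0 => j _; rewrite mulr_ge0 ?powR_ge0// divr_ge0.
Qed.

(** Supplies the comparison that [near_minimizer] asks for, at x = 0: |s j| <= |f t - s j| + L |t|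
    at the sampled row value t, and the regulariser controls |t|^p. *)
Lemma sketch_near_minimizer (f : R -> R) (L : R) A c e ix s a : 0 <= L -> Lip L f ->
  (forall i, 0 <= c i) -> 0 < e -> 0 < a ->
  exists x, forall z, sketch_objective f A c e ix s x <= (1 + a) * sketch_objective f A c e ix s z.
Proof.
move=> L0 [f0 fL] c0 e0 a0; have p_ge0 : 0 <= p by exact: le_trans p1.
apply: (@near_minimizer _ _ _ 0 (3 `^ p * (1 + \sum_j c (ix j) / m%:R * L `^ p / e))) => //.
  by move=> x; apply: sketch_objective_ge0 => //; exact: ltW.
move=> x; rewrite /sketch_objective mulmx0.
have -> : lpp p (0 : 'cV[R]_n) = 0.
  by apply: big1 => i _; rewrite mxE normr0 powR0// gt_eqF// (lt_le_trans ltr01).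
rewrite mulr0 addr0 -mulrA.
set N := lpp p (A *m x); have N0 : 0 <= N by exact: lpp_ge0.
apply: (@le_trans _ _ (3 `^ p * (\sum_j c (ix j) / m%:R * `|f ((A *m x) (ix j) 0) - s j| `^ p
    + (\sum_j c (ix j) / m%:R * L `^ p / e) * (e * N)))).
  rewrite mulr_suml -big_split/= mulr_sumr; apply: ler_sum => j _.
  set w := c (ix j) / m%:R; have w0 : 0 <= w by rewrite divr_ge0.
  have Nj : `|(A *m x) (ix j) 0| `^ p <= N.
    by rewrite /N /lpp (bigD1 (ix j))//= lerDl; apply: sumr_ge0 => i _; exact: powR_ge0.
  set t := (A *m x) (ix j) 0 in Nj *.
  rewrite (_ : w * L `^ p / e * (e * N) = w * (L `^ p * N)); last by field; rewrite gt_eqF.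
  rewrite -mulrDr mulrCA; apply: ler_wpM2l => //; rewrite mxE f0.
  have h : `|0 - s j| <= `|f t - s j| + L * `|t|.
    have := fL 0 t; rewrite f0 !sub0r !normrN => h0.
    have := ler_normB (f t) (f t - s j); rewrite opprB addrCA subrr addr0.
    by move: h0; lra.
  apply: (@le_trans _ _ ((`|f t - s j| + L * `|t|) `^ p)).
    by apply: ge0_ler_powR; rewrite ?nnegrE ?addr_ge0 ?mulr_ge0.
  have := @powR_add3_le R p `|f t - s j| (L * `|t|) 0 p_ge0.
  rewrite addr0 powR0 ?gt_eqF ?(lt_le_trans ltr01)// addr0 => /(_ _ _ _)/le_trans; apply => //.
    by rewrite mulr_ge0.
  apply: ler_wpM2l; first exact: powR_ge0.
  by rewrite lerD2l powRM// ler_wpM2l ?powR_ge0.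
apply: ler_wpM2l; first exact: powR_ge0.
set X := \sum_j _ * _; set Y := \sum_j _ / e.
have X0 : 0 <= X by apply: sumr_ge0 => j _; rewrite mulr_ge0 ?powR_ge0// divr_ge0.
have Y0 : 0 <= Y.
  by apply: sumr_ge0 => j _; rewrite divr_ge0 ?(ltW e0)// mulr_ge0 ?powR_ge0// divr_ge0.
have : 0 <= Y * X by exact: mulr_ge0.
have : 0 <= e * N by rewrite mulr_ge0// ltW.
move: (e * N) => M M0 YX; rewrite mulrDr mulrDl; lra.
Qed.

(** The strategy is non-adaptive: the number of answers so far determines the next index, and
    [insub] succeeds as long as it is below m. *)
Lemma transcriptE (b : 'cV[R]_n) (ix : 'I_m -> 'I_n) (j : 'I_m) :
  nth 0 (transcript b (fun s => omap ix (insub (size s))) m) j = b (ix j) 0.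
Proof.
set q := fun s => _.
have sz k : size (transcript b q k) = k by elim: k => //= k IH; rewrite size_rcons IH.
suff H k : (j < k)%N -> (k <= m)%N -> nth 0 (transcript b q k) j = b (ix j) 0 by apply: H.
elim: k => // k IH; rewrite ltnS => jk km /=; rewrite nth_rcons sz.
have [jlt|] := ltnP j k; first by apply: IH => //; exact: ltnW.
move=> kj; have ejk : j = k :> nat by apply/eqP; rewrite eqn_leq jk kj.
by rewrite ejk eqxx /q sz -ejk valK.
Qed.

End Sketch.

(** * From the regression problem to the normalised model *)

Section Reduction.
Variables (R : realType) (n d r m : nat) (p L : R) (A : 'M[R]_(n, d)) (U : 'M[R]_(n, r)) (E : 'M[R]_(r, d)).
Variables (g : 'I_(2 * n) -> 'I_n) (om : 'I_n -> R) (f : R -> R) (b : 'cV[R]_n).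
Hypotheses (p1 : 1 <= p) (L0 : 0 < L) (fL : Lip L f) (AE : A = U *m E)
  (gE : forall F : 'I_n -> R, Ex (fun k => om (g k) * F (g k)) = \sum_i rownorm U i `^ p * F i).

Let p0 : p != 0. Proof. by rewrite gt_eqF// (lt_le_trans ltr01). Qed.
Let Lp0 : 0 < L `^ p. Proof. exact: powR_gt0. Qed.

(* A zero row of [U] yields the zero vector, as [0^-1 = 0]. *)
Definition unit_row i : 'rV[R]_r := (rownorm U i)^-1 *: row i U.
(** Division by L |u_i| makes the link 1-Lipschitz in the coordinate along the unit row; the weight
    |u_i|^p and a global L^p restore the loss. *)
Definition scaled_link i (s : R) : R := f (rownorm U i * s) / (L * rownorm U i).
Definition scaled_target i : R := b i 0 / (L * rownorm U i).
Definition coords (x : 'cV[R]_d) : 'rV[R]_r := (E *m x)^T.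

Let v k := unit_row (g k).
Let F k := scaled_link (g k).
Let beta k := scaled_target (g k).
Let w k := om (g k).

Lemma rownorm_eq0 i : rownorm U i = 0 -> row i U = 0.
Proof.
by move=> h; have := rownorm2 U i; rewrite h expr0n => /esym/dot_eq0.
Qed.

Lemma dot_unit_row i : dot (unit_row i) (unit_row i) <= 1.
Proof.
rewrite dotZl dotZr -rownorm2; have [->|h] := eqVneq (rownorm U i) 0.
  by rewrite expr0n/= !mulr0.
by rewrite (_ : _ * _ = 1)//; field.
Qed.

Lemma rownorm_dot i x : rownorm U i * dot (unit_row i) (coords x) = (A *m x) i 0.
Proof.
have -> : (A *m x) i 0 = dot (row i U) (coords x).
  by rewrite AE -mulmxA mxE; apply: eq_bigr => j _; rewrite !mxE.
rewrite dotZl; have [h|h] := eqVneq (rownorm U i) 0; last by rewrite mulVKf.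
by rewrite (rownorm_eq0 h) /dot big1 ?mulr0// => j _; rewrite mxE mul0r.
Qed.

Lemma scaled_link_lipschitz i s t : `|scaled_link i s - scaled_link i t| <= `|s - t|.
Proof.
rewrite /scaled_link -mulrBl; set y := rownorm U i; have y0 : 0 <= y by exact: rownorm_ge0.
have [->|h] := eqVneq y 0; first by rewrite mulr0 invr0 mulr0 normr0.
have Ly : 0 < L * y by rewrite mulr_gt0// lt0r h.
rewrite normrM normfV [`|L * y|]gtr0_norm// ler_pdivrMr//.
by have := fL.2 (y * s) (y * t); rewrite -mulrBr normrM (ger0_norm y0); lra.
Qed.

Lemma scaled_lossE i x : rownorm U i != 0 ->
  L `^ p * (rownorm U i `^ p * `|scaled_link i (dot (unit_row i) (coords x)) - scaled_target i| `^ p)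
    = `|f ((A *m x) i 0) - b i 0| `^ p.
Proof.
move=> h; have y0 : 0 <= rownorm U i by exact: rownorm_ge0.
rewrite /scaled_link rownorm_dot -mulrBl -!powRM ?normr_ge0 ?mulr_ge0// ?(ltW L0)//.
congr (_ `^ _); have Ly : 0 < L * rownorm U i by rewrite mulr_gt0// lt0r h.
rewrite normrM normfV [`|L * _|]gtr0_norm//; field.
by rewrite h gt_eqF.
Qed.

Lemma pnorm_coords x : pnorm v w p (coords x) = lpp p (A *m x).
Proof.
rewrite /pnorm /v /w (gE (fun i => `|dot (unit_row i) (coords x)| `^ p)).
apply: eq_bigr => i _; rewrite -rownorm_dot normrM powRM// ger0_norm//.
exact: rownorm_ge0.
Qed.

(** Only differences match: a zero row of U contributes the constant |b i|^p to the residual and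
    nothing to the risk. *)
Lemma resid_risk x y : resid p f A b x - resid p f A b y
  = L `^ p * (risk v w p F beta (coords x) - risk v w p F beta (coords y)).
Proof.
have riskE z : risk v w p F beta (coords z) = \sum_i rownorm U i `^ p *
    `|scaled_link i (dot (unit_row i) (coords z)) - scaled_target i| `^ p by exact: gE.
rewrite !riskE /resid /lpp -!sumrB mulr_sumr; apply: eq_bigr => i _.
have rE z : (map_mx f (A *m z) - b) i 0 = f ((A *m z) i 0) - b i 0 by rewrite !mxE.
rewrite !rE; have [h|h] := eqVneq (rownorm U i) 0; last by rewrite mulrBr !scaled_lossE.
have Az (z : 'cV[R]_d) : (A *m z) i 0 = 0 by rewrite -rownorm_dot h mul0r.
by rewrite !Az h powR0// !mul0r subrr subrr mulr0.
Qed.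

Lemma risk_le_resid x : L `^ p * risk v w p F beta (coords x) <= resid p f A b x.
Proof.
have -> : risk v w p F beta (coords x) = \sum_i rownorm U i `^ p *
    `|scaled_link i (dot (unit_row i) (coords x)) - scaled_target i| `^ p by exact: gE.
rewrite mulr_sumr; apply: ler_sum => i _.
have [h|h] := eqVneq (rownorm U i) 0; last by rewrite scaled_lossE// !mxE.
by rewrite h powR0// mul0r mulr0 powR_ge0.
Qed.

Lemma sketch_objective_risk (S : {ffun 'I_m -> 'I_(2 * n)}) e x :
  sketch_objective p f A (fun i => om i / rownorm U i `^ p) (e * L `^ p) (fun j => g (S j)) (fun j => b (g (S j)) 0) x
  = L `^ p * (sample_risk v w p F beta S (coords x) + e * pnorm v w p (coords x)).
Proof.
rewrite /sketch_objective pnorm_coords mulrDr; congr (_ + _); last by ring.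
rewrite mulr_sumr; apply: eq_bigr => j _; rewrite /sweight /w /loss /F /v /beta; set i := g (S j).
have [h|h] := eqVneq (rownorm U i) 0.
  rewrite h powR0// invr0 !(mulr0, mul0r)/= /scaled_link /scaled_target h mulr0 invr0 !mulr0 subrr normr0.
  by rewrite powR0// !mulr0.
rewrite -scaled_lossE//; have y0 : 0 < rownorm U i by rewrite lt0r h rownorm_ge0.
by move: (m%:R^-1) => m'; field; rewrite gt_eqF ?powR_gt0.
Qed.

End Reduction.

Lemma sketched_regression (R : realType) (p : R) : 1 <= p ->
  exists C T : R, [/\ 1 <= C, 1 <= T & forall (n d : nat) (eps Lam : R), (0 < n)%N -> (0 < d)%N ->
  0 < eps -> eps < 1 -> Lam = ln (d%:R / eps) -> T <= Lam ->
  exists2 m : nat, m%:R <= 2 * query_rate p d eps * Lam ^+ 5 &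
  forall A : 'M[R]_(n, d), exists (g : 'I_(2 * n) -> 'I_n) (c : 'I_n -> R), (forall i, 0 <= c i) /\
  forall (f : R -> R) (L : R) (b : 'cV[R]_n), 0 < L -> Lip L f -> forall xs : 'cV[R]_d,
  9 / 10 <= Pr R (fun S : {ffun 'I_m -> 'I_(2 * n)} => forall xh,
    let J := sketch_objective p f A c (eps / C * L `^ p) (fun j => g (S j)) (fun j => b (g (S j)) 0) in
    J xh <= (1 + eps / C) * J xs ->
    resid p f A b xh <= resid p f A b xs + eps * (resid p f A b xs + L `^ p * lpp p (A *m xs)))].
Proof.
move=> p1; have p0 : 0 < p by exact: lt_le_trans p1.
have [CL CL1 lewisP] := lewis_position p1.
(* The factor lost in [sampled_regression]; the model is run with accuracy eps / C. *)
pose C := 103 + 101 * (p * 2 `^ p).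
have defC : C = 103 + 101 * (p * 2 `^ p) by [].
have C1 : 1 <= C.
  have : 0 <= p * 2 `^ p by rewrite mulr_ge0 ?powR_ge0// ltW.
  by rewrite defC; move: (p * 2 `^ p) => z; lra.
clearbody C.
have [T T1 budget] := budget_parameters p1 CL1 C1.
exists C, T; split=> // n d eps Lam n0 d0 e0 e1 defLam TL.
have C0 : 0 < C by exact: lt_le_trans C1.
pose m := (Num.truncn (query_rate p d eps * Lam ^+ 5)).+1.
pose B := 3 * CL * (2 * d%:R) `^ Num.max 0 (1 / 2 - 1 / p).
pose e := eps / C.
have [mle [lam [lam1 [del [K [[h1 h2 h3] [[h4 h5 h6] [[h7 h8 h9 h10] [h11 h12 h13]]]]]]]]] :=
  budget d eps Lam d0 e0 e1 defLam TL m (2 * d%:R) B e (103 * 3 `^ p) erefl erefl erefl erefl erefl.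
have m_gt0 : (0 < m)%N by [].
have e_gt0 : 0 < e by rewrite divr_gt0.
have e_le1 : e <= 1 by rewrite ler_pdivrMr// mul1r (le_trans (ltW e1)).
clearbody m; exists m => // A.
have [r [U [_ [E [rd _ AE Upow lewis]]]]] := lewisP n d A.
have D1 : 1 <= d%:R :> R by rewrite ler1n.
have D0 : 0 < d%:R :> R by rewrite ltr0n.
have Ud : \sum_i rownorm U i `^ p <= d%:R by rewrite (le_trans Upow)// ler_nat.
have [g [om [omP gE]]] := sampling_map n0 D0 (fun i => powR_ge0 (rownorm U i) p) Ud.
exists g, (fun i => om i / rownorm U i `^ p); split.
  by move=> i; case/andP: (omP i) => o0 _; exact: divr_ge0 (powR_ge0 _ _).
move=> f L b L0 fL xs; have Lp0 : 0 < L `^ p by exact: powR_gt0.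
pose v k := unit_row U (g k); pose F k := scaled_link L U f (g k).
pose beta k := scaled_target L U b (g k); pose w k := om (g k).
have w0 k : 0 <= w k by have /andP[] := omP (g k).
have wW k : w k <= 2 * d%:R by have /andP[] := omP (g k).
have W1 : 1 <= 2 * d%:R :> R by move: D1; clear; lra.
have W0 : 0 < 2 * d%:R :> R by exact: lt_le_trans W1.
have v1 k : dot (v k) (v k) <= 1 by exact: dot_unit_row.
have I0 : (0 < #|'I_(2 * n)|)%N by rewrite card_ord muln_gt0.
have lewisv x : dot x x <= CL * qform v w x.
  apply: (le_trans (lewis x)); rewrite /qform (gE (fun i => dot (unit_row U i) x ^+ 2)).
  apply: ler_wpM2l; first exact: le_trans CL1.
  by apply: ler_sum => i _; rewrite dotZl [_^-1 * _]mulrC.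
have B1 : 1 <= B.
  have : 1 <= (2 * d%:R) `^ Num.max 0 (1 / 2 - 1 / p) :> R.
    by rewrite -{1}(powRr0 (2 * d%:R)); apply: ler_powR => //; rewrite le_max lexx.
  by move=> h; rewrite -[leLHS]mulr1; apply: ler_pM => //; move: CL1; clear; lra.
have pB := pnorm_bound I0 p1 w0 wW W1 CL1 v1 lewisv.
have FL k s t : `|F k s - F k t| <= `|s - t| by exact: scaled_link_lipschitz.
pose x0 := coords E xs.
pose rho := risk v w p F beta x0 + pnorm v w p x0.
have risk0 x : 0 <= risk v w p F beta x by apply: Ex_ge0 => k; rewrite mulr_ge0 ?powR_ge0.
have pn0 x : 0 <= pnorm v w p x by apply: Ex_ge0 => k; rewrite mulr_ge0 ?powR_ge0.
have rho_ge0 : 0 <= rho by rewrite addr_ge0.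
pose J (S : {ffun 'I_m -> 'I_(2 * n)}) := sketch_objective p f A (fun i => om i / rownorm U i `^ p)
  (e * L `^ p) (fun j => g (S j)) (fun j => b (g (S j)) 0).
have JE S x : J S x = L `^ p * (sample_risk v w p F beta S (coords E x) + e * pnorm v w p (coords E x)).
  exact: sketch_objective_risk.
have RE x : resid p f A b x - resid p f A b xs = L `^ p * (risk v w p F beta (coords E x) - risk v w p F beta x0).
  exact: resid_risk.
have RL : L `^ p * risk v w p F beta x0 <= resid p f A b xs by exact: risk_le_resid.
have PE x : pnorm v w p (coords E x) = lpp p (A *m x) by exact: pnorm_coords.
have sr0 (S : {ffun 'I_m -> 'I_(2 * n)}) x : 0 <= sample_risk v w p F beta S x.
  by apply: sumr_ge0 => j _; rewrite mulr_ge0 ?powR_ge0// divr_ge0.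
(* With rho = 0 there is no scale to normalise by. The sketched objective then vanishes at [xs],
   hence at xh, and the regulariser forces A xh = 0 = A xs. *)
have [rho_eq0|rho_neq0] := eqVneq rho 0.
  have rx : risk v w p F beta x0 = 0 by move: (risk0 x0) (pn0 x0) rho_eq0; rewrite /rho; clear; lra.
  have px : pnorm v w p x0 = 0 by move: (risk0 x0) (pn0 x0) rho_eq0; rewrite /rho; clear; lra.
  have loss0 k : w k * loss p F beta k (dot (v k) x0) = 0.
    move/eqP: rx; rewrite /risk /Ex mulf_eq0 invr_eq0 pnatr_eq0 (gtn_eqF I0) orbF.
    rewrite psumr_eq0 => [/allP/(_ k (mem_index_enum _))/eqP //|i _].
    by rewrite mulr_ge0 ?powR_ge0.
  have Jxs S : J S xs = 0.
    rewrite JE -/x0 px mulr0 addr0 /sample_risk big1 ?mulr0// => j _.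
    by rewrite /sweight mulrAC loss0 mul0r.
  have F0 : (0 < #|{ffun 'I_m -> 'I_(2 * n)}|)%N by rewrite card_ffun expn_gt0 I0.
  rewrite Pr_eq1//; first by clear; lra.
  move=> S xh.
  rewrite -/e -/(J S) /= Jxs mulr0 JE pmulr_rle0// => h.
  have Axh : A *m xh = 0.
    apply: (@lpp_eq0 _ p); rewrite -PE.
    have : e * pnorm v w p (coords E xh) <= 0 by move: h (sr0 S (coords E xh)); clear; lra.
    by rewrite pmulr_rle0.
  have Axs : A *m xs = 0 by apply: (@lpp_eq0 _ p); rewrite -PE -/x0 px.
  rewrite {1}/resid Axh -Axs lerDl; apply: mulr_ge0; first exact: ltW.
  by apply: addr_ge0; [exact: lpp_ge0|apply: mulr_ge0; [exact: ltW|exact: lpp_ge0]].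
have rho0 : 0 < rho by rewrite lt0r rho_neq0.
have main := sampled_regression I0 m_gt0 p1 w0 wW W0 CL1 v1 lewisv B1 pB FL e_gt0 e_le1 rho0 (lexx _)
  h1 h2 h3 h4 h5 h6 h7 h8 h9 h10 h11 h12 h13.
apply: (le_trans main); apply: Pr_le => S hS xh; rewrite -/e -/(J S) /=.
rewrite !JE [(1 + e) * (L `^ p * _)]mulrCA ler_pM2l// => /hS; rewrite -defC => h.
rewrite -lerBlDl RE.
have -> : eps = C * e by rewrite /e mulrC divfK// gt_eqF.
rewrite -PE -/x0; apply: (@le_trans _ _ (L `^ p * (C * (e * rho)))).
  by rewrite ler_pM2l// lerBlDl.
rewrite (_ : L `^ p * (C * (e * rho)) = C * e * (L `^ p * risk v w p F beta x0 + L `^ p * pnorm v w p x0)); last by rewrite /rho; ring.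
by apply: ler_wpM2l; [apply: mulr_ge0; exact: ltW|rewrite lerD2r].
Qed.

(** * The randomised algorithm *)

Lemma slack_ge0 (R : realType) (n d : nat) (p eps L : R) f (A : 'M[R]_(n, d)) b x :
  0 <= eps -> 0 <= eps * (resid p f A b x + L `^ p * lpp p (A *m x)).
Proof.
move=> e0; apply: mulr_ge0 => //; apply: addr_ge0; first exact: lpp_ge0.
by apply: mulr_ge0; [exact: powR_ge0|exact: lpp_ge0].
Qed.

Local Open Scope classical_set_scope.

Theorem theorem1 (R : realType) :
  exists c0 : R, forall p : R, 1 <= p ->
  exists Cp eps0 : R, 0 < eps0 /\
  forall (n d : nat) (eps : R), 0 < eps -> eps < eps0 ->
  exists (dsp : measure_display) (Omega : measurableType dsp)
         (P : probability Omega R) (Q : nat)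
         (qry : Omega -> 'M[R]_(n, d) -> (R -> R) -> seq R -> option 'I_n)
         (out : Omega -> 'M[R]_(n, d) -> (R -> R) -> seq R -> 'cV[R]_d),
    Q%:R <= Cp * (d%:R `^ Num.max 1 (p / 2) / eps `^ Num.max 2 p)
                * (ln (d%:R / eps)) `^ c0 /\
    forall (A : 'M[R]_(n, d)) (f : R -> R) (L : R) (b : 'cV[R]_n),
      0 <= L -> Lip L f ->
      forall xstar : 'cV[R]_d,
        (forall x, resid p f A b xstar <= resid p f A b x) ->
        (forall x, resid p f A b x = resid p f A b xstar ->
                   lpp p (A *m xstar) <= lpp p (A *m x)) ->
        let OPT := resid p f A b xstar in
        let S := [set w : Omega |
                   resid p f A b (out w A f (transcript b (qry w A f) Q))
                   <= OPT + eps * (OPT + L `^ p * lpp p (A *m xstar))] in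
        measurable S /\ ((9 / 10)%:E <= P S)%E.
Proof.
exists 5 => p p1; have p0 : 0 < p by exact: lt_le_trans p1.
have [C [T [C1 T1 main]]] := sketched_regression p1.
have C0 : 0 < C by exact: lt_le_trans C1.
(* eps < exp (-T) ensures ln (d / eps) >= T for every d >= 1. *)
exists 2, (Num.min 1 (expR (- T))); split; first by rewrite lt_min ltr01 expR_gt0.
move=> n d eps e0; rewrite lt_min => /andP[e1 eT].
(* In these cases all x have the same residual, and no query is made. *)
have [triv|] := boolP ((n == 0%N) || (d == 0%N)).
  have U0 : (0 < #|{: unit}|)%N by rewrite card_unit.
  have [dsp [Om [P _]]] := uniform_probability_space R U0.
  exists dsp, Om, P, 0%N, (fun _ _ _ _ => None), (fun _ _ _ _ => 0); split.
    by rewrite !mulr_ge0 ?invr_ge0 ?powR_ge0.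
  move=> A f L b L0 fL xstar _ _ /=.
  have E : resid p f A b 0 = resid p f A b xstar.
    case/orP: triv => /eqP h; last by subst d; rewrite [xstar]flatmx0.
    by subst n; rewrite /resid /lpp !big_ord0.
  set S := [set _ | _]; have -> : S = setT.
    by apply/seteqP; split=> // w _; rewrite /S/= E lerDl; apply: slack_ge0; exact: ltW.
  split; first exact: measurableT.
  by rewrite probability_setT lee_fin; lra.
rewrite negb_or -!lt0n => /andP[n0 d0].
have D0 : 0 < d%:R :> R by rewrite ltr0n.
pose Lam := ln (d%:R / eps).
have TL : T <= Lam.
  rewrite -[T]expRK ler_ln ?posrE ?expR_gt0 ?divr_gt0// ler_pdivlMr//.
  apply: (@le_trans _ _ 1); last by rewrite ler1n.
  by rewrite -(expRxMexpNx_1 T) ler_pM2l ?expR_gt0// ltW.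
have [m mle H] := main n d eps Lam n0 d0 e0 e1 erefl TL.
pose I := {ffun 'I_m -> 'I_(2 * n)}.
have I0 : (0 < #|{: I}|)%N by rewrite card_ffun !card_ord expn_gt0 muln_gt0 n0.
have [dsp [Om [P [dec PE]]]] := uniform_probability_space R I0.
(* The strategy is a function of A, so the sampling data are selected for all matrices at once. *)
have /choice[G HG] : forall A : 'M[R]_(n, d), exists gc : ('I_(2 * n) -> 'I_n) * ('I_n -> R),
  (forall i, 0 <= gc.2 i) /\
  forall (f : R -> R) (L : R) (b : 'cV[R]_n), 0 < L -> Lip L f -> forall xs : 'cV[R]_d,
  9 / 10 <= Pr R (fun S : I => forall xh,
    let J := sketch_objective p f A gc.2 (eps / C * L `^ p) (fun j => gc.1 (S j)) (fun j => b (gc.1 (S j)) 0) in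
    J xh <= (1 + eps / C) * J xs ->
    resid p f A b xh <= resid p f A b xs + eps * (resid p f A b xs + L `^ p * lpp p (A *m xs))).
  by move=> A; have [g [c h]] := H A; exists (g, c).
have /choice[lip lipP] : forall f : R -> R, exists l : R, forall L, 0 <= L -> Lip L f ->
    [/\ 0 <= l, Lip l f & l <= L].
  move=> f; have [[L [L0 fL]]|h] := pselect (exists L, 0 <= L /\ Lip L f).
    have [l [l0 fl ll]] := least_lipschitz L0 fL; exists l => L' L'0 fL'.
    by split=> //; exact: ll.
  by exists 0 => L L0 fL; exfalso; apply: h; exists L.
pose J (S : I) A f (s : 'I_m -> R) := sketch_objective p f A (G A).2 (eps / C * lip f `^ p) (fun j => (G A).1 (S j)) s.
pose qry (S : I) (A : 'M[R]_(n, d)) (f : R -> R) (s : seq R) : option 'I_n :=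
  omap (fun j => (G A).1 (S j)) (insub (size s)).
(* An arbitrary approximate minimiser; for Lipschitz f with [lip f] positive,
   [sketch_near_minimizer] shows that one exists. *)
pose out (S : I) A f (s : seq R) : 'cV[R]_d :=
  xget 0 [set x | forall z, J S A f (fun j => s`_j) x <= (1 + eps / C) * J S A f (fun j => s`_j) z].
exists dsp, Om, P, m, (qry \o dec), (out \o dec); split.
  by rewrite powR_mulrn//; apply: le_trans TL; exact: le_trans T1.
move=> A f L b L0 fL xstar _ _ OPT; rewrite /OPT {OPT}.
pose good S := resid p f A b (out S A f (transcript b (qry S A f) m)) <=
  resid p f A b xstar + eps * (resid p f A b xstar + L `^ p * lpp p (A *m xstar)).
have [mS PS] := PE good; rewrite /= -/(good _); split; first exact: mS.
rewrite [X in (_ <= X)%E]PS lee_fin.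
have [l0 fl lL] := lipP f L L0 fL; have [c0 HA] := HG A.
have lpL : lip f `^ p <= L `^ p by apply: ge0_ler_powR => //; exact: ltW.
(* For [lip f] = 0 the regulariser disappears; but then f is zero and every x has the same
   residual. *)
have [lf0|lf_neq0] := eqVneq (lip f) 0.
  have fE t : f t = 0.
    by have := fl.2 t 0; rewrite fl.1 lf0 mul0r subr0 normr_le0 => /eqP.
  rewrite Pr_eq1//; first by lra.
  move=> S; rewrite /good.
  have E x : resid p f A b x = resid p f A b xstar.
    by apply: eq_bigr => i _; rewrite !mxE !fE.
  by rewrite E lerDl; apply: slack_ge0; exact: ltW.
have lf_gt0 : 0 < lip f by rewrite lt0r lf_neq0.
apply: (le_trans (HA f (lip f) b lf_gt0 fl xstar)); apply: Pr_le => S hS; rewrite /good.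
apply: (@le_trans _ _ (resid p f A b xstar + eps * (resid p f A b xstar + lip f `^ p * lpp p (A *m xstar)))).
  apply: hS => /=; have trE : (fun j : 'I_m => (transcript b (qry S A f) m)`_j) = (fun j : 'I_m => b ((G A).1 (S j)) 0).
    by apply/funext => j; rewrite transcriptE.
  rewrite /out trE; apply: (@xgetPex _ 0 [set x | forall z, J S A f _ x <= (1 + eps / C) * J S A f _ z]).
  apply: (sketch_near_minimizer p1 _ _ _ l0 fl) => //; last by rewrite divr_gt0.
  by rewrite mulr_gt0 ?powR_gt0 ?divr_gt0.
rewrite lerD2l; apply: ler_wpM2l; first exact: ltW.
by rewrite lerD2l; apply: ler_wpM2r => //; exact: lpp_ge0.
Qed.
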